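(* Let $X$ be any of the spaces $l^p_a$ $(1<p\le\infty)$, $c_{0,a}$, or $X_q$ $(1\le q<\infty)$. Then the set of totally unbounded functions in $X$ is a $G_\delta$ and dense subset of $X$, and the same is true for the set of non-extendable functions in $X$.
   Context: $D$ is the open unit disc in $\mathbb{C}$. For a holomorphic function $f$ on $D$ write $f(z)=\sum_{n=0}^\infty a_n(f)z^n$. For $0<p<\infty$, $l^p_a$ is the space of holomorphic functions $f$ on $D$ with $\sum_{n=0}^\infty|a_n(f)|^p<\infty$; $l^\infty_a$ is the space of those with $\sup_n|a_n(f)|<\infty$; $c_{0,a}$ is the space of those with $a_n(f)\to0$. For $1\le p\le\infty$, $l^p_a$ carries the norm inherited from the sequence space $l^p$, i.e. the metric $d_p(f,g)=\big(\sum_n|a_n(f)-a_n(g)|^p\big)^{1/p}$ (or $d_\infty(f,g)=\sup_n|a_n(f)-a_n(g)|$ if $p=\infty$); for $0<p<1$ it carries the metric $d_p(f,g)=\sum_n|a_n(f)-a_n(g)|^p$; $c_{0,a}$ carries the norm inherited from $l^\infty_a$. For $0\le q<\infty$, $X_q=\bigcap_{p>q}l^p_a$ with the metric $\sum_{n=0}^\infty\frac1{2^n}\frac{d_{p_n}(f,g)}{1+d_{p_n}(f,g)}$, where $(p_n)$ is a strictly decreasing sequence converging to $q$. A function $g:D\to\mathbb{C}$ is called totally unbounded (on $D$) if for every open disc $B(\zeta,\varepsilon)$ with $\varepsilon>0$ and $\zeta\in\partial D$ and every connected component $Y$ of $B(\zeta,\varepsilon)\cap D$ the restriction $g|_Y$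 is unbounded. A holomorphic function $f$ on $D$ is called extendable if there exist a domain (nonempty connected open set) $U\subset\mathbb{C}$ with $\partial D\cap U\neq\emptyset$ and a holomorphic function $F$ on $U$ such that $f|_Y=F|_Y$ for some connected component $Y$ of $U\cap D$. Otherwise $f$ is called non-extendable. *)

(* Defs.v *)
From HB Require Import structures.
From mathcomp Require Import all_boot all_order all_algebra.
From mathcomp Require Import complex.
From mathcomp Require Import all_classical all_reals all_analysis.
From mathcomp Require Import borel_hierarchy.

Set Implicit Arguments.
Unset Strict Implicit.
Unset Printing Implicit Defensive.

Import Order.TTheory GRing.Theory Num.Theory.
Import numFieldNormedType.Exports.

Local Open Scope classical_set_scope.
Local Open Scope ring_scope.

(* The field of complex numbers over R, seen as a normed space over itself. *)
Notation Cplx R := ((complex R)^o).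

(* The library norm of complex R takes its values in complex R; this is the
   R-valued modulus. *)
Notation modulus := ComplexField.Normc.normc.

Section MetricTopology.
Context {R : realType} {T : choiceType}.

(* The subset A of T, as a type of its own, with the topology whose open sets
   are the O such that every point of O is the centre of a d-ball of A lying
   in O. *)
Definition metric_sub (A : set T) (d : T -> T -> R) : Type := set_type A.

Variables (A : set T) (d : T -> T -> R).

HB.instance Definition _ := Choice.copy (metric_sub A d) (set_type A).

Definition metric_open : set_system (metric_sub A d) :=
  [set O | forall f, O f -> exists2 e : R, 0 < e &
    forall g : metric_sub A d, d (set_val f) (set_val g) < e -> O g].

Let metric_openT : metric_open setT.
Proof. by move=> f _; exists 1. Qed.

Let metric_openI : setI_closed metric_open.
Proof.
move=> O P oO oP f [/oO[e e0 eO] /oP[e' e'0 eP]].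
exists (Num.min e e'); first by rewrite lt_min e0.
by move=> g; rewrite lt_min => /andP[/eO Og /eP Pg].
Qed.

Let metric_open_bigU (I : Type) (F : I -> set (metric_sub A d)) :
  (forall i, metric_open (F i)) -> metric_open (\bigcup_i F i).
Proof.
by move=> oF f [i _ /oF[e e0 eF]]; exists e => // g /eF Fg; exists i.
Qed.

HB.instance Definition _ := isOpenTopological.Build (metric_sub A d)
  metric_openT metric_openI metric_open_bigU.

Lemma metric_openE : @open (metric_sub A d) = metric_open.
Proof. by []. Qed.

End MetricTopology.

Section Disc.
Context {R : realType}.
Local Notation C := (Cplx R).
Implicit Types (f g : C -> C) (U Y : set C).

Definition disc (c : C) (r : R) : set C := [set z | modulus (z - c) < r].

Definition unit_disc : set C := disc 0 1.

Definition unit_circle : set C := [set z | modulus z = 1].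

Definition holomorphic_on U f := forall z, U z -> derivable f z 1.

(* A holomorphic function on the unit disc is represented by its extension by
   0 to the whole plane, so that equality of representatives is equality on
   the disc. *)
Definition holomorphic_disc f :=
  holomorphic_on unit_disc f /\ (forall z, ~ unit_disc z -> f z = 0).

(* The sequence a such that f z = \sum_n a n * z ^+ n on the unit disc (0 if
   there is none). *)
Definition coef f : nat -> C :=
  xget (fun=> 0) [set a | forall z, unit_disc z ->
    series (fun n => a n * z ^+ n) @ \oo --> f z].

(* Meaningful for 0 < p; the case p = -oo is junk. *)
Definition lpa (p : \bar R) : set (C -> C) :=
  [set f | holomorphic_disc f /\
    match p with
    | r%:E => (\sum_(0 <= n <oo) (modulus (coef f n) `^ r)%:E < +oo)%E
    | +oo%E => (ereal_sup (range (fun n => (modulus (coef f n))%:E)) < +oo)%E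
    | -oo%E => False
    end].

Definition dist_lpa (p : \bar R) f g : R :=
  match p with
  | r%:E =>
      let s := fine
        (\sum_(0 <= n <oo) (modulus (coef f n - coef g n) `^ r)%:E)%E in
      if r < 1 then s else s `^ r^-1
  | +oo%E => sup (range (fun n => modulus (coef f n - coef g n)))
  | -oo%E => 0
  end.

Definition c0a : set (C -> C) :=
  [set f | holomorphic_disc f /\ coef f @ \oo --> (0 : C)].

Definition Xq (q : R) : set (C -> C) :=
  \bigcap_(p in [set p : R | q < p]) lpa p%:E.

Definition dist_Xq (pn : nat -> R) f g : R :=
  limn (series (fun n => (2 ^+ n)^-1 *
    (dist_lpa (pn n)%:E f g / (1 + dist_lpa (pn n)%:E f g)))).

Definition is_component (A Y : set C) :=
  exists2 z, A z & Y = connected_component A z.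

Definition unbounded_on Y f := ~ exists M : R, forall z, Y z -> modulus (f z) <= M.

Definition totally_unbounded f :=
  forall (zeta : C) (e : R), unit_circle zeta -> 0 < e ->
    forall Y, is_component (disc zeta e `&` unit_disc) Y -> unbounded_on Y f.

Definition extendable f :=
  exists (U : set C) (F : C -> C),
    [/\ open U, connected U, U !=set0 & unit_circle `&` U !=set0] /\
    holomorphic_on U F /\
    exists2 Y, is_component (U `&` unit_disc) Y & forall z, Y z -> f z = F z.

End Disc.

(* Main.v *)
(**
  A function that extends across a boundary point is bounded near some boundary point, so
  totally unbounded functions are non-extendable and density only has to be proved for
  them. For this, take the lacunary series [g = \sum_k c_k z^(2^k)] with [(c_k)] in every
  l^p, p > 1, but not in l^1: at a point [t w] with [w] a dyadic root of unity all but
  finitely many terms are positive, so [g] is unbounded along a dense set of radii. For a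
  given [f] and a given disc of a countable family, [f + delta g] is bounded near the
  boundary for at most one [delta]; hence arbitrarily small [delta] make [f + delta g]
  totally unbounded, and no completeness is needed.

  Both sets are G_delta because they are defined by countably many strict inequalities
  between functionals that are continuous for the sup norm of the Taylor coefficients:
  point values for total unboundedness, and the Taylor coefficients [b_n] of [f] at
  rational points [w] of the disc for non-extendability, as [f] extends to a disc of
  centre [w] that crosses the unit circle iff [b_n r^n] is bounded for some [r > 1 - |w|].
  This uses that functions which are merely complex differentiable have Taylor expansions,
  which rests on Goursat's argument.
*)

Require Import Defs.
From mathcomp Require Import all_boot all_order all_algebra.
From mathcomp Require Import complex.
From mathcomp Require Import all_classical all_reals all_analysis.
From mathcomp Require Import borel_hierarchy.
From mathcomp Require Import ring lra.
Set Implicit Arguments.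
Unset Strict Implicit.
Unset Printing Implicit Defensive.
Import Order.TTheory GRing.Theory Num.Theory.
Import numFieldNormedType.Exports.
Local Open Scope classical_set_scope.
Local Open Scope ring_scope.

(** * Complex numbers with the real-valued modulus *)

Section modulus.
Context {R : realType}.
Local Notation C := (Cplx R).
Implicit Types (z w : C) (x : R).

(** For [p <= 1] a sequence in l^p is summable and its power series is bounded on the disc. The
    range [1 < p] is what leaves room for the coefficients of [g], which are not summable and yet
    lie in every l^p with [p > 1], so that a single [g] serves all the spaces. A space enters only
    through two facts: a small distance makes all coefficient differences small at once, and
    [f + delta g] stays in the space and tends to [f] as [delta] tends to 0. Most of the length is
    complex analysis. Contour integrals are never formed there: an integral along a segment or a
    circle is the increment of a primitive of a path with real parameter, and every estimate of such
    an integral is a mean value inequality. *)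

Lemma modulusE z : `|z| = (modulus z)%:C%C. Proof. by []. Qed.

Lemma modulus_ge0 z : 0 <= modulus z. Proof. by rewrite -lecR -modulusE normr_ge0. Qed.

Lemma modulusD z w : modulus (z + w) <= modulus z + modulus w.
Proof. exact: le_normcD. Qed.

Lemma modulusN z : modulus (- z) = modulus z. Proof. exact: normcN. Qed.

Lemma modulusBC z w : modulus (z - w) = modulus (w - z).
Proof. by rewrite -modulusN opprB. Qed.

Lemma modulusM z w : modulus (z * w) = modulus z * modulus w.
Proof. exact: ComplexField.Normc.normcM. Qed.

Lemma lerB_modulus z w : modulus z - modulus w <= modulus (z - w).
Proof. rewrite lerBlDr. apply: le_trans (modulusD _ _). by rewrite subrK. Qed.

Lemma modulus0 : modulus (0 : C) = 0. Proof. exact: ComplexField.Normc.normc0. Qed.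

Lemma modulus1 : modulus (1 : C) = 1. Proof. exact: ComplexField.Normc.normc1. Qed.

Lemma modulus_eq0 z : (modulus z == 0) = (z == 0).
Proof.
apply/eqP/eqP => [|->]; [exact: ComplexField.Normc.eq0_normc|exact: modulus0].
Qed.

Lemma modulus_gt0 z : (0 < modulus z) = (z != 0).
Proof. by rewrite lt_neqAle modulus_ge0 andbT eq_sym modulus_eq0. Qed.

Lemma modulusX z n : modulus (z ^+ n) = modulus z ^+ n.
Proof. by elim: n => [|n IH]; rewrite ?expr0 ?modulus1// !exprS modulusM IH. Qed.

Lemma modulusV z : modulus z^-1 = (modulus z)^-1.
Proof. exact: ComplexField.Normc.normcV. Qed.

Lemma modulus_real x : modulus (x%:C%C : C) = `|x|.
Proof. by rewrite /= expr0n/= addr0 sqrtr_sqr. Qed.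

Lemma modulus_sum (I : Type) (r : seq I) (P : pred I) (F : I -> C) :
  modulus (\sum_(i <- r | P i) F i) <= \sum_(i <- r | P i) modulus (F i).
Proof.
elim/big_ind2 : _ => [|x1 x2 y1 y2 h1 h2|//]; first by rewrite modulus0.
by apply: le_trans (modulusD _ _) _; rewrite lerD.
Qed.

Lemma Re_modulus z : `|complex.Re z| <= modulus z.
Proof. case: z => a b /=. rewrite -sqrtr_sqr ler_wsqrtr// lerDl sqr_ge0//. Qed.

Lemma Im_modulus z : `|complex.Im z| <= modulus z.
Proof. case: z => a b /=. rewrite -sqrtr_sqr ler_wsqrtr// lerDr sqr_ge0//. Qed.

Lemma modulus_ReIm z : modulus z <= `|complex.Re z| + `|complex.Im z|.
Proof.
case: z => a b /=. rewrite -(@ler_pXn2r _ 2) ?nnegrE ?addr_ge0//.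
rewrite sqr_sqrtr ?addr_ge0 ?sqr_ge0// sqrrD !real_normK ?num_real// lerD2r lerDl
  mulrn_wge0// mulr_ge0//.
Qed.

(** Neighbourhoods in [C] have radii in [C] itself. In the order of [C], [0 < e] forces [e] to be a
    positive real, which turns them into epsilon conditions over [R]. *)
Lemma cvg_modulus (u : nat -> C) (l : C) :
  u @ \oo --> l <-> (modulus (u n - l) @[n --> \oo] --> (0:R)).
Proof.
split => [/cvgrPdist_lt h|/cvgrPdist_lt h]; apply/cvgrPdist_lt => e e0.
  have := h e%:C%C; rewrite ltcR => /(_ e0); apply: filterS => n.
  by rewrite modulusE ltcR sub0r normrN ger0_norm ?modulus_ge0// modulusBC.
have [re e0'] : (0 < complex.Re e) /\ e = (complex.Re e)%:C%C.
  by case: e e0 => a b; rewrite ltcE /= => /andP[/eqP -> ->].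
have := h _ re; apply: filterS => n.
by rewrite modulusE e0' ltcR sub0r normrN ger0_norm ?modulus_ge0// modulusBC.
Qed.

Lemma nbhs_disc z (A : set C) : nbhs z A <-> exists2 r : R, 0 < r & disc z r `<=` A.
Proof.
split => [/nbhs_ballP[e /= e0 h]|[r r0 h]].
  have [re e0'] : (0 < complex.Re e) /\ e = (complex.Re e)%:C%C.
    by case: e e0 {h} => a b; rewrite ltcE /= => /andP[/eqP -> ->].
  exists (complex.Re e) => // w wz; apply: h.
  by rewrite -ball_normE /ball_ /= e0' modulusE ltcR modulusBC.
apply/nbhs_ballP; exists r%:C%C; first by rewrite /= ltcR.
move=> w; rewrite -ball_normE /ball_ /= modulusE ltcR modulusBC; exact: h.
Qed.

Lemma open_disc (U : set C) : open U <-> forall z, U z -> exists2 r : R, 0 < r & disc z r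
  `<=` U.
Proof.
rewrite openE; split => h z Uz; first exact/nbhs_disc/h.
exact/nbhs_disc/h.
Qed.

(** Differentiability in remainder form: without a quotient, [w = z] needs no exception and
    estimates add up directly. *)
Definition cdiff (f : C -> C) z d := forall e : R, 0 < e -> exists2 r : R, 0 < r &
  forall w, modulus (w - z) < r -> modulus (f w - f z - d * (w - z)) <= e * modulus (w - z).

Lemma derivable_cdiff (f : C -> C) z : derivable f z 1 <-> exists d, cdiff f z d.
Proof.
split => [|[d h]].
  rewrite /derivable; set g := (X in cvg X -> _) => /cvg_ex[/= d]; rewrite {}/g => h.
  exists d => e e0.
  move/cvgrPdist_lt : h => /(_ e%:C%C); rewrite ltcR => /(_ e0)/nbhs_disc[r r0 h].
  exists r => // w wr. have [->|wz] := eqVneq w z; first by rewrite !subrr mulr0 subrr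
    modulus0 mulr0.
  have := h (w - z); rewrite /disc /= subr0 => /(_ wr); rewrite subr_eq0 => /(_ wz).
  rewrite modulusE ltcR => /ltW h1.
  have -> : f w - f z - d * (w - z) = - ((d - (w - z)^-1 *: (f ((w - z) *: (1:C) + z) - f
    z)) * (w - z)).
    rewrite /GRing.scale /= mulr1 subrK. field. by rewrite subr_eq0.
  by rewrite modulusN modulusM ler_wpM2r ?modulus_ge0//.
apply/cvg_ex; exists d; apply/cvgrPdist_le => e e0.
have [re e0'] : (0 < complex.Re e) /\ e = (complex.Re e)%:C%C.
  by case: e e0 => a b; rewrite ltcE /= => /andP[/eqP -> ->].
have [r r0 hr] := h _ re.
apply/nbhs_disc; exists r => // w; rewrite /disc /= subr0 => wr w0.
rewrite e0' modulusE lecR.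
have := hr (w + z); rewrite addrK => /(_ wr).
have -> : f (w + z) - f z - d * w = - (d - w^-1 *: (f (w *: (1 : C) + z) - f z)) * w.
  by rewrite /GRing.scale /= mulr1; field.
by rewrite modulusM modulusN ler_pM2r // modulus_gt0.
Qed.
End modulus.

(** * Primitives of continuous paths *)

Section prim.
Context {R : realType}.

Lemma is_derive_zero_const (f : R -> R) (a b : R) : a <= b ->
  (forall x, a <= x <= b -> is_derive x 1 f 0) -> f b = f a.
Proof.
rewrite le_eqVlt => /predU1P[->//|ab] h.
have [||c _ /eqP] := @MVT R f (fun=> 0) a b ab.
- by move=> x; rewrite in_itv/= => /andP[/ltW ax /ltW xb]; apply: h; rewrite ax xb.
- apply: derivable_within_continuous => x; rewrite in_itv/= => xab.
  by have [] := h _ xab.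
by rewrite mul0r subr_eq0 => /eqP.
Qed.

Lemma continuous_antiderivative_gt (f : R -> R) (a : R) : continuous f ->
  exists F : R -> R, forall x : R, a < x -> is_derive x 1 F (f x).
Proof.
move=> cf; exists (fun x => \int[lebesgue_measure]_(t in [set` Interval (BLeft a) (BRight
  x)]) f t)%R.
move=> x ax.
have [||||d1 d2] := @continuous_FTC1 R f (BLeft a) x (x + 1).
- by rewrite ltrDl.
- apply: continuous_compact_integrable; first exact: segment_compact.
  exact: continuous_subspaceT.
- by rewrite /= lte_fin.
- exact: cf.
apply: DeriveDef; first exact: d1.
by move: d2; rewrite derive1E.
Qed.

(** Integrating from a base point gives an antiderivative only to the right of that point. The ones
    with base points [- n%:R], normalised to vanish at 0, agree where they overlap because their
    difference has derivative 0, and are glued. *)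
Lemma continuous_antiderivative (f : R -> R) : continuous f ->
  exists F : R -> R, forall x : R, is_derive x 1 F (f x).
Proof.
move=> cf.
have /choice[F hF] : forall n : nat, exists F : R -> R, forall x : R, - n%:R < x ->
  is_derive x 1 F (f x).
  by move=> n; apply: continuous_antiderivative_gt.
pose N (x : R) := (Num.truncn `|x|).+1.
have hN x : `|x| < (N x)%:R by exact: truncnS_gt.
have indep n m x : `|x| < n%:R -> `|x| < m%:R -> F n x - F n 0 = F m x - F m 0.
  move=> xn xm.
  have n0 : (0 : R) < n%:R by exact: le_lt_trans xn.
  have m0 : (0 : R) < m%:R by exact: le_lt_trans xm.
  have D y : - `|x| <= y -> is_derive y 1 (F n - F m) 0.
    move=> xy; rewrite -(subrr (f y)).
    by apply: is_deriveB; apply: hF; apply: lt_le_trans xy; rewrite ltrN2.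
  suff : (F n - F m) x = (F n - F m) 0 by rewrite !fctE; lra.
  have [x0|x0] := leP 0 x; [|apply/esym]; apply: is_derive_zero_const => //; first last.
  - by move=> y /andP[xy _]; apply: D; rewrite ltr0_norm// opprK.
  - exact: ltW.
  - by move=> y /andP[xy _]; apply: D; apply: le_trans xy; rewrite oppr_le0.
exists (fun x => F (N x) x - F (N x) 0) => x.
pose n := (N x).+1.
apply: (@near_eq_is_derive _ _ _ (fun y => F n y - F n 0)).
  near=> y.
  have xy : `|x - y| < 1.
    suff : ball x 1 y by rewrite -ball_normE.
    by near: y; exact: nbhsx_ballx.
  apply: indep => //.
  rewrite -[y](subKr x).
  apply: le_lt_trans (ler_normB _ _) _; rewrite /n -natr1 ltrD//.
rewrite -(subr0 (f x)).
apply: is_deriveB; apply: hF. rewrite ltrNl.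
have := hN x; rewrite /n -natr1; have := ler_norm (-x); rewrite normrN; lra.
Unshelve. all: by end_near. Qed.

End prim.

(** * Differentiable paths in the complex plane *)

Section pdiff.
Context {R : realType}.
Local Notation C := (Cplx R).
Local Notation Re := (@complex.Re R).
Local Notation Im := (@complex.Im R).
Implicit Types (G H : R -> C) (t a b : R).

Lemma is_derive_eps (f : R -> R) (x d : R) : is_derive x 1 f d <->
  (forall e : R, 0 < e -> exists2 r : R, 0 < r &
   forall y, `|y - x| < r -> `|f y - f x - d * (y - x)| <= e * `|y - x|).
Proof.
split => [[fd <-] e e0|h].
  move: fd; rewrite /derivable => /(@cvgrPdist_lt _ _ _ _ _) /(_ e e0)/nbhs_ballP[r /= r0 h].
  exists r => // y yr. have [->|yx] := eqVneq y x; first by rewrite !subrr mulr0 subrr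
    normr0 mulr0.
  have := h (y - x); rewrite /ball /= sub0r normrN => /(_ yr); rewrite subr_eq0 => /(_
    yx)/ltW h1.
  have -> : f y - f x - 'D_1 f x * (y - x) = - (('D_1 f x - (y - x)^-1 *: (f ((y - x) *:
    (1:R) + x) - f x)) * (y - x)).
    rewrite /GRing.scale /= mulr1 subrK. field. by rewrite subr_eq0.
  by rewrite normrN normrM ler_wpM2r.
have cv : (h^-1 *: ((f \o shift x) (h *: (1:R)) - f x)) @[h --> (0:R)^'] --> d.
  apply/cvgrPdist_le => e e0.
  have [r r0 hr] := h _ e0.
  apply/nbhs_ballP; exists r => // w; rewrite /ball /= sub0r normrN => wr w0.
  have := hr (w + x); rewrite addrK => /(_ wr).
  have -> : f (w + x) - f x - d * w = - (d - w^-1 *: (f (w *: (1 : R) + x) - f x)) * w.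
    by rewrite /GRing.scale /= mulr1; field.
  by rewrite normrM normrN ler_pM2r // normr_gt0.
apply: DeriveDef; first by apply/cvg_ex; exists d.
exact/cvg_lim.
Qed.

(** Coordinatewise, so that real differentiation rules and real antiderivatives apply at once;
    [pdiff_eps] recovers the remainder form used in the chain rule. *)
Definition pdiff G t (d : C) :=
  is_derive t 1 (Re \o G) (Re d) /\ is_derive t 1 (Im \o G) (Im d).

Lemma Re_real_mul (x : R) (z : C) : Re (x%:C%C * z) = x * Re z.
Proof. by case: z => u v /=; rewrite mul0r subr0. Qed.

Lemma Im_real_mul (x : R) (z : C) : Im (x%:C%C * z) = x * Im z.
Proof. by case: z => u v /=; rewrite mul0r addr0. Qed.

Lemma ReB (z w : C) : Re (z - w) = Re z - Re w. Proof. by case: z; case: w. Qed.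

Lemma ImB (z w : C) : Im (z - w) = Im z - Im w. Proof. by case: z; case: w. Qed.

Lemma ReD (z w : C) : Re (z + w) = Re z + Re w. Proof. by case: z; case: w. Qed.

Lemma ImD (z w : C) : Im (z + w) = Im z + Im w. Proof. by case: z; case: w. Qed.

Lemma ReM (z w : C) : Re (z * w) = Re z * Re w - Im z * Im w. Proof. by case: z; case: w. Qed.

Lemma ImM (z w : C) : Im (z * w) = Re z * Im w + Im z * Re w. Proof. by case: z; case: w. Qed.

Lemma pdiff_eps G t d : pdiff G t d <->
  (forall e : R, 0 < e -> exists2 r : R, 0 < r &
   forall s, `|s - t| < r -> modulus (G s - G t - (s - t)%:C%C * d) <= e * `|s - t|).
Proof.
split => [[/is_derive_eps h1 /is_derive_eps h2] e e0|h].
  have e20 : 0 < e / 2 by lra.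
  have [r1 r10 {}h1] := h1 _ e20; have [r2 r20 {}h2] := h2 _ e20.
  exists (Num.min r1 r2); first by rewrite lt_min r10.
  move=> s; rewrite lt_min => /andP[/h1 {}h1 /h2 {}h2].
  apply: le_trans (modulus_ReIm _) _.
  rewrite !ReB !ImB Re_real_mul Im_real_mul ![(s - t) * _]mulrC.
  by apply: le_trans (lerD h1 h2) _; rewrite -mulrDl -splitr.
split; apply/is_derive_eps => e e0; have [r r0 {}h] := h _ e0; exists r => // s /h {}h;
  apply: le_trans h.
  by apply: le_trans (Re_modulus _); rewrite !ReB Re_real_mul mulrC.
by apply: le_trans (Im_modulus _); rewrite !ImB Im_real_mul mulrC.
Qed.

Lemma pdiffD G H t d d' : pdiff G t d -> pdiff H t d' -> pdiff (fun s => G s + H s) t (d + d').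
Proof.
move=> [g1 g2] [h1 h2]; split.
  have -> : Re \o (fun s => G s + H s) = (Re \o G) + (Re \o H).
    by apply/funext => s; rewrite fctE /= ReD.
  by rewrite ReD; apply: is_deriveD.
have -> : Im \o (fun s => G s + H s) = (Im \o G) + (Im \o H).
  by apply/funext => s; rewrite fctE /= ImD.
by rewrite ImD; apply: is_deriveD.
Qed.

Lemma pdiffM G H t d d' : pdiff G t d -> pdiff H t d' ->
  pdiff (fun s => G s * H s) t (d * H t + G t * d').
Proof.
move=> [g1 g2] [h1 h2]; split.
  have -> : Re \o (fun s => G s * H s) = (Re \o G) * (Re \o H) - (Im \o G) * (Im \o H).
    by apply/funext => s; rewrite !fctE /= ReM.
  apply: (is_derive_eq (is_deriveB (is_deriveM g1 h1) (is_deriveM g2 h2))).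
  by rewrite /GRing.scale /= ReD !ReM; ring.
have -> : Im \o (fun s => G s * H s) = (Re \o G) * (Im \o H) + (Im \o G) * (Re \o H).
  by apply/funext => s; rewrite !fctE /= ImM.
apply: (is_derive_eq (is_deriveD (is_deriveM g1 h2) (is_deriveM g2 h1))).
by rewrite /GRing.scale /= ImD !ImM; ring.
Qed.

Lemma pdiff_cst (c : C) t : pdiff (fun=> c) t 0.
Proof. by split; apply: is_derive_cst. Qed.

Lemma pdiff_id t : pdiff (fun s => s%:C%C) t 1.
Proof. by split; [apply: is_derive_id|apply: is_derive_cst]. Qed.

Lemma pdiffZ G t d c : pdiff G t d -> pdiff (fun s => c * G s) t (c * d).
Proof. by move=> /(pdiffM (pdiff_cst c t)); rewrite mul0r add0r. Qed.

Lemma pdiffB G H t d d' : pdiff G t d -> pdiff H t d' -> pdiff (fun s => G s - H s) t (d - d').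
Proof.
move=> g /(pdiffZ (-1)); rewrite mulN1r => h.
have := pdiffD g h; congr pdiff; by apply/funext => s; rewrite mulN1r.
Qed.

Lemma pdiffX G t d n : pdiff G t d -> pdiff (fun s => G s ^+ n) t (n%:R * G t ^+ n.-1 * d).
Proof.
move=> g; elim: n => [|n IH].
  by rewrite mul0r mul0r; under [fun _ => _]eq_fun do rewrite expr0; exact: pdiff_cst.
under [fun _ => _]eq_fun do rewrite exprS.
have := pdiffM g IH; congr pdiff.
case: n {IH} => [|n]; first by rewrite !mul0r mulr0 addr0 expr0; ring.
by rewrite /= exprS -!natr1; ring.
Qed.

Lemma pdiff_comp (F : C -> C) G t d d' : cdiff F (G t) d -> pdiff G t d' ->
  pdiff (F \o G) t (d * d').
Proof.
(* [K] will be a Lipschitz constant of [G] at [t]. One half of [e] pays for the remainder of [F],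
   the other half for [d] times the remainder of [G]. *)
move=> hF /pdiff_eps hG; apply/pdiff_eps => e e0.
pose K := modulus d' + 1.
have K0 : 0 < K by rewrite ltr_wpDl ?modulus_ge0.
pose D := modulus d + 1.
have D0 : 0 < D by rewrite ltr_wpDl ?modulus_ge0.
have e10 : 0 < e / 2 / K by rewrite !divr_gt0.
have [r r0 {}hF] := hF _ e10.
have e20 : 0 < Num.min 1 (e / 2 / D) by rewrite lt_min ltr01 !divr_gt0.
have [r' r'0 {}hG] := hG _ e20.
exists (Num.min r' (r / K)); first by rewrite lt_min r'0 divr_gt0.
move=> s; rewrite lt_min => /andP[/hG {}hG].
rewrite ltr_pdivlMr // => sr.
have h1 : modulus (G s - G t) <= K * `|s - t|.
  have m1 : Num.min 1 (e / 2 / D) <= 1 by rewrite ge_min lexx.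
  rewrite -[X in modulus X](subrK ((s - t)%:C%C * d')).
  apply: le_trans (modulusD _ _) _; rewrite modulusM modulus_real.
  have := le_trans hG (ler_wpM2r (normr_ge0 _) m1).
  rewrite /K; lra.
have h2 : modulus (G s - G t) < r by rewrite (le_lt_trans h1)// mulrC.
have h3 := hF _ h2.
have -> : (F \o G) s - (F \o G) t - (s - t)%:C%C * (d * d') =
  (F (G s) - F (G t) - d * (G s - G t)) + d * (G s - G t - (s - t)%:C%C * d').
  by rewrite /=; ring.
apply: le_trans (modulusD _ _) _.
rewrite [e]splitr mulrDl lerD//.
  apply: le_trans h3 _; rewrite -mulrA ler_wpM2l//; first lra.
  by rewrite ler_pdivrMl.
rewrite modulusM.
apply: (@le_trans _ _ (D * (e / 2 / D * `|s - t|))); last first.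
  by rewrite mulrA mulrCA divff ?mulr1// gt_eqF.
apply: ler_pM; rewrite ?modulus_ge0//; first by rewrite /D; lra.
apply: le_trans hG _; rewrite ler_wpM2r//.
by rewrite ge_min lexx orbT.
Qed.

(** The mean value theorem fails for complex values, so it is applied to the real function
    [Re (c * G s)] with [c] the conjugate of [G b - G a]: its increment is the square of the modulus
    to be bounded. *)
Lemma pdiff_mvt G g a b M : a <= b -> (forall t, pdiff G t (g t)) ->
  (forall t, a <= t <= b -> modulus (g t) <= M) -> modulus (G b - G a) <= M * (b - a).
Proof.
rewrite le_eqVlt => /predU1P[->|ab] hG hM; first by rewrite !subrr modulus0 mulr0.
pose c := (G b - G a)^*%C : C.
pose phi (s : R) := Re (c * G s).
have dphi t : is_derive t 1 phi (Re (c * g t)) by have [] := pdiffZ c (hG t).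
have [|t tab] := @MVT R phi (fun s => Re (c * g s)) a b ab.
  by apply: derivable_within_continuous => t _; have [] := dphi t.
rewrite /phi -ReB -mulrBr => E.
have cc : Re (c * (G b - G a)) = modulus (G b - G a) ^+ 2.
  rewrite /c; case: (G b - G a) => u v /=; rewrite sqr_sqrtr ?addr_ge0 ?sqr_ge0//; ring.
have [->|nz] := eqVneq (modulus (G b - G a)) 0.
  rewrite mulr_ge0 ?subr_ge0 ?(ltW ab)//.
  by apply: le_trans (hM a _); rewrite ?modulus_ge0// lexx ltW.
have p : 0 < modulus (G b - G a) by rewrite lt_neqAle eq_sym nz modulus_ge0.
rewrite -(ler_pM2l p) -expr2 -cc E mulrA ler_wpM2r ?subr_ge0 ?(ltW ab)//.
apply: le_trans (ler_norm _) _; apply: le_trans (Re_modulus _) _; rewrite modulusM.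
apply: ler_pM; rewrite ?modulus_ge0//.
  by rewrite /c; case: (G b - G a) => u v /=; rewrite sqrrN.
by apply: hM; move: tab; rewrite in_itv /= => /andP[/ltW -> /ltW ->].
Qed.

Lemma pdiff_mvt_abs G g a b M : (forall t, pdiff G t (g t)) ->
  (forall t, Num.min a b <= t <= Num.max a b -> modulus (g t) <= M) -> modulus (G b - G a)
    <= M * `|b - a|.
Proof.
move=> hG; have [ab|ba] := leP a b => hM.
  by rewrite ger0_norm ?subr_ge0//; exact: (pdiff_mvt ab hG).
rewrite modulusBC ltr0_norm ?subr_lt0// opprB; exact: (pdiff_mvt (ltW ba) hG).
Qed.

Lemma continuous_Re : continuous (Re : C -> R).
Proof.
move=> z A /nbhs_ballP[e e0 h]; apply/nbhs_disc; exists e => // w; rewrite /disc /= => we.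
apply: h; rewrite -ball_normE /ball_ /=.
by rewrite -ReB (le_lt_trans (Re_modulus _))// modulusBC.
Qed.

Lemma continuous_Im : continuous (Im : C -> R).
Proof.
move=> z A /nbhs_ballP[e e0 h]; apply/nbhs_disc; exists e => // w; rewrite /disc /= => we.
apply: h; rewrite -ball_normE /ball_ /=.
by rewrite -ImB (le_lt_trans (Im_modulus _))// modulusBC.
Qed.

Lemma pdiff_antiderivative (g : R -> C) : continuous g ->
  exists G, forall t, pdiff G t (g t).
Proof.
move=> cg.
have [A hA] := @continuous_antiderivative _ (Re \o g) (fun t => continuous_comp (cg t)
  (@continuous_Re _)).
have [B hB] := @continuous_antiderivative _ (Im \o g) (fun t => continuous_comp (cg t)
  (@continuous_Im _)).
exists (fun t => (A t +i* B t)%C) => t; split; [exact: hA|exact: hB].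
Qed.

End pdiff.

(** * Goursat's theorem on rectangles *)

Section goursat.
Context {R : realType}.
Local Notation C := (Cplx R).
Local Notation Re := (@complex.Re R).
Local Notation Im := (@complex.Im R).
Implicit Types (x y a b t : R) (z w : C).

Definition pt x y : C := (x +i* y)%C.
Definition iu : C := ('i)%C.

Lemma ptE x y : pt x y = x%:C%C + iu * y%:C%C.
Proof.
by rewrite /iu; apply/eqP; rewrite eq_complex /= !mul0r !mul1r subrr !add0r !addr0 !eqxx.
Qed.

Lemma pt_eta z : pt (Re z) (Im z) = z. Proof. by case: z. Qed.

Lemma iu2 : iu * iu = -1.
Proof.
by apply/eqP; rewrite eq_complex /= ?mul0r ?mul1r ?mulr0 ?sub0r ?addr0 ?oppr0 ?eqxx.
Qed.

Lemma modulus_iu : modulus iu = 1.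
Proof. by rewrite /= expr0n /= add0r expr1n sqrtr1. Qed.

Lemma modulus_pt x y : modulus (pt x y) <= `|x| + `|y|.
Proof. exact: modulus_ReIm. Qed.

Lemma modulus_pt_le x y a b : `|a| <= `|x| -> `|b| <= `|y| -> modulus (pt a b) <= modulus
  (pt x y).
Proof.
move=> ax b_y /=; apply: ler_wsqrtr.
rewrite -(real_normK (num_real a)) -(real_normK (num_real b)).
rewrite -(real_normK (num_real x)) -(real_normK (num_real y)).
by rewrite lerD// ler_pXn2r ?nnegrE.
Qed.

Lemma pdiff_ptx x y : pdiff (fun s => pt s y) x 1.
Proof.
under [fun s => _]eq_fun do rewrite ptE.
by rewrite -[X in pdiff _ _ X]addr0; apply: pdiffD; [exact: pdiff_id|exact: pdiff_cst].
Qed.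

Lemma pdiff_pty x y : pdiff (pt x) y iu.
Proof.
rewrite (_ : pt x = fun s => x%:C%C + iu * s%:C%C); last by apply/funext => s; rewrite ptE.
rewrite -[X in pdiff _ _ X]add0r -[X in pdiff _ _ (_ + X)]mulr1; apply: pdiffD; first exact:
  pdiff_cst.
exact/pdiffZ/pdiff_id.
Qed.

Lemma continuous_pdiff (G : R -> C) g : (forall t, pdiff G t (g t)) -> continuous G.
Proof.
move=> h t A /nbhs_disc[r r0 rA].
have /pdiff_eps/(_ _ ltr01)[r' r'0 hr'] := h t.
pose K := 1 + modulus (g t) + 1.
have K0 : 0 < K by have := modulus_ge0 (g t); rewrite /K; lra.
apply/nbhs_ballP; exists (Num.min r' (r / K)); first by rewrite /= lt_min r'0 divr_gt0.
move=> s; rewrite -ball_normE /ball_ /= distrC lt_min => /andP[/hr' {}h1].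
rewrite ltr_pdivlMr // => sr; apply: rA; rewrite /disc /=.
rewrite -[X in modulus X](subrK ((s - t)%:C%C * g t)).
apply: le_lt_trans (modulusD _ _) _; rewrite modulusM modulus_real.
apply: le_lt_trans sr; rewrite /K; have := normr_ge0 (s - t). lra.
Qed.

Variable f : C -> C.
Hypothesis cf : continuous f.

Lemma continuous_ptx y : continuous (fun s => f (pt s y)).
Proof.
by move=> s; apply: continuous_comp; [exact: (continuous_pdiff (fun s => pdiff_ptx s
  y))|exact: cf].
Qed.

Lemma continuous_pty x : continuous (fun s => f (pt x s)).
Proof.
by move=> s; apply: continuous_comp; [exact: (continuous_pdiff (pdiff_pty x))|exact: cf].
Qed.

Variables H V : R -> R -> C.
Hypothesis hH : forall y x, pdiff (H y) x (f (pt x y)).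
Hypothesis hV : forall x y, pdiff (V x) y (f (pt x y)).

(* [H y] and [V x] are primitives of [f] along horizontal and vertical lines, so this is the
   integral of [f z dz] around the rectangle; the endpoints may come in any order. *)
Definition rint x1 x2 y1 y2 : C :=
  (H y1 x2 - H y1 x1) - (H y2 x2 - H y2 x1) +
  iu * ((V x2 y2 - V x2 y1) - (V x1 y2 - V x1 y1)).

(* The integral of the affine function [c + d (z - pt a b)] vanishes, as it has a primitive [P]. *)
Lemma rint_affine_bound x1 x2 y1 y2 a b (c d : C) (L e : R) :
  (forall x y, `|x - a| <= L -> `|y - b| <= L ->
     modulus (f (pt x y) - c - d * (pt x y - pt a b)) <= e) ->
  `|x1 - a| <= L -> `|x2 - a| <= L -> `|y1 - b| <= L -> `|y2 - b| <= L ->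
  modulus (rint x1 x2 y1 y2) <= 2 * e * (`|x2 - x1| + `|y2 - y1|).
Proof.
move=> hf hx1 hx2 hy1 hy2.
pose P z := c * z + d * ((z - pt a b) ^+ 2 / 2).
have PX y x : pdiff (fun s => P (pt s y)) x (c + d * (pt x y - pt a b)).
  have h := pdiffB (pdiff_ptx x y) (pdiff_cst (pt a b) x).
  have := pdiffD (pdiffZ c (pdiff_ptx x y)) (pdiffZ (d/2) (pdiffX 2 h)).
  congr pdiff; first by apply/funext => s; rewrite /P; field.
  by rewrite /= expr1; field.
have PY x y : pdiff (fun s => P (pt x s)) y (iu * (c + d * (pt x y - pt a b))).
  have h := pdiffB (pdiff_pty x y) (pdiff_cst (pt a b) y).
  have := pdiffD (pdiffZ c (pdiff_pty x y)) (pdiffZ (d/2) (pdiffX 2 h)).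
  congr pdiff; first by apply/funext => s; rewrite /P; field.
  by rewrite /= expr1; field.
have between (u v t m : R) : `|u - m| <= L -> `|v - m| <= L -> Num.min u v <= t <= Num.max u
  v -> `|t - m| <= L.
  rewrite !ler_norml => /andP[? ?] /andP[? ?]; case: (leP u v) => _ /andP[? ?]; lra.
have EX y : `|y - b| <= L -> modulus ((H y x2 - P (pt x2 y)) - (H y x1 - P (pt x1 y))) <= e
  * `|x2 - x1|.
  move=> hy; apply: (pdiff_mvt_abs (fun t => pdiffB (hH y t) (PX y t))) => t ht.
  rewrite opprD addrA; apply: hf => //; exact: between ht.
have EY x : `|x - a| <= L -> modulus ((iu * V x y2 - P (pt x y2)) - (iu * V x y1 - P (pt x
  y1))) <= e * `|y2 - y1|.
  move=> hx; apply: (pdiff_mvt_abs (fun t => pdiffB (pdiffZ iu (hV x t)) (PY x t))) => t ht.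
  rewrite -mulrBr modulusM modulus_iu mul1r opprD addrA; apply: hf => //; exact: between ht.
have -> : rint x1 x2 y1 y2 = ((H y1 x2 - P (pt x2 y1)) - (H y1 x1 - P (pt x1 y1))) +
  - ((H y2 x2 - P (pt x2 y2)) - (H y2 x1 - P (pt x1 y2))) +
  (((iu * V x2 y2 - P (pt x2 y2)) - (iu * V x2 y1 - P (pt x2 y1))) +
  - ((iu * V x1 y2 - P (pt x1 y2)) - (iu * V x1 y1 - P (pt x1 y1)))).
  by rewrite /rint; ring.
apply: le_trans (modulusD _ _) _.
apply: le_trans (lerD (modulusD _ _) (modulusD _ _)) _.
rewrite !(modulusN (_ - _)).
have := EX _ hy1; have := EX _ hy2; have := EY _ hx1; have := EY _ hx2.
lra.
Qed.

Lemma rint_swapx x1 x2 y1 y2 : rint x1 x2 y1 y2 = - rint x2 x1 y1 y2.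
Proof. by rewrite /rint; ring. Qed.

Lemma rint_swapy x1 x2 y1 y2 : rint x1 x2 y1 y2 = - rint x1 x2 y2 y1.
Proof. by rewrite /rint; ring. Qed.

Lemma rint_splitx x2 x1 x3 y1 y2 : rint x1 x3 y1 y2 = rint x1 x2 y1 y2 + rint x2 x3 y1 y2.
Proof. by rewrite /rint; ring. Qed.

Lemma rint_splity y2 x1 x2 y1 y3 : rint x1 x2 y1 y3 = rint x1 x2 y1 y2 + rint x1 x2 y2 y3.
Proof. by rewrite /rint; ring. Qed.

(** The integrals over the four quarters add up to the whole, so one of them carries at least a
    quarter of its modulus. *)
Lemma bisect_step x X y Y : exists x' y',
  [/\ modulus (rint x (x + X) y (y + Y)) <= 4 * modulus (rint x' (x' + X / 2) y' (y' + Y / 2)),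
    x' = x \/ x' = x + X / 2 & y' = y \/ y' = y + Y / 2].
Proof.
have E : rint x (x + X) y (y + Y) =
  (rint x (x + X / 2) y (y + Y / 2) + rint x (x + X / 2) (y + Y / 2) (y + Y / 2 + Y / 2)) +
  (rint (x + X / 2) (x + X / 2 + X / 2) y (y + Y / 2) +
   rint (x + X / 2) (x + X / 2 + X / 2) (y + Y / 2) (y + Y / 2 + Y / 2)).
  have -> : x + X / 2 + X / 2 = x + X by field.
  have -> : y + Y / 2 + Y / 2 = y + Y by field.
  by rewrite /rint; ring.
apply: contrapT => /forallNP hn.
have g (x' y' : R) : x' = x \/ x' = x + X / 2 -> y' = y \/ y' = y + Y / 2 ->
    4 * modulus (rint x' (x' + X / 2) y' (y' + Y / 2)) < modulus (rint x (x + X) y (y + Y)).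
  by move=> hx hy; rewrite ltNge; apply/negP => h; have /forallNP/(_ y') := hn x'; apply;
    split.
have := g x y (or_introl erefl) (or_introl erefl).
have := g x (y + Y / 2) (or_introl erefl) (or_intror erefl).
have := g (x + X / 2) y (or_intror erefl) (or_introl erefl).
have := g (x + X / 2) (y + Y / 2) (or_intror erefl) (or_intror erefl).
rewrite E.
have := modulusD (rint x (x + X / 2) y (y + Y / 2) + rint x (x + X / 2) (y + Y / 2) (y + Y /
  2 + Y / 2))
  (rint (x + X / 2) (x + X / 2 + X / 2) y (y + Y / 2) +
   rint (x + X / 2) (x + X / 2 + X / 2) (y + Y / 2) (y + Y / 2 + Y / 2)).
have := modulusD (rint x (x + X / 2) y (y + Y / 2)) (rint x (x + X / 2) (y + Y / 2) (y + Y /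
  2 + Y / 2)).
have := modulusD (rint (x + X / 2) (x + X / 2 + X / 2) y (y + Y / 2))
   (rint (x + X / 2) (x + X / 2 + X / 2) (y + Y / 2) (y + Y / 2 + Y / 2)).
lra.
Qed.

(** Nested intervals: left ends increase, right ends decrease, and the supremum of the left ends
    lies in all of them. *)
Lemma dyadic_cvg (u : nat -> R) X : 0 <= X ->
  (forall n, u n.+1 = u n \/ u n.+1 = u n + X / 2 ^+ n.+1) ->
  exists a, forall n, u n <= a <= u n + X / 2 ^+ n.
Proof.
move=> X0 hu.
have p2 n : 0 <= X / 2 ^+ n :> R by rewrite divr_ge0// exprn_ge0.
have E n : X / 2 ^+ n = X / 2 ^+ n.+1 + X / 2 ^+ n.+1.
  by rewrite exprS; field; rewrite expf_neq0.
have nd : nondecreasing_seq u.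
  by apply/nondecreasing_seqP => n; have := p2 n.+1; case: (hu n) => ->; lra.
have ni : nonincreasing_seq (fun n => u n + X / 2 ^+ n).
  apply/nonincreasing_seqP => n; rewrite (E n); have := p2 n.+1.
  by case: (hu n) => ->; lra.
have ub n m : u n <= u m + X / 2 ^+ m.
  have [nm|mn] := leqP n m.
    by apply: le_trans (nd _ _ nm) _; rewrite lerDl.
  by apply: le_trans (ni _ _ (ltnW mn)); rewrite lerDl.
exists (sup (range u)) => n; apply/andP; split.
  apply: ub_le_sup; last by exists n.
  by exists (u 0%N + X / 2 ^+ 0) => _ [m _ <-].
by apply: ge_sup; [exists (u 0%N), 0%N|move=> _ [m _ <-]].
Qed.

(** Repeated bisection leads to rectangles shrinking to a point [pt a b], the [n]-th of which keeps
    at least the fraction [4 ^- n] of the integral. Near that point [f] is affine up to a remainder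
    small compared with the distance, which makes the integral smaller than any given multiple of
    [4 ^- n]. *)
Lemma goursat_pos x X y Y : 0 <= X -> 0 <= Y ->
  (forall a b, x <= a <= x + X -> y <= b <= y + Y -> exists d, cdiff f (pt a b) d) ->
  rint x (x + X) y (y + Y) = 0.
Proof.
move=> X0 Y0 hd.
have /choice[st hst] : forall p : R * R * nat, exists q : R * R,
  [/\ modulus (rint p.1.1 (p.1.1 + X / 2 ^+ p.2) p.1.2 (p.1.2 + Y / 2 ^+ p.2)) <=
   4 * modulus (rint q.1 (q.1 + X / 2 ^+ p.2.+1) q.2 (q.2 + Y / 2 ^+ p.2.+1)),
   q.1 = p.1.1 \/ q.1 = p.1.1 + X / 2 ^+ p.2.+1 & q.2 = p.1.2 \/ q.2 = p.1.2 + Y / 2 ^+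
     p.2.+1].
  move=> [[u v] n] /=; have [x' [y' h]] := bisect_step u (X / 2 ^+ n) v (Y / 2 ^+ n).
  exists (x', y') => /=; move: h.
  by have E (Z : R) : Z / 2 ^+ n / 2 = Z / 2 ^+ n.+1; [rewrite exprSr invfM mulrA|rewrite !E].
pose s := fix s n := if n is k.+1 then st (s k, k) else (x, y).
have [a ha] := @dyadic_cvg (fun n => (s n).1) X X0 (fun n => let: And3 _ h _ := hst (s n, n)
  in h).
have [b hb] := @dyadic_cvg (fun n => (s n).2) Y Y0 (fun n => let: And3 _ _ h := hst (s n, n)
  in h).
pose I n := modulus (rint (s n).1 ((s n).1 + X / 2 ^+ n) (s n).2 ((s n).2 + Y / 2 ^+ n)).
have hI n : I 0%N <= 4 ^+ n * I n.
  elim: n => [|n IH]; first by rewrite expr0 mul1r.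
  apply: le_trans IH _; rewrite exprSr -mulrA ler_wpM2l ?exprn_ge0//.
  by case: (hst (s n, n)).
have I0 : I 0%N = modulus (rint x (x + X) y (y + Y)) by rewrite /I /= expr0 !divr1.
have [d hdd] : exists d, cdiff f (pt a b) d.
  by apply: hd; [have := ha 0%N|have := hb 0%N]; rewrite /= expr0 divr1.
(* The added 1 keeps [S] positive for a degenerate rectangle. *)
pose S := X + Y + 1.
have S0 : 0 < S by rewrite /S; lra.
(* At level [n] the remainder of [f] is at most [e * (2 * (S / 2 ^+ n))] and the two sides add up to
   at most [2 * (S / 2 ^+ n)]; the factor [4 ^+ n] from the bisection cancels both powers of 2. *)
have key e : 0 < e -> I 0%N <= 8 * S * S * e.
  move=> e0; have [r r0 hr] := hdd _ e0.
  have [n hn] : exists n : nat, 2 * S / 2 ^+ n < r.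
    pose n := (Num.truncn (2 * S / r)).+1.
    have hn : 2 * S / r < n%:R by exact: truncnS_gt.
    exists n.
    have := @ltn_expl 2 n isT; rewrite -(ltr_nat R) natrX => /ltW h2.
    move: hn; rewrite ltr_pdivrMr // ltr_pdivrMr ?exprn_gt0// => h.
    by apply: lt_le_trans h _; rewrite mulrC ler_pM2l.
  have n0 : 0 < S / 2 ^+ n by rewrite divr_gt0 ?exprn_gt0.
  have LX : X / 2 ^+ n <= S / 2 ^+ n by rewrite ler_pM2r ?invr_gt0 ?exprn_gt0// /S; lra.
  have LY : Y / 2 ^+ n <= S / 2 ^+ n by rewrite ler_pM2r ?invr_gt0 ?exprn_gt0// /S; lra.
  have X0' : 0 <= X / 2 ^+ n by rewrite divr_ge0 ?exprn_ge0.
  have Y0' : 0 <= Y / 2 ^+ n by rewrite divr_ge0 ?exprn_ge0.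
  have := ha n; have := hb n => /andP[hb1 hb2] /andP[ha1 ha2].
  have hh : I n <= 2 * (e * (2 * (S / 2 ^+ n))) * (`|(s n).1 + X / 2 ^+ n - (s n).1| + `|(s
    n).2 + Y / 2 ^+ n - (s n).2|).
    apply: (@rint_affine_bound _ _ _ _ a b (f (pt a b)) d (S / 2 ^+ n)); first last.
    - by rewrite ler_norml; lra.
    - by rewrite ler_norml; lra.
    - by rewrite ler_norml; lra.
    - by rewrite ler_norml; lra.
    move=> u v hu hv.
    have hm : modulus (pt u v - pt a b) <= 2 * (S / 2 ^+ n).
      by apply: le_trans (modulus_pt (u - a) (v - b)) _; lra.
    apply: le_trans (hr _ _) _; first by apply: le_lt_trans hm _; rewrite mulrA.
    by rewrite ler_wpM2l// ltW.
  have h2 : `|(s n).1 + X / 2 ^+ n - (s n).1| + `|(s n).2 + Y / 2 ^+ n - (s n).2| <= 2 * (S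
    / 2 ^+ n).
    by rewrite ![_ + _ / _ - _]addrC !addKr !ger0_norm//; lra.
  apply: le_trans (hI n) _.
  apply: (@le_trans _ _ (4 ^+ n * (2 * (e * (2 * (S / 2 ^+ n))) * (2 * (S / 2 ^+ n))))).
    rewrite ler_wpM2l ?exprn_ge0//; apply: le_trans hh _; rewrite ler_wpM2l//.
    by rewrite !mulr_ge0// ltW.
  have -> : 4 ^+ n = 2 ^+ n * 2 ^+ n :> R by rewrite -exprMn; congr (_ ^+ _); ring.
  by rewrite le_eqVlt; apply/orP; left; apply/eqP; field; rewrite expf_neq0.
apply/eqP; rewrite -modulus_eq0 -I0 eq_le {2}I0 modulus_ge0 andbT.
apply/ler_addgt0Pl => e e0; rewrite addr0.
apply: le_trans (key (e / (8 * S * S)) _) _; first by rewrite !divr_gt0// !mulr_gt0.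
by rewrite mulrC divfK// !mulf_neq0// gt_eqF.
Qed.

End goursat.

(** * Primitives on a disc, with one exceptional point *)

Section primitive.
Context {R : realType}.
Local Notation C := (Cplx R).
Local Notation Re := (@complex.Re R).
Local Notation Im := (@complex.Im R).
Implicit Types (x y a b t : R) (z w : C).
Variable f : C -> C.
Hypothesis cf : continuous f.
Variables H V : R -> R -> C.
Hypothesis hH : forall y x, pdiff (H y) x (f (pt x y)).
Hypothesis hV : forall x y, pdiff (V x) y (f (pt x y)).
Local Notation rint := (rint H V).

(** Rectangles are spanned by a base point and a second corner in any direction, hence intervals
    with unordered ends. *)
Definition between x y a := Num.min x y <= a <= Num.max x y.

Ltac btw := rewrite /between;
  repeat match goal with |- context[Num.min ?u ?v] => case: (leP u v) => ? end; lra.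

Lemma between_dist x y a : between x y a -> `|a - x| <= `|y - x|.
Proof.
rewrite ler_norml; case: (leP 0 (y - x)) => h; [rewrite ger0_norm//|rewrite ltr0_norm//]; btw.
Qed.

Lemma goursat x1 x2 y1 y2 :
  (forall a b, between x1 x2 a -> between y1 y2 b -> exists d, cdiff f (pt a b) d) ->
  rint x1 x2 y1 y2 = 0.
Proof.
have pos u1 u2 v1 v2 : u1 <= u2 -> v1 <= v2 ->
   (forall a b, u1 <= a <= u2 -> v1 <= b <= v2 -> exists d, cdiff f (pt a b) d) ->
   rint u1 u2 v1 v2 = 0.
  move=> hu hv hd; rewrite -[u2](subrKC u1) -[v2](subrKC v1).
  by apply: (goursat_pos hH hV); rewrite ?subr_ge0// => a b; rewrite !subrKC; apply: hd.
rewrite /between; case: (leP x1 x2) => hx; case: (leP y1 y2) => hy hd.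
- exact: pos.
- by rewrite rint_swapy pos ?oppr0// ltW.
- by rewrite rint_swapx pos ?oppr0// ltW.
- by rewrite rint_swapx rint_swapy opprK pos// ltW.
Qed.

(* The rectangle can be shrunk to the exceptional corner without changing the integral, and [f] is
   bounded there. *)
Lemma goursat_corner a0 b0 x y :
  (forall a b, between a0 x a -> between b0 y b -> pt a b <> pt a0 b0 ->
    exists d, cdiff f (pt a b) d) ->
  rint a0 x b0 y = 0.
Proof.
move=> hd.
have [->|xa] := eqVneq x a0; first by rewrite /rint; ring.
have [->|yb] := eqVneq y b0; first by rewrite /rint; ring.
have E t : 0 < t -> t <= 1 -> rint a0 x b0 y = rint a0 (a0 + t * (x - a0)) b0 (b0 + t * (y -
  b0)).
  move=> t0 t1.
  have tu u : u != 0 -> (0 < t * u <= u) || (u <= t * u < 0).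
    rewrite neq_lt => /orP[u0|u0]; apply/orP; [right|left]; apply/andP; split.
    - by rewrite -[leLHS]mul1r ler_nM2r.
    - by rewrite pmulr_rlt0.
    - by rewrite pmulr_rgt0.
    - by rewrite -[leRHS]mul1r ler_pM2r.
  have := tu (x - a0); rewrite subr_eq0 => /(_ xa); set p := t * (x - a0) => hp.
  have := tu (y - b0); rewrite subr_eq0 => /(_ yb); set q := t * (y - b0) => hq.
  (* Cutting off the small rectangle at the corner leaves two rectangles that avoid the corner, and
     their integrals vanish. *)
  rewrite (rint_splitx _ _ (a0 + p)) (rint_splity _ _ (b0 + q)).
  rewrite [X in _ + X + _]goursat ?[X in _ + X]goursat ?addr0//.
    move=> a b ha hb; apply: hd => //.
      move: ha hp; clear; move=> ha /orP[] hp; move: ha; btw.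
    move=> [ea _]; move: ha hp; rewrite ea; clear; move=> ha /orP[] hp; move: ha; btw.
  move=> a b ha hb; apply: hd.
  - move: ha hp; clear; move=> ha /orP[] hp; move: ha; btw.
  - move: hb hq; clear; move=> hb /orP[] hq; move: hb; btw.
  - move=> [_ eb]; move: hb hq; rewrite eb; clear; move=> hb /orP[] hq; move: hb; btw.
apply/eqP; rewrite -modulus_eq0 eq_le modulus_ge0 andbT.
apply/ler_addgt0Pl => e e0; rewrite addr0.
pose M := modulus (f (pt a0 b0)) + 1.
have M0 : 0 < M by have := modulus_ge0 (f (pt a0 b0)); rewrite /M; lra.
have /nbhs_disc[r r0 hr] : nbhs (pt a0 b0) (f @^-1` disc (f (pt a0 b0)) 1).
  by apply: cf; apply/nbhs_disc; exists 1.
pose K := `|x - a0| + `|y - b0| + 1.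
have K0 : 0 < K by have := normr_ge0 (x - a0); have := normr_ge0 (y - b0); rewrite /K; lra.
(* The first bound keeps the small rectangle inside the given one, the second keeps it in the disc
   of radius [r] where [f] is bounded by [M], the third brings the final estimate [2 * M * (t * K)]
   below [e]. *)
pose t := Num.min 1 (Num.min (r / (2 * K) / 2) (e / (2 * M * K))).
have t0 : 0 < t by rewrite !lt_min ltr01 !divr_gt0// !mulr_gt0.
have t1 : t <= 1 by rewrite ge_min lexx.
have tr : t * K * 2 < r.
  have : t <= r / (2 * K) / 2 by rewrite !ge_min lexx ?orbT.
  rewrite -(ler_pM2r K0) (_ : r / (2 * K) / 2 * K = r / 4); last by field; rewrite gt_eqF.
  lra.
have te : 2 * M * (t * K) <= e.
  have : t <= e / (2 * M * K) by rewrite !ge_min lexx ?orbT.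
  rewrite ler_pdivlMr ?mulr_gt0// => h; apply: le_trans h; lra.
rewrite (E t)//.
apply: le_trans te.
have tx : `|t * (x - a0)| <= t * K.
  by rewrite normrM gtr0_norm// ler_pM2l// /K; have := normr_ge0 (y - b0); lra.
have ty : `|t * (y - b0)| <= t * K.
  by rewrite normrM gtr0_norm// ler_pM2l// /K; have := normr_ge0 (x - a0); lra.
apply: le_trans (rint_affine_bound hH hV (a := a0) (b := b0) (c := 0) (d := 0) (L := t * K)
  (e := M) _ _ _ _ _) _.
- move=> u v hu hv; rewrite subr0 mul0r subr0.
  have /hr : disc (pt a0 b0) r (pt u v).
    by apply: le_lt_trans (modulus_pt (u - a0) (v - b0)) _; lra.
  rewrite /disc /= => h1.
  rewrite -[X in modulus X](subrK (f (pt a0 b0))); apply: le_trans (modulusD _ _) _.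
  by rewrite /M; lra.
- by rewrite subrr normr0 mulr_ge0// ltW.
- by rewrite addrAC subrr add0r.
- by rewrite subrr normr0 mulr_ge0// ltW.
- by rewrite addrAC subrr add0r.
rewrite ler_wpM2l//; first by rewrite mulr_ge0// ltW.
have cancel (u v : R) : u + v - u = v by ring.
rewrite !cancel !normrM gtr0_norm// -mulrDr ler_pM2l// /K; lra.
Qed.

(** If [z] lies in the rectangle, the horizontal and vertical lines through it produce four
    rectangles with corner [z]; otherwise [goursat] applies directly. *)
Lemma goursat_except x1 x2 y1 y2 z :
  (forall a b, between x1 x2 a -> between y1 y2 b -> pt a b <> z ->
    exists d, cdiff f (pt a b) d) ->
  rint x1 x2 y1 y2 = 0.
Proof.
move=> hd.
have [hz|hz] := pselect (between x1 x2 (Re z) /\ between y1 y2 (Im z)); last first.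
  apply: goursat => a b ha hb; apply: hd => // zab; apply: hz.
  by rewrite -zab.
have [hx hy] := hz.
have -> : rint x1 x2 y1 y2 = rint (Re z) x2 (Im z) y2 - rint (Re z) x1 (Im z) y2
   - rint (Re z) x2 (Im z) y1 + rint (Re z) x1 (Im z) y1 by rewrite /rint; ring.
have sub u v m s : between u v m -> between m u s \/ between m v s -> between u v s.
  by move=> + [|]; btw.
have corner x y : x = x1 \/ x = x2 -> y = y1 \/ y = y2 -> rint (Re z) x (Im z) y = 0.
  move=> ex ey; apply: goursat_corner => a b ha hb hab; apply: hd.
  - by apply: sub hx _; case: ex => <-; [left|right].
  - by apply: sub hy _; case: ey => <-; [left|right].
  - by rewrite pt_eta in hab.
by rewrite !corner; [ring|auto..].
Qed.

(** [P] integrates from 0 along the real axis and then vertically. As rectangle integrals vanish,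
    the opposite order gives the same value, so that [P w - P z] reduces to a short horizontal and a
    short vertical piece, along which [f] is close to [f z]. The exceptional point [z0] is there for
    difference quotients such as [dslope]. *)
Lemma primitive_disc rho z0 :
  (forall z, modulus z < rho -> z <> z0 -> exists d, cdiff f z d) ->
  exists P, forall z, modulus z < rho -> cdiff P z (f z).
Proof.
move=> hd.
pose P z := (H 0 (Re z) - H 0 0) + iu * (V (Re z) (Im z) - V (Re z) 0).
exists P => z zr.
have PE x y : modulus (pt x y) < rho ->
    P (pt x y) = iu * (V 0 y - V 0 0) + (H y x - H y 0).
  move=> xyr; apply/eqP; rewrite -subr_eq0; apply/eqP.
  transitivity (rint 0 x 0 y); first by rewrite /P /rint /=; ring.
  apply: (@goursat_except _ _ _ _ z0) => a b ha hb.
  apply: hd; apply: le_lt_trans xyr; apply: modulus_pt_le.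
    by have := between_dist ha; rewrite !subr0.
  by have := between_dist hb; rewrite !subr0.
move=> e e0.
have /nbhs_disc[r r0 hr] : nbhs z (f @^-1` disc (f z) (e / 2)).
  by apply: cf; apply/nbhs_disc; exists (e / 2) => //; rewrite divr_gt0.
exists (Num.min (r / 2) ((rho - modulus z) / 2)); first by rewrite lt_min !divr_gt0// subr_gt0.
move=> w; rewrite lt_min => /andP[wr wrho].
pose x := Re z; pose y := Im z; pose x' := Re w; pose y' := Im w.
have zE : z = pt x y by rewrite /x /y pt_eta.
have wE : w = pt x' y' by rewrite /x' /y' pt_eta.
have hx : `|x' - x| <= modulus (w - z) by rewrite -ReB Re_modulus.
have hy : `|y' - y| <= modulus (w - z) by rewrite -ImB Im_modulus.
have vr u v : between x x' u -> between y y' v -> modulus (f (pt u v) - f z) <= e / 2.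
  move=> hu hv; apply/ltW/hr; rewrite /disc /= [X in _ - X]zE.
  have : `|u - x| <= modulus (w - z).
    apply: le_trans hx; move: hu; apply: between_dist.
  have : `|v - y| <= modulus (w - z).
    apply: le_trans hy; move: hv; apply: between_dist.
  by have := modulus_pt (u - x) (v - y); lra.
have bx : between x x' x by btw.
have bx' : between x x' x' by btw.
have b_y : between y y' y by btw.
have b_y' : between y y' y' by btw.
have xyr : modulus (pt x' y) < rho.
  rewrite -[pt x' y](subrK z).
  apply: le_lt_trans (modulusD _ _) _.
  have : modulus (pt x' y - z) <= modulus (w - z).
    rewrite {1}zE; apply: le_trans (modulus_pt (x' - x) (y - y)) _.
    by rewrite subrr normr0 addr0.
  lra.
have E : P w - P z - f z * (w - z) =
   ((H y x' - f z * pt x' y) - (H y x - f z * pt x y)) +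
   ((iu * V x' y' - f z * pt x' y') - (iu * V x' y - f z * pt x' y)).
  have D1 : P w - P (pt x' y) = iu * (V x' y' - V x' y) by rewrite /P /=; ring.
  have D2 : P (pt x' y) - P z = H y x' - H y x.
    by rewrite PE// {1}zE PE -?zE//; ring.
  rewrite -zE -wE.
  transitivity (P w - P (pt x' y) + (P (pt x' y) - P z) - f z * (w - z)); first by ring.
  by rewrite D1 D2; ring.
rewrite E.
apply: le_trans (modulusD _ _) _; rewrite [e]splitr mulrDl lerD//.
  apply: (le_trans _ (ler_wpM2l _ hx)); last by rewrite divr_ge0// ltW.
  apply: (pdiff_mvt_abs (fun t => pdiffB (hH y t) (pdiffZ (f z) (pdiff_ptx t y)))) => t ht.
  by rewrite mulr1; apply: vr.
apply: (le_trans _ (ler_wpM2l _ hy)); last by rewrite divr_ge0// ltW.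
apply: (pdiff_mvt_abs (fun t => pdiffB (pdiffZ iu (hV x' t)) (pdiffZ (f z) (pdiff_pty x'
  t)))) => t ht.
rewrite [f z * _]mulrC -mulrBr modulusM modulus_iu mul1r; exact: vr.
Qed.

End primitive.

(** * Cauchy's formula on a circle *)

Section cauchy.
Context {R : realType}.
Local Notation C := (Cplx R).
Local Notation Re := (@complex.Re R).
Local Notation Im := (@complex.Im R).
Implicit Types (x y a b t : R) (z w : C).

Lemma cdiff_near (f g : C -> C) z d r : 0 < r -> (forall w, modulus (w - z) < r -> f w = g
  w) ->
  cdiff f z d -> cdiff g z d.
Proof.
move=> r0 fg h e e0; have [r' r'0 h'] := h _ e0.
exists (Num.min r r'); first by rewrite lt_min r0.
move=> w; rewrite lt_min => /andP[/fg <- /h'].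
by rewrite -(fg z)// subrr modulus0.
Qed.

Lemma cdiff_continuous (f : C -> C) z d : cdiff f z d -> {for z, continuous f}.
Proof.
move=> h A /nbhs_disc[r r0 rA].
have [r' r'0 hr'] := h _ ltr01.
pose K := 1 + modulus d + 1.
have K0 : 0 < K by have := modulus_ge0 d; rewrite /K; lra.
apply/nbhs_disc; exists (Num.min r' (r / K)); first by rewrite lt_min r'0 divr_gt0.
move=> s; rewrite /disc /= lt_min => /andP[/hr' h1].
rewrite ltr_pdivlMr // => sr; apply: rA; rewrite /disc /=.
rewrite -[X in modulus X](subrK (d * (s - z))).
apply: le_lt_trans (modulusD _ _) _; rewrite modulusM.
apply: le_lt_trans sr; rewrite /K; have := modulus_ge0 (s - z). lra.
Qed.

(** The exponential of [iu * t]; its inverse [cisN] has its own definition so that the factors of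
    Fourier type are plain powers, covered by [pdiffX]. *)
Definition cis t : C := (cos t +i* sin t)%C.
Definition cisN t : C := (cos t -i* sin t)%C.

Lemma pdiff_cis t : pdiff cis t (iu * cis t).
Proof.
have -> : iu * cis t = (- sin t +i* cos t)%C.
  by apply/eqP; rewrite eq_complex /= ?mul0r ?mul1r ?add0r ?sub0r !eqxx.
by split; [exact: is_derive_cos|exact: is_derive_sin].
Qed.

Lemma pdiff_cisN t : pdiff cisN t (- iu * cisN t).
Proof.
have -> : - iu * cisN t = (- sin t -i* cos t)%C.
  by apply/eqP; rewrite eq_complex /= ?oppr0 ?mul0r ?mul1r ?add0r ?sub0r ?mulrN ?mulNr
    ?mul1r ?opprK ?eqxx ?add0r ?mulN1r ?eqxx.
by split; [exact: is_derive_cos|exact: is_deriveN].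
Qed.

Lemma cis_mulN t : cis t * cisN t = 1.
Proof.
apply/eqP; rewrite eq_complex /=; apply/andP; split; apply/eqP; last by ring.
by rewrite mulrN opprK -!expr2 cos2Dsin2.
Qed.

Lemma modulus_cis t : modulus (cis t) = 1.
Proof. by rewrite /= cos2Dsin2 sqrtr1. Qed.

Lemma modulus_cisN t : modulus (cisN t) = 1.
Proof. by rewrite /= sqrrN cos2Dsin2 sqrtr1. Qed.

Lemma cis0 : cis 0 = 1. Proof. by rewrite /cis cos0 sin0. Qed.

Lemma cisN0 : cisN 0 = 1. Proof. by rewrite /cisN cos0 sin0 oppr0. Qed.

Lemma cis2pi : cis (2 * pi) = 1.
Proof. by rewrite /cis mulr2n mulrDl mul1r -mulr2n cos2pi sin2pi. Qed.

Lemma cisN2pi : cisN (2 * pi) = 1.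
Proof. by rewrite /cisN mulr2n mulrDl mul1r -mulr2n cos2pi sin2pi oppr0. Qed.

Lemma path_bounded (g : R -> C) a b : a <= b -> continuous g ->
  exists2 M, 0 < M & forall t, a <= t <= b -> modulus (g t) <= M.
Proof.
move=> ab cg.
have bd (h : R -> R) : continuous h -> exists M, forall t, a <= t <= b -> h t <= M.
  move=> ch; have [|c _ hc] := @EVT_max R h a b ab.
    exact: continuous_subspaceT.
  by exists (h c) => t tab; apply: hc; rewrite in_itv.
have [M hM] := bd _ (fun t => continuous_comp (continuous_comp (cg t) (@continuous_Re R _))
  (@norm_continuous _ R^o _)).
have [N hN] := bd _ (fun t => continuous_comp (continuous_comp (cg t) (@continuous_Im R _))
  (@norm_continuous _ R^o _)).
exists (`|M| + `|N| + 1); first by rewrite ltr_wpDl// addr_ge0.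
move=> t tab; apply: le_trans (modulus_ReIm _) _.
have /= := hM _ tab; have /= := hN _ tab; have := ler_norm M; have := ler_norm N; lra.
Qed.

Section coef.
Variables (f : C -> C) (rho rho1 : R).
Hypothesis cf : continuous f.
Hypothesis rho0 : 0 < rho.
Hypothesis rho1_gt : rho < rho1.
Hypothesis df : forall z, modulus z < rho1 -> exists d, cdiff f z d.

Definition circ t : C := rho%:C%C * cis t.

Lemma pdiff_circ t : pdiff circ t (iu * circ t).
Proof. by have := pdiffZ rho%:C%C (pdiff_cis t); rewrite mulrCA. Qed.

Lemma modulus_circ t : modulus (circ t) = rho.
Proof. by rewrite modulusM modulus_real modulus_cis mulr1 gtr0_norm. Qed.

(* The difference quotient of [f] at [z0], with the value [d] meant for the derivative at [z0]. *)
Definition dslope (z0 d z : C) : C := if z == z0 then d else (f z - f z0) / (z - z0).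

Lemma cdiff_dslope z0 d z : z != z0 -> (exists d, cdiff f z d) ->
  exists d', cdiff (dslope z0 d) z d'.
Proof.
move=> zz0 dfz.
have zz : 0 < modulus (z - z0) by rewrite modulus_gt0 subr_eq0.
have [d' hd'] : exists d', cdiff (fun w => (f w - f z0) / (w - z0)) z d'.
  apply/derivable_cdiff; apply: derivableM.
    by apply: derivableB; [exact/derivable_cdiff|exact: derivable_cst].
  apply: derivableV; first by rewrite subr_eq0.
  by apply: derivableB; [exact: derivable_id|exact: derivable_cst].
exists d'; apply: (cdiff_near zz _ hd') => w hw.
rewrite /dslope ifF//; apply/negbTE; apply: contraTneq hw => ->.
by rewrite modulusBC ltxx.
Qed.

Lemma continuous_dslope z0 d : cdiff f z0 d -> continuous (dslope z0 d).
Proof.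
move=> dz0 z; have [->|zz0] := eqVneq z z0.
  move=> A /nbhs_disc[r r0 rA]; apply/nbhs_disc.
  have [r' r'0 h] := dz0 (r / 2) (divr_gt0 r0 (ltr0Sn _ _)).
  exists r' => // w hw; apply: rA; rewrite /disc /dslope /= eqxx.
  have [//|wz] := eqVneq w z0; first by rewrite subrr modulus0.
  have wz' : w - z0 != 0 by rewrite subr_eq0.
  have m0 : 0 < modulus (w - z0) by rewrite modulus_gt0.
  have -> : (f w - f z0) / (w - z0) - d = (f w - f z0 - d * (w - z0)) / (w - z0) by field.
  rewrite modulusM modulusV ltr_pdivrMr//; apply: le_lt_trans (h _ hw) _.
  by rewrite ltr_pM2r//; lra.
have zz : 0 < modulus (z - z0) by rewrite modulus_gt0 subr_eq0.
have hc : {for z, continuous (fun w => (f w - f z0) / (w - z0))}.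
  apply: continuousM; first by apply: continuousB; [exact: cf|exact: cst_continuous].
  apply: continuousV; first by rewrite subr_eq0.
  by apply: continuousB; [exact: cvg_id|exact: cst_continuous].
move=> A hA.
have hA' : nbhs ((f z - f z0) / (z - z0)) A by move: hA; rewrite /dslope ifF//; apply/negbTE.
have /nbhs_disc[r r0 hr] := hc _ hA'.
apply/nbhs_disc; exists (Num.min r (modulus (z - z0))); first by rewrite lt_min r0.
move=> w; rewrite /disc /= lt_min => /andP[/hr hw hw'].
rewrite /dslope /= ifF//; apply/negbTE; apply: contraTneq hw' => ->.
by rewrite modulusBC ltxx.
Qed.

Variable B : nat -> R -> C.
Hypothesis hB : forall k t, pdiff (B k) t (f (circ t) * cisN t ^+ k).

(** As [B k] is a primitive of the integrand, this is Cauchy's integral for the [k]-th Taylor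
    coefficient at 0: the mean of [f (circ t) * cisN t ^+ k] over a period, divided by
    [rho ^+ k]. *)
Definition cauchy_coef k : C := (B k (2 * pi) - B k 0) / ((2 * pi)%:C%C * rho%:C%C ^+ k).

Lemma cauchy_estimate k M : (forall t, modulus (f (circ t)) <= M) ->
  modulus (cauchy_coef k) * rho ^+ k <= M.
Proof.
move=> hM.
have pi0 : 0 < 2 * pi :> R by rewrite mulr_gt0 ?pi_gt0.
have M0 : 0 <= M by apply: le_trans (hM 0); rewrite modulus_ge0.
rewrite /cauchy_coef modulusM modulusV modulusM modulusX !modulus_real !gtr0_norm//.
rewrite invfM mulrA divfK ?expf_neq0 ?gt_eqF// ler_pdivrMr//.
rewrite -[X in M * X]subr0; apply: (pdiff_mvt (ltW pi0) (hB k)) => t _.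
by rewrite modulusM modulusX modulus_cisN expr1n mulr1.
Qed.

(** A primitive of [cisN t ^+ k]. Only the one with [k = 0] changes over a period. *)
Definition cisN_prim k t : C := if k is 0%N then t%:C%C else cisN t ^+ k / (- iu * k%:R).

Lemma iu_neq0 : iu != 0 :> C.
Proof. by rewrite -modulus_eq0 modulus_iu oner_neq0. Qed.

Lemma pdiff_cisN_prim k t : pdiff (cisN_prim k) t (cisN t ^+ k).
Proof.
case: k => [|k]; first by rewrite expr0; exact: pdiff_id.
have := pdiffZ (- iu * k.+1%:R)^-1 (pdiffX k.+1 (pdiff_cisN t)).
congr pdiff; first by apply/funext => s; rewrite mulrC.
have n0 : k.+1%:R != 0 :> C by rewrite pnatr_eq0.
have i0 := iu_neq0.
by rewrite exprS; field; rewrite i0 addrC natr1 n0.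
Qed.

Lemma cisN_prim_period k :
  cisN_prim k (2 * pi) - cisN_prim k 0 = if k is 0%N then (2 * pi)%:C%C else 0.
Proof.
case: k => [|k] /=; first by rewrite subr0.
by rewrite cisN2pi cisN0 subrr.
Qed.

(* With [g = dslope z d] and [v] on the circle,
   [g v * v = \sum_(k < n) (f v - f z) * (z / v) ^+ k + g v * v * (z / v) ^+ n], and the integral of
   [g v * v] over the circle vanishes because [g] has a primitive; [T n] is a primitive along the
   circle of the last term. *)
Lemma cauchy_remainder z : modulus z < rho -> exists K, forall n,
  modulus (f z - \sum_(0 <= k < n.+1) cauchy_coef k * z ^+ k) <= K * (modulus z / rho) ^+ n.+1.
Proof.
move=> zrho.
have [d hd] := df (lt_trans zrho rho1_gt).
pose g := dslope z d.
have cg : continuous g by exact: continuous_dslope.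
have [P hP] : exists P, forall w, modulus w < rho1 -> cdiff P w (g w).
  have /choice[H hH] : forall y, exists G, forall x, pdiff G x (g (pt x y)).
    by move=> y; exact/pdiff_antiderivative/continuous_ptx.
  have /choice[V hV] : forall x, exists G, forall y, pdiff G y (g (pt x y)).
    by move=> x; exact/pdiff_antiderivative/continuous_pty.
  apply: (primitive_disc cg hH hV (z0 := z)) => w wr wz.
  by apply: cdiff_dslope; [exact/eqP|exact: df].
(* The derivative of [P \o circ] is [g (circ t) * (iu * circ t)]; the factor [- iu] strips the [iu],
   and each further level subtracts a primitive of one summand. *)
pose T := fix T n t := if n is k.+1 then T k t - (z / rho%:C%C) ^+ k * (B k t - f z *
  cisN_prim k t)
  else P (circ t) * - iu.
have rc0 : rho%:C%C != 0 :> C by rewrite -modulus_eq0 modulus_real normr_eq0 gt_eqF.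
have dT n t : pdiff (T n) t (g (circ t) * circ t * (z / rho%:C%C * cisN t) ^+ n).
  elim: n => [|n IH].
    have := pdiffZ (- iu) (pdiff_comp (hP (circ t) _) (pdiff_circ t)).
    rewrite modulus_circ => /(_ rho1_gt); congr pdiff; first by apply/funext => s; rewrite
      mulrC.
    rewrite expr0 mulr1; transitivity (- (iu * iu) * (g (circ t) * circ t)); first by ring.
    by rewrite iu2 opprK mul1r.
  have := pdiffB IH (pdiffZ ((z / rho%:C%C) ^+ n) (pdiffB (hB n t) (pdiffZ (f z)
    (pdiff_cisN_prim n t)))).
  congr pdiff.
  have E1 : g (circ t) * (circ t - z) = f (circ t) - f z.
    rewrite /g /dslope; have [->|h] := eqVneq (circ t) z; first by rewrite !subrr mulr0.
    by rewrite divfK// subr_eq0.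
  have E2 : circ t * (z / rho%:C%C * cisN t) = z.
    by rewrite /circ mulrACA cis_mulN mulr1 mulrC divfK.
  transitivity (g (circ t) * circ t * (z / rho%:C%C * cisN t) ^+ n
      - (f (circ t) - f z) * (z / rho%:C%C * cisN t) ^+ n); first by rewrite exprMn; ring.
  rewrite -E1 exprS; transitivity (g (circ t) * z * (z / rho%:C%C * cisN t) ^+ n); first by
    ring.
  by rewrite -{1}E2; ring.
have pi0 : 0 < 2 * pi :> R by rewrite mulr_gt0 ?pi_gt0.
have pc0 : (2 * pi)%:C%C != 0 :> C by rewrite -modulus_eq0 modulus_real normr_eq0 gt_eqF.
have TS n t : T n.+1 t = T n t - (z / rho%:C%C) ^+ n * (B n t - f z * cisN_prim n t) by [].
(* [circ] closes up after [2 * pi], so [P] has increment 0; among the [cisN_prim] only index 0 has a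
   nonzero increment, and it produces the term [f z]. *)
have ET n : T n.+1 (2 * pi) - T n.+1 0 =
   (2 * pi)%:C%C * (f z - \sum_(0 <= k < n.+1) cauchy_coef k * z ^+ k).
  elim: n => [|n IH].
    rewrite big_nat1 /T !expr0 /cauchy_coef !expr0 /circ cis2pi cis0 !mulr1 !mul1r.
    by rewrite /= (_ : 0%:C%C = 0 :> C)//; move: pc0; move: (2 * pi)%:C%C => tp tp0; field.
  transitivity ((2 * pi)%:C%C * (f z - \sum_(0 <= k < n.+1) cauchy_coef k * z ^+ k) -
    (2 * pi)%:C%C * (cauchy_coef n.+1 * z ^+ n.+1)); last by rewrite [in
      RHS]big_nat_recr//=; ring.
  rewrite -IH !(TS n.+1).
  have : cisN_prim n.+1 (2 * pi) = cisN_prim n.+1 0.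
    by apply/eqP; rewrite -subr_eq0 cisN_prim_period.
  move=> ->; rewrite /cauchy_coef exprMn exprVn.
  move: (expf_neq0 n.+1 rc0) pc0; move: (rho%:C%C ^+ n.+1) (2 * pi)%:C%C => rn tp rn0 tp0.
  move: (T _ _) (T _ _) (B _ _) (B _ _) (cisN_prim _ _) (f z) (z ^+ n.+1) rn0 tp0.
  by clear; move=> *; field; apply/andP; split.
have [K K0 hK] := path_bounded (ltW pi0) (fun t => continuousM (continuous_comp
  (@continuous_pdiff _ _ _ pdiff_circ t) (cg _)) (@continuous_pdiff _ _ _ pdiff_circ t)).
exists K => n.
rewrite -(ler_pM2l pi0) -{1}[2 * pi]gtr0_norm// -modulus_real -modulusM -ET.
rewrite [leRHS]mulrC.
have := @pdiff_mvt R (T n.+1) _ 0 (2 * pi) (K * (modulus z / rho) ^+ n.+1) (ltW pi0) (dT n.+1).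
rewrite subr0; apply => t ht.
rewrite modulusM modulusX [modulus (_ / _ * _)]modulusM modulus_cisN mulr1.
rewrite [modulus (_ / _)]modulusM modulusV modulus_real (gtr0_norm rho0).
rewrite ler_wpM2r//; first by rewrite exprn_ge0// divr_ge0 ?modulus_ge0// ltW.
exact: hK.
Qed.
End coef.
End cauchy.

(** * Power series *)

Section pseries.
Context {R : realType}.
Local Notation C := (Cplx R).
Local Notation Re := (@complex.Re R).
Local Notation Im := (@complex.Im R).
Implicit Types (x y t : R) (z w c : C) (u b : nat -> C).

Lemma dist_cvg0 (v : nat -> R) x : v @ \oo --> x -> `|v n - x| @[n --> \oo] --> (0 : R).
Proof. by move=> h; have := cvg_norm (cvgB h (cvg_cst x)); rewrite subrr normr0; apply. Qed.

Lemma cvg_ReIm (u : nat -> C) x y : (Re \o u) @ \oo --> x -> (Im \o u) @ \oo --> y ->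
  u @ \oo --> ((x +i* y)%C : C).
Proof.
move=> hx hy; apply/cvg_modulus.
apply: (@squeeze_cvgr _ _ _ _ (cst 0) (fun n => `|Re (u n) - x| + `|Im (u n) - y|)).
- near=> n; apply/andP; split; first exact: modulus_ge0.
  by apply: le_trans (modulus_ReIm _) _; rewrite ReB ImB.
- exact: cvg_cst.
- have := cvgD (dist_cvg0 hx) (dist_cvg0 hy); rewrite addr0; exact.
Unshelve. all: by end_near. Qed.

Lemma modulus_lim_le (u : nat -> C) (l : C) (K : R) : u @ \oo --> l -> (forall n, modulus (u
  n) <= K) ->
  modulus l <= K.
Proof.
move=> /cvg_modulus/cvgrPdist_le h hK; apply/ler_addgt0Pl => e e0.
have [n _ hn] := h _ e0.
have := hn _ (leqnn n); rewrite sub0r normrN ger0_norm ?modulus_ge0// => h1.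
have := modulusD (u n) (l - u n); rewrite subrKC.
by have := hK n; rewrite modulusBC in h1; lra.
Qed.

Lemma cvgC_unique (u : nat -> C) (l l' : C) : u @ \oo --> l -> u @ \oo --> l' -> l = l'.
Proof. by move=> h h'; apply: (cvg_unique _ h h'); exact: norm_hausdorff. Qed.

Lemma geometric_sum_le x n : 0 <= x < 1 -> \sum_(0 <= k < n) x ^+ k <= (1 - x)^-1.
Proof.
move=> /andP[x0 x1].
have h : 1 - x ^+ n = (1 - x) * \sum_(0 <= k < n) x ^+ k.
  by rewrite big_mkord -opprB subrX1 -mulNr opprB.
rewrite -[leRHS]mulr1 ler_pdivlMl ?subr_gt0// -h.
by rewrite lerBlDr lerDl exprn_ge0.
Qed.

Lemma cvg_series_geometric (u : nat -> C) K y : 0 <= y < 1 ->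
  (forall n, modulus (u n) <= K * y ^+ n) ->
  exists2 l : C, series u @ \oo --> l & modulus l <= K / (1 - y).
Proof.
move=> y01 hu; have /andP[y0 y1] := y01.
have K0 : 0 <= K by have := hu 0%N; rewrite expr0 mulr1; apply: le_trans; rewrite modulus_ge0.
have cv (v : nat -> R) : (forall n, `|v n| <= K * y ^+ n) -> cvgn (series v).
  move=> hv; apply: normed_cvg.
  apply: (@series_le_cvg _ _ (geometric K y)) => //.
  - by move=> n; exact: normr_ge0.
  - by move=> n; exact: mulr_ge0 K0 (exprn_ge0 _ y0).
  - by apply: is_cvg_geometric_series; rewrite ger0_norm.
have cRe : cvgn (series (Re \o u)).
  by apply: cv => n; apply: le_trans (hu n); exact: Re_modulus.
have cIm : cvgn (series (Im \o u)).
  by apply: cv => n; apply: le_trans (hu n); exact: Im_modulus.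
have ERe : Re \o series u = series (Re \o u).
  apply/funext => n; elim: n => [|n IH]; first by rewrite /series /= !big_geq.
  by move: IH; rewrite /series /= !big_nat_recr//= ReD => ->.
have EIm : Im \o series u = series (Im \o u).
  apply/funext => n; elim: n => [|n IH]; first by rewrite /series /= !big_geq.
  by move: IH; rewrite /series /= !big_nat_recr//= ImD => ->.
have hl : series u @ \oo --> ((limn (series (Re \o u)) +i* limn (series (Im \o u)))%C : C).
  by apply: cvg_ReIm; rewrite ?ERe ?EIm.
exists (limn (series (Re \o u)) +i* limn (series (Im \o u)))%C => //.
apply: (modulus_lim_le hl) => n.
apply: le_trans (modulus_sum _ _ _) _.
apply: (@le_trans _ _ (\sum_(0 <= k < n) K * y ^+ k)); first exact: ler_sum.
by rewrite -mulr_sumr ler_wpM2l//; exact: geometric_sum_le.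
Qed.

Lemma seriesC0 (u : nat -> C) : series u 0%N = 0.
Proof. by rewrite /series /= big_geq. Qed.

Lemma seriesCS (u : nat -> C) n : series u n.+1 = series u n + u n.
Proof. by rewrite /series /= big_nat_recr. Qed.

Lemma cvg_series_terms_bounded (u : nat -> C) (l : C) : series u @ \oo --> l ->
  exists M, forall n, modulus (u n) <= M.
Proof.
move=> /cvg_modulus h.
have [M [Mr hM]] := cvg_seq_bounded (cvgP _ h).
exists ((M + 1) + (M + 1)) => n.
have -> : u n = (series u n.+1 - l) - (series u n - l) by rewrite seriesCS; ring.
apply: le_trans (modulusD _ _) _; rewrite modulusN.
have M1 : M < M + 1 by rewrite ltrDl.
have g k : modulus (series u k - l) <= M + 1.
  by have := hM _ M1 k I; move=> /= h1; apply: le_trans h1; rewrite ger0_norm ?modulus_ge0.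
exact: lerD.
Qed.

(** Once the coefficients below [n] vanish, evaluation at a small [t > 0] gives [b n * t ^+ n] as
    minus the tail, which is of order [t ^+ n.+1]; hence [modulus (b n)] is at most a constant times
    [t]. *)
Lemma pseries_eq0 b r : 0 < r ->
  (forall z, modulus z < r -> series (fun n => b n * z ^+ n) @ \oo --> (0 : C)) ->
  forall n, b n = 0.
Proof.
move=> r0 hb n; elim/ltn_ind: n => n IH.
pose s := r / 2; have s0 : 0 < s by rewrite divr_gt0.
have sr : modulus (s%:C%C : C) < r by rewrite modulus_real gtr0_norm// /s; lra.
have [M hM] := cvg_series_terms_bounded (hb _ sr).
have M0 : 0 <= M by apply: le_trans (hM 0%N); rewrite modulus_ge0.
have key t : 0 < t -> 2 * t <= s -> modulus (b n) <= t * (2 * M * (2 / s) ^+ n.+1).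
  move=> t0 ts.
  have ts' : modulus (t%:C%C : C) < r by rewrite modulus_real gtr0_norm//; rewrite /s in ts;
    lra.
  pose v k := if (k <= n)%N then 0 else b k * (t%:C%C : C) ^+ k.
  (* Write [t ^+ k] as [s ^+ k * (2 * t / s) ^+ k * (1 / 2) ^+ k]. Since [2 * t <= s] and [n < k],
     the middle factor is at most its power [n.+1], and the last one makes the tail summable. *)
  have hv k : modulus (v k) <= M * (2 * t / s) ^+ n.+1 * (1 / 2) ^+ k.
    rewrite /v; case: leqP => kn.
      by rewrite modulus0 !mulr_ge0// exprn_ge0// ?divr_ge0// ltW// mulr_gt0.
    have hk : modulus (b k) * s ^+ k <= M.
      by apply: le_trans (hM k); rewrite modulusM modulusX modulus_real (gtr0_norm s0).
    rewrite modulusM modulusX modulus_real (gtr0_norm t0).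
    have -> : modulus (b k) * t ^+ k = modulus (b k) * s ^+ k * (2 * t / s) ^+ k * (1 / 2)
      ^+ k.
      by rewrite -!mulrA -!exprMn; congr (_ * _ ^+ _); field; rewrite gt_eqF.
    rewrite ler_wpM2r ?exprn_ge0//; apply: ler_pM => //.
    - by rewrite mulr_ge0 ?modulus_ge0// exprn_ge0// ltW.
    - by rewrite exprn_ge0// divr_ge0// ltW// mulr_gt0.
    - apply: ler_wiXn2l => //; first by rewrite divr_ge0// ltW// mulr_gt0.
      by rewrite ler_pdivrMr// mul1r.
  have [l hl lb] := cvg_series_geometric (y := 1 / 2) ltac:(lra) hv.
  have E : l = - (b n * (t%:C%C : C) ^+ n).
    have Ev N : series (fun k => b k * (t%:C%C : C) ^+ k) N =
        series v N + (if (n < N)%N then b n * (t%:C%C : C) ^+ n else 0).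
      elim: N => [|N IHN]; first by rewrite !seriesC0 addr0.
      rewrite !seriesCS IHN /v ltnS; case: (ltngtP N n) => [Nn|nN|->].
      - by rewrite IH// mul0r !addr0.
      - by rewrite addrAC.
      - by rewrite addr0.
    have h1 : series v @ \oo --> - (b n * (t%:C%C : C) ^+ n).
      apply/cvg_modulus; have /cvg_modulus := hb _ ts'.
      apply: cvg_trans; apply: near_eq_cvg; near=> N; congr modulus.
      have nN : (n < N)%N by near: N; exact: nbhs_infty_gt.
      rewrite subr0 opprK.
      by rewrite Ev nN.
    exact: cvgC_unique hl h1.
  move: lb; rewrite E modulusN modulusM modulusX modulus_real gtr0_norm// => lb.
  rewrite -(ler_pM2r (exprn_gt0 n t0)); apply: le_trans lb _.
  rewrite le_eqVlt; apply/orP; left; apply/eqP.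
  rewrite (_ : 2 * t / s = 2 / s * t); last by rewrite mulrAC.
  by rewrite exprMn [t ^+ n.+1]exprS; move: ((2 / s) ^+ n.+1) => A; field.
apply/eqP; rewrite -modulus_eq0 eq_le modulus_ge0 andbT.
pose K := 2 * M * (2 / s) ^+ n.+1.
have K0 : 0 <= K by rewrite !mulr_ge0// exprn_ge0// divr_ge0// ltW.
apply/ler_addgt0Pl => e e0; rewrite addr0.
pose t := Num.min (s / 2) (e / (K + 1)).
have t0 : 0 < t by rewrite lt_min !divr_gt0// ltr_wpDl.
apply: le_trans (key t t0 _) _.
  have : t <= s / 2 by rewrite ge_min lexx.
  lra.
have : t <= e / (K + 1) by rewrite ge_min lexx orbT.
rewrite ler_pdivlMr ?ltr_wpDl// -/K; lra.
Unshelve. all: by end_near. Qed.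
End pseries.

(** * Termwise differentiation of power series *)

Section taylor.
Context {R : realType}.
Local Notation C := (Cplx R).
Implicit Types (x y t : R) (z w c : C) (u b : nat -> C).

(** Each of the [n] terms of the geometric sum is at least [x ^+ n]. *)
Lemma natr_exp_le x n : 0 <= x < 1 -> n%:R * x ^+ n <= (1 - x)^-1.
Proof.
move=> x01; apply: le_trans (geometric_sum_le n x01); have /andP[x0 x1] := x01.
rewrite mulr_natl -[n in x ^+ _ *+ n]subn0 -sumr_const_nat big_nat [leRHS]big_nat.
by apply: ler_sum => k /andP[_ kn]; rewrite ler_wiXn2l ?(ltW x1)// ltnW.
Qed.

(* With [u ^+ 4 = x], [n ^ 2 x ^ n = (n u ^ n) ^ 2 (u ^ 2) ^ n] and [n u ^ n] is bounded. *)
Lemma sqr_exp_le x : 0 <= x < 1 -> exists K y, [/\ 0 <= y < 1, 0 <= K &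
  forall n, n%:R ^+ 2 * x ^+ n <= K * y ^+ n].
Proof.
move=> /andP[x0 x1].
have sq1 (s : R) : 0 <= s < 1 -> 0 <= Num.sqrt s < 1.
  by move=> /andP[s0 s1]; rewrite sqrtr_ge0/= -sqrtr1 ltr_sqrt.
pose y := Num.sqrt x; have y01 : 0 <= y < 1 by apply: sq1; rewrite x0.
pose u := Num.sqrt y; have u01 : 0 <= u < 1 by exact: sq1.
have /andP[y0 _] := y01; have /andP[u0 u1] := u01.
have xE : x = u ^+ 2 * y by rewrite /u sqr_sqrtr// -expr2 /y sqr_sqrtr.
exists ((1 - u)^-1 ^+ 2), y; split => // [|n]; first by rewrite exprn_ge0// invr_ge0
  subr_ge0 ltW.
rewrite xE exprMn exprAC mulrA -exprMn ler_wpM2r ?exprn_ge0//.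
by rewrite ler_pXn2r ?nnegrE ?natr_exp_le// ?mulr_ge0 ?exprn_ge0// invr_ge0 subr_ge0 ltW.
Qed.

Definition pow_rem n z c : C := z ^+ n - c ^+ n - n%:R * c ^+ n.-1 * (z - c).

Lemma pow_remS n z c : pow_rem n.+1 z c = z * pow_rem n z c + n%:R * c ^+ n.-1 * (z - c) ^+ 2.
Proof.
rewrite /pow_rem; case: n => [|n]; first by rewrite !expr0 expr1 /=; ring.
by rewrite /= !exprS -!natr1; ring.
Qed.

Lemma modulus_natr n : modulus (n%:R : C) = n%:R.
Proof.
have -> : n%:R = (n%:R%:C)%C :> C by rewrite rmorph_nat.
by rewrite modulus_real normr_nat.
Qed.

(** The factor [s ^+ 2] on the left stands for an exponent [n - 2] on the right, which would be
    negative for small [n]. Induction through [pow_remS]. *)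
Lemma pow_rem_le n z c s : 0 < s -> modulus z <= s -> modulus c <= s ->
  modulus (pow_rem n z c) * s ^+ 2 <= n%:R ^+ 2 * s ^+ n * modulus (z - c) ^+ 2.
Proof.
move=> s0 zs cs.
have s0' := ltW s0.
elim: n => [|n IH].
  by rewrite /pow_rem !expr0 subrr !mul0r subrr modulus0 mul0r !mulr_ge0 ?exprn_ge0
    ?modulus_ge0.
rewrite pow_remS.
have h1 : modulus (n%:R * c ^+ n.-1 * (z - c) ^+ 2) * s ^+ 2 <=
    n%:R * s ^+ n.+1 * modulus (z - c) ^+ 2.
  rewrite modulusM modulusM !modulusX modulus_natr.
  rewrite [leLHS]mulrAC ler_wpM2r ?exprn_ge0 ?modulus_ge0//.
  case: n {IH} => [|n]; first by rewrite !mul0r.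
  have -> : n.+1%:R * s ^+ n.+2 = n.+1%:R * s ^+ n * s ^+ 2 by rewrite !exprS; ring.
  rewrite ler_wpM2r ?exprn_ge0// ler_wpM2l//.
  by apply: lerXn2r; rewrite ?nnegrE ?modulus_ge0.
have h2 : modulus (z * pow_rem n z c) * s ^+ 2 <= s * (n%:R ^+ 2 * s ^+ n * modulus (z - c)
  ^+ 2).
  rewrite modulusM -mulrA; apply: ler_pM => //; first exact: modulus_ge0.
  by rewrite mulr_ge0 ?exprn_ge0// modulus_ge0.
have h3 : modulus (z * pow_rem n z c + n%:R * c ^+ n.-1 * (z - c) ^+ 2) * s ^+ 2 <=
   modulus (z * pow_rem n z c) * s ^+ 2 + modulus (n%:R * c ^+ n.-1 * (z - c) ^+ 2) * s ^+ 2.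
  by rewrite -mulrDl ler_wpM2r ?exprn_ge0// modulusD.
apply: le_trans h3 _; apply: le_trans (lerD h2 h1) _.
rewrite -natr1 [s ^+ n.+1]exprS; set D := modulus (z - c) ^+ 2.
have -> : s * (n%:R ^+ 2 * s ^+ n * D) + n%:R * (s * s ^+ n) * D =
  (n%:R ^+ 2 + n%:R) * (s * s ^+ n * D) by ring.
rewrite -[leRHS]mulrA ler_wpM2r ?mulr_ge0 ?exprn_ge0 ?modulus_ge0//.
by have := ler0n R n; nra.
Qed.

(** Shaped after [G z - G c - d * (z - c)]. Other linear combinations come from [k = 0] or from a
    constant sequence. *)
Lemma cvgC_lin (u v w : nat -> C) (l1 l2 l3 k : C) :
  u @ \oo --> l1 -> v @ \oo --> l2 -> w @ \oo --> l3 ->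
  (fun n => u n - v n - w n * k) @ \oo --> l1 - l2 - l3 * k.
Proof.
move=> /cvg_modulus h1 /cvg_modulus h2 /cvg_modulus h3; apply/cvg_modulus.
apply: (@squeeze_cvgr _ _ _ _ (cst 0)
  (fun n => modulus (u n - l1) + modulus (v n - l2) + modulus (w n - l3) * modulus k)).
- near=> n; apply/andP; split; first exact: modulus_ge0.
  have -> : u n - v n - w n * k - (l1 - l2 - l3 * k) = (u n - l1) - (v n - l2) - (w n - l3)
    * k by ring.
  apply: le_trans (modulusD _ _) _; rewrite modulusN modulusM lerD2r.
  by apply: le_trans (modulusD _ _) _; rewrite modulusN.
- exact: cvg_cst.
- have := cvgD (cvgD h1 h2) (cvgM h3 (cvg_cst (modulus k))).
  by rewrite mul0r !addr0; exact.
Unshelve. all: by end_near. Qed.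

Definition has_taylor (F : C -> C) w r b := forall z, modulus z < r ->
  series (fun n => b n * z ^+ n) @ \oo --> F (w + z).

(** For [modulus c < s < r] the error [G z - G c - d * (z - c)] is the sum of the
    [b n * pow_rem n z c]. As [n%:R ^+ 2 * (s / r) ^+ n] is dominated by a geometric sequence, the
    error is quadratic in [z - c]. *)
Lemma pseries_cdiff b M r : 0 < r -> (forall n, modulus (b n) * r ^+ n <= M) ->
  exists G : C -> C, forall z, modulus z < r ->
    series (fun n => b n * z ^+ n) @ \oo --> G z /\ exists d, cdiff G z d.
Proof.
move=> r0 hb.
have M0 : 0 <= M by apply: le_trans (hb 0%N); rewrite expr0 mulr1 modulus_ge0.
have cv z : modulus z < r -> exists l : C, series (fun n => b n * z ^+ n) @ \oo --> l.
  move=> zr; have [||l hl _] := @cvg_series_geometric R (fun n => b n * z ^+ n) M (modulus z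
    / r).
  - by rewrite divr_ge0 ?modulus_ge0 ?(ltW r0)//= ltr_pdivrMr// mul1r.
  - move=> n; have -> : M * (modulus z / r) ^+ n = M / r ^+ n * modulus z ^+ n by rewrite
      exprMn exprVn; ring.
    rewrite modulusM modulusX ler_wpM2r ?exprn_ge0 ?modulus_ge0//.
    by rewrite ler_pdivlMr ?exprn_gt0.
  by exists l.
have /choice[G hG] : forall z, exists l : C, modulus z < r -> series (fun n => b n * z ^+ n)
  @ \oo --> l.
  move=> z; case: (boolP (modulus z < r)) => [/cv[l hl]|zr]; first by exists l.
  by exists 0.
exists G => c cr; split; first exact: hG.
pose s := (modulus c + r) / 2.
have cs : modulus c < s by rewrite /s; lra.
have s0 : 0 < s by apply: le_lt_trans cs; rewrite modulus_ge0.
have sr : s < r by rewrite /s; lra.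
have [|K [y [y01 K0 hK]]] := @sqr_exp_le (s / r).
  by rewrite divr_ge0 ?(ltW s0) ?(ltW r0)//= ltr_pdivrMr// mul1r.
have bs n : modulus (b n) * (n%:R ^+ 2 * s ^+ n) <= M * K * y ^+ n.
  have -> : modulus (b n) * (n%:R ^+ 2 * s ^+ n) = (modulus (b n) * r ^+ n) * (n%:R ^+ 2 *
    (s / r) ^+ n).
    have E : s ^+ n = (s / r) ^+ n * r ^+ n by rewrite -exprMn divfK// gt_eqF.
    by rewrite E; ring.
  rewrite -[leRHS]mulrA; apply: ler_pM => //.
    by rewrite mulr_ge0 ?modulus_ge0 ?exprn_ge0// ltW.
  by rewrite mulr_ge0 ?exprn_ge0// divr_ge0// ltW.
have [|d hd _] := @cvg_series_geometric R (fun n => b n * (n%:R * c ^+ n.-1)) (M * K / s) y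
  y01.
  move=> n; rewrite mulrAC ler_pdivlMr//; apply: le_trans (bs n).
  rewrite modulusM modulusM modulusX modulus_natr -mulrA ler_wpM2l ?modulus_ge0//.
  case: n => [|n]; first by rewrite !mul0r expr2 !mul0r.
  rewrite /= -mulrA; apply: ler_pM => //.
  - by rewrite mulr_ge0 ?exprn_ge0 ?modulus_ge0 ?(ltW s0).
  - by rewrite expr2 -[leLHS]mulr1 ler_wpM2l// ler1n.
  - by rewrite exprSr ler_wpM2r ?(ltW s0)//; apply: lerXn2r; rewrite ?nnegrE ?modulus_ge0
      ?(ltW cs) ?(ltW s0).
exists d.
have key z : modulus z < s -> modulus (G z - G c - d * (z - c)) <=
    (M * K / s ^+ 2 / (1 - y)) * modulus (z - c) ^+ 2.
  move=> zs.
  have h : series (fun n => b n * pow_rem n z c) @ \oo --> (G z - G c - d * (z - c) : C).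
    have h1 := hG _ (lt_trans zs sr); have h2 := hG _ cr.
    have -> : series (fun n => b n * pow_rem n z c) = fun n => series (fun n => b n * z ^+ n) n
        - series (fun n => b n * c ^+ n) n - series (fun n => b n * (n%:R * c ^+ n.-1)) n *
            (z - c).
      apply/funext; elim=> [|n IH]; first by rewrite !seriesC0 mul0r !subrr.
      rewrite !seriesCS IH /pow_rem; move: (series _ _) (series _ _) (series _ _) => A B E.
      by ring.
    exact: cvgC_lin h1 h2 hd.
  have [|l hl] := @cvg_series_geometric R (fun n => b n * pow_rem n z c) (M * K / s ^+ 2 *
    modulus (z - c) ^+ 2) y y01.
    move=> n; rewrite modulusM.
    have -> : M * K / s ^+ 2 * modulus (z - c) ^+ 2 * y ^+ n = M * K * y ^+ n * modulus (z -
      c) ^+ 2 / s ^+ 2 by ring.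
    rewrite ler_pdivlMr ?exprn_gt0// -[leLHS]mulrA.
    apply: le_trans (ler_wpM2l (modulus_ge0 (b n)) (pow_rem_le n s0 (ltW zs) (ltW cs))) _.
    by rewrite mulrA ler_wpM2r ?exprn_ge0 ?modulus_ge0.
  by rewrite (cvgC_unique hl h) => /le_trans; apply; rewrite mulrAC.
set L := _ / (1 - y) in key.
have L0 : 0 <= L.
  by rewrite /L !mulr_ge0// invr_ge0 ?exprn_ge0 ?(ltW s0)// subr_ge0 ltW//; case/andP: y01.
move=> e e0; exists (Num.min (s - modulus c) (e / (L + 1))).
  by rewrite lt_min subr_gt0 cs divr_gt0// ltr_wpDl.
move=> z; rewrite lt_min => /andP[h1].
rewrite ltr_pdivlMr ?ltr_wpDl// => h2.
have zs : modulus z < s by rewrite -[z](subrK c); apply: le_lt_trans (modulusD _ _) _; lra.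
apply: le_trans (key _ zs) _; rewrite expr2 mulrA ler_wpM2r ?modulus_ge0//.
by have := modulus_ge0 (z - c); nra.
Qed.
End taylor.

(** * Taylor expansion of holomorphic functions *)

Section taylor.
Context {R : realType}.
Local Notation C := (Cplx R).
Implicit Types (x y t r rho : R) (z w c : C) (u b : nat -> C).

Lemma continuous_modulus : continuous (fun z : C => modulus z).
Proof.
move=> z A /nbhs_ballP[e e0 h]; apply/nbhs_disc; exists e => // w wz; apply: h.
rewrite -ball_normE /ball_ /=; apply: le_lt_trans wz.
rewrite ler_norml; apply/andP; split.
  by rewrite lerNl opprB; apply: lerB_modulus.
by rewrite [leRHS]modulusBC; apply: lerB_modulus.
Qed.

(* Composing with this retraction makes a function on an open disc globally continuous without
   changing it on a smaller disc, so that it has primitives along entire lines. *)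
Definition retract rho z : C := z * (rho / Num.max (modulus z) rho)%:C%C.

Lemma retract_id rho z : 0 < rho -> modulus z <= rho -> retract rho z = z.
Proof.
by move=> rho0 zr; rewrite /retract max_r// divff ?mulr1// gt_eqF.
Qed.

Lemma modulus_retract rho z : 0 < rho -> modulus (retract rho z) <= rho.
Proof.
move=> rho0; have m0 : 0 < Num.max (modulus z) rho by rewrite lt_max rho0 orbT.
rewrite modulusM modulus_real ger0_norm ?divr_ge0 ?(ltW m0) ?(ltW rho0)//.
by rewrite mulrCA ler_piMr ?(ltW rho0)// ler_pdivrMr// mul1r le_max lexx.
Qed.

Lemma continuous_retract rho : 0 < rho -> continuous (retract rho).
Proof.
move=> rho0 z.
apply: (@continuousM _ _ (fun w => w) (fun w => (rho / Num.max (modulus w) rho)%:C%C));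
  first exact: cvg_id.
apply: (@continuous_comp _ _ _ (fun w : C => rho / Num.max (modulus w) rho) (fun t => t%:C%C
  : C)); last first.
  exact: (continuous_pdiff (@pdiff_id R)).
apply: (@continuous_comp _ _ _ (fun w : C => modulus w) (fun t : R => rho / Num.max t rho));
  first exact: continuous_modulus.
apply: continuousM; first exact: cst_continuous.
apply: continuousV; first by rewrite gt_eqF// lt_max rho0 orbT.
apply: continuous_max; [exact: cvg_id|exact: cst_continuous].
Qed.

Lemma cdiff_shift (F : C -> C) w z d : cdiff F (w + z) d -> cdiff (fun v => F (w + v)) z d.
Proof.
move=> h e /h[r r0 hr]; exists r => // v vz.
by have := hr (w + v); have -> : w + v - (w + z) = v - z; [ring|exact].
Qed.

Lemma taylor_rho (F : C -> C) w r rho : 0 < rho < r ->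
  holomorphic_on (disc w r) F -> exists b,
  (forall z, modulus z < rho -> exists K, forall n,
     modulus (F (w + z) - \sum_(0 <= k < n.+1) b k * z ^+ k) <= K * (modulus z / rho) ^+
       n.+1) /\
  (forall M, (forall z, modulus z = rho -> modulus (F (w + z)) <= M) ->
     forall k, modulus (b k) * rho ^+ k <= M).
Proof.
move=> /andP[rho0 rho_r] hF.
(* Strictly between: [f] agrees with the translate of [F] on a disc larger than the circle of
   integration, while the retraction stays where [F] is holomorphic. *)
pose rho1 := (rho + r) / 2.
have rho1_gt : rho < rho1 by rewrite /rho1; lra.
have rho1_lt : rho1 < r by rewrite /rho1; lra.
have rho10 : 0 < rho1 by lra.
have dF z : modulus z < r -> exists d, cdiff (fun v => F (w + v)) z d.
  move=> zr; have /derivable_cdiff[d hd] : derivable F (w + z) 1.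
    by apply: hF; rewrite /disc /= addrAC subrr add0r.
  by exists d; exact: cdiff_shift.
pose f z := F (w + retract rho1 z).
have fE z : modulus z <= rho1 -> f z = F (w + z) by move=> zr; rewrite /f retract_id.
have cf : continuous f.
  move=> z; apply: (@continuous_comp _ _ _ (retract rho1) (fun v => F (w + v))).
    exact: continuous_retract.
  have [d hd] := dF _ (le_lt_trans (modulus_retract z rho10) rho1_lt).
  exact: cdiff_continuous hd.
have df z : modulus z < rho1 -> exists d, cdiff f z d.
  move=> zr; have [d hd] := dF _ (lt_trans zr rho1_lt); exists d.
  apply: (@cdiff_near _ _ _ _ _ (rho1 - modulus z) _ _ hd); first by rewrite subr_gt0.
  move=> v hv; rewrite fE// -[v](subrK z); apply: le_trans (modulusD _ _) _; lra.
have cfc : continuous (fun t => f (circ rho t)).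
  by move=> t; apply: continuous_comp; [exact: (continuous_pdiff (pdiff_circ rho))|exact: cf].
have ccN : continuous (cisN : R -> C) by exact: (continuous_pdiff (@pdiff_cisN R)).
have /choice[B hB] : forall k, exists G, forall t, pdiff G t (f (circ rho t) * cisN t ^+ k).
  move=> k; apply: pdiff_antiderivative => t.
  exact: (continuousM (cfc t) (continuous_pdiff (fun t => pdiffX k (pdiff_cisN t)) (x := t))).
exists (cauchy_coef rho B); split=> [z zr|M hM k].
  have [K hK] := cauchy_remainder cf rho0 rho1_gt df hB zr.
  by exists K => n; rewrite -fE ?hK//; lra.
apply: (cauchy_estimate rho0 hB) => t; rewrite fE ?modulus_circ ?(ltW rho1_gt)//.
by apply: hM; rewrite modulus_circ.
Qed.

Lemma taylor_rho_cvg (F : C -> C) w r rho : 0 < rho < r ->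
  holomorphic_on (disc w r) F -> exists b, has_taylor F w rho b /\
  (forall M, (forall z, modulus z = rho -> modulus (F (w + z)) <= M) ->
     forall k, modulus (b k) * rho ^+ k <= M).
Proof.
move=> rr hF; have [b [hb hM]] := taylor_rho rr hF; exists b; split => // z zr.
have [K hK] := hb _ zr; have /andP[rho0 _] := rr.
rewrite -cvg_shiftS; apply/cvg_modulus.
apply: (@squeeze_cvgr _ _ _ _ (cst 0) (fun n => K * (modulus z / rho) ^+ n.+1)).
- near=> n; apply/andP; split; first exact: modulus_ge0.
  by rewrite modulusBC; exact: hK.
- exact: cvg_cst.
- rewrite -[X in _ --> X](mulr0 K); apply: cvgM; first exact: cvg_cst.
  rewrite (cvg_shiftS (fun n => (modulus z / rho) ^+ n)); apply: cvg_expr.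
  by rewrite ger0_norm ?divr_ge0 ?modulus_ge0 ?(ltW rho0)// ltr_pdivrMr// mul1r.
Unshelve. all: by end_near. Qed.

Lemma has_taylor_unique (F : C -> C) w r b b' : 0 < r ->
  has_taylor F w r b -> has_taylor F w r b' -> b = b'.
Proof.
move=> r0 hb hb'; apply/funext => n; apply/eqP; rewrite -subr_eq0; apply/eqP.
apply: (@pseries_eq0 R (fun n => b n - b' n) r r0) => z zr.
have := cvgC_lin (k := 0) (hb _ zr) (hb' _ zr) (hb _ zr).
rewrite mulr0 subr0 subrr.
suff -> : series (fun n => (b n - b' n) * z ^+ n) = fun n => series (fun n => b n * z ^+ n) n -
  series (fun n => b' n * z ^+ n) n - series (fun n => b n * z ^+ n) n * 0 by exact.
apply/funext; elim=> [|k IH]; first by rewrite !seriesC0 mul0r !subrr.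
by rewrite !seriesCS IH !mulr0; ring.
Qed.

Lemma has_taylor_le (F : C -> C) w r r' b : r' <= r -> has_taylor F w r b -> has_taylor F w
  r' b.
Proof. by move=> rr h z zr; apply: h; exact: lt_le_trans rr. Qed.

(** Each radius below [r] has its own Cauchy coefficients; by uniqueness they all coincide with
    those of radius [r / 2], which therefore represent [F] on the whole disc and satisfy all the
    Cauchy estimates. *)
Theorem taylor (F : C -> C) w r : 0 < r -> holomorphic_on (disc w r) F ->
  exists b, has_taylor F w r b /\
  (forall rho M, 0 < rho < r -> (forall z, modulus z = rho -> modulus (F (w + z)) <= M) ->
     forall k, modulus (b k) * rho ^+ k <= M).
Proof.
move=> r0 hF.
have r2 : 0 < r / 2 < r by lra.
have [b [hb _]] := taylor_rho_cvg r2 hF.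
have same rho b' : 0 < rho < r -> has_taylor F w rho b' -> b' = b.
  move=> rr hb'; apply: (@has_taylor_unique F w (Num.min rho (r / 2))).
  - by rewrite lt_min; lra.
  - by apply: has_taylor_le hb'; rewrite ge_min lexx.
  - by apply: has_taylor_le hb; rewrite ge_min lexx orbT.
exists b; split => [z zr|rho M rr hM].
  pose rho := (modulus z + r) / 2.
  have rr : 0 < rho < r by rewrite /rho; have := modulus_ge0 z; lra.
  have [b' [hb' _]] := taylor_rho_cvg rr hF.
  by rewrite -(same _ _ rr hb'); apply: hb'; rewrite /rho; lra.
have [b' [hb' hM']] := taylor_rho_cvg rr hF.
by rewrite -(same _ _ rr hb'); exact: hM'.
Qed.
End taylor.

(** * Convex sets, identity theorem and extensions *)

Section geometry.
Context {R : realType}.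
Local Notation C := (Cplx R).
Implicit Types (x y t r rho : R) (z w c : C) (K Y U : set C).

Definition convexC K := forall z w t, K z -> K w -> 0 <= t <= 1 -> K (z + t%:C%C * (w - z)).

Lemma convexC_connected K : convexC K -> connected K.
Proof.
move=> cK; have [->|/set0P[z Kz]] := eqVneq K set0; first exact: connected0.
pose seg w := [set z + t%:C%C * (w - z) | t in `[0, 1]%classic : set R].
have segz w : seg w z by exists 0; rewrite /= ?in_itv/= ?lexx ?ler01// mul0r addr0.
have segw w : seg w w by exists 1; rewrite /= ?in_itv/= ?lexx ?ler01// mul1r subrKC.
have -> : K = \bigcup_(w in K) seg w.
  apply/seteqP; split => [w Kw|_ [w Kw [t t01 <-]]]; first by exists w.
  by apply: cK; move: t01; rewrite //= in_itv.
apply: bigcup_connected; first by exists z.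
move=> w Kw; apply: connected_continuous_connected; first exact: segment_connected.
apply: continuous_subspaceT.
exact: (continuous_pdiff (fun t => pdiffD (pdiff_cst z t) (pdiffM (pdiff_id t) (pdiff_cst (w
  - z) t)))).
Qed.

Lemma disc_center c r : 0 < r -> disc c r c.
Proof. by move=> r0; rewrite /disc /= subrr modulus0. Qed.

Lemma unit_discE z : unit_disc z = (modulus z < 1) :> Prop.
Proof. by rewrite /unit_disc /disc /= subr0. Qed.

Lemma convexC_disc c r : convexC (disc c r).
Proof.
move=> z w t; rewrite /disc /= => zr wr /andP[t0 t1].
have -> : z + t%:C%C * (w - z) - c = (1 - t)%:C%C * (z - c) + t%:C%C * (w - c).
  by rewrite rmorphB rmorph1; ring.
apply: le_lt_trans (modulusD _ _) _; rewrite !modulusM !modulus_real !ger0_norm ?subr_ge0//.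
have [->|tn0] := eqVneq t 0; first by rewrite subr0 mul0r mul1r addr0.
have tp : 0 < t by rewrite lt_neqAle eq_sym tn0.
by nra.
Qed.

Lemma convexC_unit_disc : convexC (@unit_disc R).
Proof. exact: convexC_disc. Qed.

Lemma convexCI K U : convexC K -> convexC U -> convexC (K `&` U).
Proof. by move=> hK hU z w t [Kz Uz] [Kw Uw] t01; split; [exact: hK|exact: hU]. Qed.

(** Applied to the intersection of a disc with [unit_disc], this removes the components from
    [totally_unbounded]. *)
Lemma component_convexC K Y : convexC K -> is_component K Y -> Y = K.
Proof.
by move=> cK [z Kz ->]; apply: connected_component_id => //; exact: convexC_connected.
Qed.

Lemma disc_sub c c' r r' : modulus (c - c') + r <= r' -> disc c r `<=` disc c' r'.
Proof.
move=> h z; rewrite /disc /= => zr.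
rewrite (_ : z - c' = (z - c) + (c - c')); last by ring.
by apply: le_lt_trans (modulusD _ _) _; lra.
Qed.

Lemma disc_open c r : open (disc c r).
Proof.
apply/open_disc => z zr; exists (r - modulus (z - c)); first by rewrite subr_gt0.
by apply: disc_sub; rewrite addrC subrK.
Qed.

Lemma closure_disc U z : closure U z <-> forall e, 0 < e -> exists2 w, U w & modulus (w - z)
  < e.
Proof.
split => [h e e0|h A /nbhs_disc[e e0 eA]].
  have nz : nbhs z (disc z e) by apply/nbhs_disc; exists e.
  have [w [Uw wA]] := h _ nz.
  by exists w.
by have [w Uw we] := h _ e0; exists w; split => //; exact: eA.
Qed.

(** The set [A] of centres of discs on which [h] vanishes is open and closed in [K]. For closedness,
    expand [h] at a point [c'] of [A] near the limit point [c]: all coefficients vanish, and the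
    disc of expansion contains [c]. *)
Lemma identity_theorem K (h : C -> C) w r : open K -> connected K -> holomorphic_on K h ->
  K w -> 0 < r -> (forall z, disc w r z -> h z = 0) -> forall z, K z -> h z = 0.
Proof.
move=> oK cK hK Kw r0 hw.
pose A := [set c | K c /\ exists2 e, 0 < e & forall z, disc c e z -> h z = 0].
suff -> : K = A by move=> z [_ [e e0]]; apply; exact: disc_center.
apply/esym/cK; first by exists w; split => //; exists r.
- exists A; last by apply/seteqP; split => z; [move=> Az; split => //; case: Az|case].
  apply/open_disc => c [Kc [e e0 ec]].
  have [e' e'0 he'] := (proj1 (open_disc _) oK) _ Kc.
  exists (Num.min (e / 2) e'); first by rewrite lt_min e'0 divr_gt0.
  move=> z; rewrite /disc /= lt_min => /andP[ze ze']; split; first exact: he'.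
  exists (e / 2); first by rewrite divr_gt0.
  by move=> v vz; apply: ec; apply: disc_sub vz; lra.
exists (closure A); first exact: closed_closure.
apply/seteqP; split => c; first by move=> Ac; split; [case: Ac|exact: subset_closure].
move=> [Kc /closure_disc clA]; split => //.
have [e e0 he] := (proj1 (open_disc _) oK) _ Kc.
have e2 : 0 < e / 2 by rewrite divr_gt0.
have [c' [Kc' [d d0 hd]] c'c] := clA _ e2.
have sub : disc c' (e / 2) `<=` K.
  by apply: subset_trans he; apply: disc_sub; lra.
have [b [hb _]] := taylor e2 (fun z Dz => hK _ (sub _ Dz)).
have b0 : forall n, b n = 0.
  apply: (@pseries_eq0 _ b (Num.min d (e / 2))); first by rewrite lt_min d0.
  move=> z; rewrite lt_min => /andP[zd ze].
  have := hb _ ze; rewrite hd//.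
  by rewrite /disc /= addrAC subrr add0r.
exists (e / 2 - modulus (c' - c)); first by rewrite subr_gt0.
move=> z zc.
have zc' : modulus (z - c') < e / 2.
  rewrite (_ : z - c' = (z - c) + (c - c')); last by ring.
  by apply: le_lt_trans (modulusD _ _) _; move: zc; rewrite /disc /= [modulus (c -
    c')]modulusBC; lra.
have := hb _ zc'; rewrite subrKC => h1.
apply: (cvgC_unique h1).
have -> : series (fun n => b n * (z - c') ^+ n) = cst 0; last exact: cvg_cst.
by apply/funext; elim=> [|n IH]; rewrite ?seriesC0// seriesCS IH b0 mul0r addr0.
Qed.

(** The component [Y] has a limit point on the circle inside [U]: otherwise [Y] would be open and
    closed in [U], hence equal to [U], which contains a point of the circle. A small disc about such
    a limit point meets [unit_disc] in a convex set that meets [Y], so this set lies in [Y]. *)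
Lemma extendable_local (f : C -> C) : extendable f -> exists zeta e F,
  [/\ unit_circle zeta, 0 < e, holomorphic_on (disc zeta e) F &
   forall z, disc zeta e z -> unit_disc z -> f z = F z].
Proof.
move=> [U [F [[oU cU [u Uu] [v [v1 Uv]]] [hF [Y [z0 Az0 YE] fF]]]]].
have oUd z : (U `&` unit_disc) z -> exists2 e, 0 < e & disc z e `<=` U `&` unit_disc.
  have /open_disc h : open (U `&` unit_disc) by apply: openI => //; exact: disc_open.
  exact: h.
have inY (y : C) (S : set C) : Y y -> S y -> S `<=` U `&` unit_disc -> convexC S -> S `<=` Y.
  move=> Yy Sy SU cS; rewrite YE in Yy *.
  rewrite (same_connected_component Yy).
  by apply: connected_component_max => //; exact: convexC_connected.
have YU : Y `<=` U `&` unit_disc by rewrite YE; exact: connected_component_sub.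
have [zeta [z1 Uz cz]] : exists zeta, [/\ unit_circle zeta, U zeta & closure Y zeta].
  apply: contrapT => no.
  suff YeU : Y = U by have [] := YU v; [rewrite YeU|move=> _; rewrite unit_discE v1 ltxx].
  apply: cU; first by exists z0; rewrite YE; exact: connected_component_refl.
    exists Y; last by apply/seteqP; split => z; [move=> Yz; split => //; case: (YU _ Yz)|case].
    apply/open_disc => y Yy; have [e e0 ey] := oUd _ (YU _ Yy); exists e => //.
    by apply: (inY y) => //; [exact: disc_center|exact: convexC_disc].
  exists (closure Y); first exact: closed_closure.
  apply/seteqP; split => z; first by move=> Yz; split; [case: (YU _ Yz)|exact: subset_closure].
  move=> [Uz clz]; have /closure_disc clz' := clz.
  have z1 : modulus z <= 1.
    apply/ler_addgt0Pl => e e0; have [w Yw wz] := clz' _ e0.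
    have [_] := YU _ Yw; rewrite unit_discE => w1.
    have := modulusD (z - w) w; rewrite subrK modulusBC; lra.
  have Dz : unit_disc z.
    rewrite unit_discE lt_neqAle z1 andbT; apply/eqP => z1'; apply: no; exists z; split => //.
  have [e e0 he] := oUd z (conj Uz Dz).
  have [w Yw wz] := clz' _ e0.
  by apply: (inY w _ Yw wz he (@convexC_disc _ _)); exact: disc_center.
have [e e0 he] := (proj1 (open_disc _) oU) _ Uz.
exists zeta, e, F; split; [exact: z1|exact: e0|by move=> z ze; apply: hF; exact: he|move=> z
  ze zD].
apply: fF; have /closure_disc/(_ _ e0)[w Yw wz] := cz.
have [_ Dw] := YU _ Yw.
apply: (inY w (disc zeta e `&` unit_disc)) => //.
- by move=> v' [h1 h2]; split => //; exact: he.
- by apply: convexCI; [exact: convexC_disc|exact: convexC_unit_disc].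
Qed.

Lemma local_extendable (f F : C -> C) w r : unit_disc w -> 0 < r -> 1 < modulus w + r ->
  holomorphic_on (disc w r) F -> (forall z, disc w r z -> unit_disc z -> f z = F z) ->
  extendable f.
Proof.
move=> w1 r0 wr hF fF; exists (disc w r), F; split; first split.
- exact: disc_open.
- exact/convexC_connected/convexC_disc.
- by exists w; exact: disc_center.
- have [w0|w0] := eqVneq w 0.
    exists 1; split; first exact: modulus1.
    by rewrite /disc /= w0 subr0 modulus1; rewrite w0 modulus0 add0r in wr.
  have mw : modulus w != 0 by rewrite modulus_eq0.
  (* The radial projection of [w] is at distance [1 - modulus w < r] from [w]. *)
  exists (w / (modulus w)%:C%C); split.
    by rewrite /unit_circle /= modulusM modulusV modulus_real ger0_norm ?modulus_ge0// divff.
  rewrite /disc /=.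
  have -> : w / (modulus w)%:C%C - w = w * ((modulus w)^-1 - 1)%:C%C.
    by rewrite rmorphB rmorph1 fmorphV; ring.
  rewrite unit_discE in w1.
  rewrite modulusM modulus_real ger0_norm; last first.
    by rewrite subr_ge0 -invr1 lef_pV2 ?posrE ?ltr01 ?(ltW w1)// lt_neqAle eq_sym mw
      modulus_ge0.
  by rewrite mulrBr divff// mulr1; lra.
split; first exact: hF.
exists (disc w r `&` unit_disc); last by move=> z [h1 h2]; exact: fF.
have wD : (disc w r `&` unit_disc) w by split => //; exact: disc_center.
exists w => //; rewrite connected_component_id//.
by apply: convexC_connected; apply: convexCI; [exact: convexC_disc|exact: convexC_unit_disc].
Qed.

Lemma unit_circle_radial (zeta : C) (e : R) : unit_circle zeta -> 0 < e -> e <= 1 ->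
  disc zeta e ((1 - e / 2)%:C%C * zeta) /\ unit_disc ((1 - e / 2)%:C%C * zeta).
Proof.
move=> z1 e0 e1; rewrite unit_discE /disc /=.
have -> : (1 - e / 2)%:C%C * zeta - zeta = - (e / 2)%:C%C * zeta.
  by rewrite rmorphB rmorph1; ring.
rewrite !modulusM modulusN !modulus_real z1 !mulr1 !ger0_norm; lra.
Qed.

Lemma totally_unboundedP (f : C -> C) : totally_unbounded f <->
  forall (zeta : C) (e : R), unit_circle zeta -> 0 < e -> unbounded_on (disc zeta e `&`
    unit_disc) f.
Proof.
have cv (zeta : C) (e : R) : convexC (disc zeta e `&` unit_disc) by apply: convexCI; [exact:
  convexC_disc|exact: convexC_unit_disc].
split => h zeta e z1 e0; last first.
  by move=> Y /(component_convexC (cv _ _)) ->; exact: h.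
apply: (h zeta e) => //.
pose m := Num.min e 1; have m0 : 0 < m by rewrite lt_min e0 ltr01.
have m1 : m <= 1 by rewrite ge_min lexx orbT.
have me : m <= e by rewrite ge_min lexx.
have [h1 h2] := unit_circle_radial z1 m0 m1.
have hin : (disc zeta e `&` unit_disc) ((1 - m / 2)%:C%C * zeta).
  by split => //; apply: disc_sub h1; rewrite subrr modulus0 add0r.
exists ((1 - m / 2)%:C%C * zeta) => //.
by rewrite connected_component_id//; exact/convexC_connected/cv.
Qed.

Lemma totally_unbounded_nonextendable (f : C -> C) : totally_unbounded f -> ~ extendable f.
Proof.
move=> /totally_unboundedP tu /extendable_local[zeta [e [F [z1 e0 hF fF]]]].
have /derivable_cdiff[d hd] := hF _ (disc_center zeta e0).
have /nbhs_disc[r r0 hr] : nbhs zeta (F @^-1` disc (F zeta) 1).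
  by apply: (cdiff_continuous hd); apply/nbhs_disc; exists 1.
have m0 : 0 < Num.min r e by rewrite lt_min r0.
apply: (tu _ _ z1 m0); exists (modulus (F zeta) + 1) => z [].
rewrite /disc /= lt_min => /andP[zr ze] Dz; rewrite fF//.
have := hr _ zr; rewrite /disc /= => h.
rewrite -[F z](subrK (F zeta)); apply: le_trans (modulusD _ _) _; lra.
Qed.
End geometry.

(** * G_delta sets *)

Section coefficients.
Context {R : realType}.
Local Notation C := (Cplx R).
Implicit Types (x y t r rho e : R) (z w c : C) (f g F : C -> C) (a b : nat -> C).

Lemma has_taylor_eq f F w r b : (forall z, disc w r z -> f z = F z) ->
  has_taylor f w r b -> has_taylor F w r b.
Proof.
move=> fF hf z zr; rewrite -fF; first exact: hf.
by rewrite /disc /= addrAC subrr add0r.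
Qed.

Lemma has_taylorB f F w r b b' : has_taylor f w r b -> has_taylor F w r b' ->
  has_taylor (fun z => f z - F z) w r (fun n => b n - b' n).
Proof.
move=> h h' z zr; have := cvgC_lin (k := 0) (h _ zr) (h' _ zr) (h _ zr).
rewrite mulr0 subr0.
suff -> : series (fun n => (b n - b' n) * z ^+ n) = fun n => series (fun n => b n * z ^+ n) n -
  series (fun n => b' n * z ^+ n) n - series (fun n => b n * z ^+ n) n * 0 by exact.
apply/funext; elim=> [|k IH]; first by rewrite !seriesC0 mul0r !subrr.
by rewrite !seriesCS IH !mulr0; ring.
Qed.

(* Junk value 0 if [f] has no Taylor expansion at [w]. *)
Definition tcoef f w : nat -> C :=
  xget (fun=> 0) [set b | exists2 r, 0 < r & has_taylor f w r b].

Lemma tcoefE f w r b : 0 < r -> has_taylor f w r b -> tcoef f w = b.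
Proof.
move=> r0 hb; rewrite /tcoef; case: xgetP => [b' _ [r' r'0 hb']|/(_ b)[]]; last by exists r.
apply: (@has_taylor_unique _ f w (Num.min r r')); first by rewrite lt_min r0.
  by apply: has_taylor_le hb'; rewrite ge_min lexx orbT.
by apply: has_taylor_le hb; rewrite ge_min lexx.
Qed.

Lemma has_taylor_tcoef f w r : 0 < r -> holomorphic_on (disc w r) f ->
  has_taylor f w r (tcoef f w).
Proof. by move=> r0 /(taylor r0)[b [hb _]]; rewrite (tcoefE r0 hb). Qed.

Lemma has_taylor_unit f a : has_taylor f 0 1 a <->
  forall z, unit_disc z -> series (fun n => a n * z ^+ n) @ \oo --> f z.
Proof.
split=> [h z|h z z1]; first by rewrite unit_discE => /h; rewrite add0r.
by rewrite add0r; apply: h; rewrite unit_discE.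
Qed.

Lemma coefE f a : has_taylor f 0 1 a -> coef f = a.
Proof.
move=> ha; rewrite /coef; case: xgetP => [b _ /= /has_taylor_unit hb|/(_ a)[]].
  exact: has_taylor_unique ltr01 hb ha.
exact/has_taylor_unit.
Qed.

Lemma has_taylor_coef f : holomorphic_on unit_disc f -> has_taylor f 0 1 (coef f).
Proof. by move=> /(taylor ltr01)[b [hb _]]; rewrite (coefE hb). Qed.

Lemma holomorphic_onB K f g : holomorphic_on K f -> holomorphic_on K g ->
  holomorphic_on K (fun z => f z - g z).
Proof. by move=> hf hg z Kz; apply: derivableB; [exact: hf|exact: hg]. Qed.

Lemma holomorphic_on_sub K L f : K `<=` L -> holomorphic_on L f -> holomorphic_on K f.
Proof. by move=> KL hf z /KL; exact: hf. Qed.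

Lemma coef_close_eval f g e : holomorphic_on unit_disc f -> holomorphic_on unit_disc g ->
  (forall n, modulus (coef f n - coef g n) <= e) ->
  forall z, unit_disc z -> modulus (f z - g z) <= e / (1 - modulus z).
Proof.
move=> hf hg he z z1; have z1' := z1; rewrite unit_discE in z1'.
have := has_taylorB (has_taylor_coef hf) (has_taylor_coef hg) z1'; rewrite add0r => h.
have [|n|l hl] := @cvg_series_geometric R (fun n => (coef f n - coef g n) * z ^+ n) e
  (modulus z).
- by rewrite modulus_ge0.
- by rewrite modulusM modulusX ler_wpM2r// exprn_ge0// modulus_ge0.
by rewrite (cvgC_unique hl h).
Qed.

Lemma disc_in_unit_disc w : disc w (1 - modulus w) `<=` unit_disc.
Proof. by apply: disc_sub; rewrite subr0 subrKC. Qed.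

(** Cauchy's estimate for [f - g] on the circle of radius [(1 - modulus w) / 2] about [w]: its
    points have modulus at most [(1 + modulus w) / 2], where [coef_close_eval] bounds the
    difference. *)
Lemma coef_close_tcoef f g e w : holomorphic_on unit_disc f -> holomorphic_on unit_disc g ->
  (forall n, modulus (coef f n - coef g n) <= e) -> unit_disc w ->
  forall n, modulus (tcoef f w n - tcoef g w n) * ((1 - modulus w) / 2) ^+ n <=
     2 * e / (1 - modulus w).
Proof.
move=> hf hg he w1 n; rewrite unit_discE in w1.
have r0 : 0 < 1 - modulus w by rewrite subr_gt0.
have hf' := holomorphic_on_sub (@disc_in_unit_disc w) hf.
have hg' := holomorphic_on_sub (@disc_in_unit_disc w) hg.
have [b [hb hM]] := taylor r0 (holomorphic_onB hf' hg').
have E : b = fun n => tcoef f w n - tcoef g w n.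
  apply: (has_taylor_unique r0 hb); apply: has_taylorB; exact: has_taylor_tcoef.
have := hM ((1 - modulus w) / 2) (2 * e / (1 - modulus w)); rewrite E; apply; first by lra.
move=> z zE.
have e0 : 0 <= e by apply: le_trans (he 0%N); rewrite modulus_ge0.
have wz : modulus (w + z) <= (1 + modulus w) / 2.
  by apply: le_trans (modulusD _ _) _; rewrite zE; lra.
have wz1 : 0 < 1 - modulus (w + z) by lra.
apply: le_trans (coef_close_eval hf hg he _) _; first by rewrite unit_discE; lra.
rewrite ler_pdivrMr// mulrAC ler_pdivlMr//; nra.
Qed.
End coefficients.

(** * Countable descriptions of both properties *)

Section rational_discs.
Context {R : realType}.
Local Notation C := (Cplx R).
Implicit Types (x y t r rho e : R) (z w c : C) (f g F : C -> C) (a b : nat -> C).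

Definition rat_pt (q : rat * rat) : C := pt (ratr q.1) (ratr q.2).

Lemma rat_pt_dense z e : 0 < e -> exists q, modulus (rat_pt q - z) < e.
Proof.
move=> e0.
have ex x : exists q : rat, `|ratr q - x| < e / 2.
  have [q] := @rat_in_itvoo R (x - e / 2) (x + e / 2) ltac:(lra).
  by rewrite in_itv/= => /andP[h1 h2]; exists q; rewrite ltr_norml; lra.
have [q1 h1] := ex (complex.Re z); have [q2 h2] := ex (complex.Im z).
exists (q1, q2); rewrite -[z]pt_eta.
by apply: le_lt_trans (modulus_pt (ratr q1 - complex.Re z) (ratr q2 - complex.Im z)) _; lra.
Qed.

(* A rational disc (centre, radius) together with a bound. *)
Definition code := ((rat * rat) * rat * nat)%type.

(** Numbers that encode nothing, and codes outside [P], contribute the whole space to the countable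
    intersection. *)
Lemma Gdelta_code (T : topologicalType) (P : code -> Prop) (O : code -> set T) :
  (forall q, P q -> open (O q)) -> Gdelta [set f | forall q, P q -> O q f].
Proof.
move=> oO; exists (fun i => if unpickle i is Some q then [set f | P q -> O q f] else setT).
  move=> i; case: (unpickle i) => [q|]; last exact: openT.
  have [Pq|nPq] := pselect (P q).
    by rewrite (_ : [set f | _] = O q); [exact: oO|apply/seteqP; split => f; [exact|move=>
      Of _]].
  by rewrite (_ : [set f | _] = setT); [exact: openT|apply/seteqP; split => // f _ /nPq].
apply/seteqP; split => f hf; first by move=> i _; case: (unpickle i) => // q; exact: hf.
by move=> q; have := hf (pickle q) I; rewrite pickleK.
Qed.

Lemma rat_between x y : x < y -> exists q : rat, x < ratr q < y.
Proof. by move=> /rat_in_itvoo[q]; rewrite in_itv/= => h; exists q. Qed.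

Lemma rat_disc_meet (zeta : C) e : 0 < e -> exists q (r : rat),
  disc (rat_pt q) (ratr r) zeta /\ disc (rat_pt q) (ratr r) `<=` disc zeta e.
Proof.
move=> e0; have [q hq] := rat_pt_dense zeta (divr_gt0 e0 (ltr0Sn _ 3)).
have [r /andP[r1 r2]] := @rat_between (e / 4) (e / 2) ltac:(lra).
exists q, r; split; first by rewrite /disc /= modulusBC; lra.
by apply: disc_sub; lra.
Qed.

(** A rational disc that meets the circle contains a disc about a point of the circle, and every
    disc of the latter kind contains a rational one that meets the circle. *)
Lemma totally_unbounded_code f : totally_unbounded f <->
  forall q : code, (exists2 zeta : C, unit_circle zeta & disc (rat_pt q.1.1) (ratr q.1.2)
    zeta) ->
    exists z, [/\ disc (rat_pt q.1.1) (ratr q.1.2) z, unit_disc z & q.2%:R < modulus (f z)].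
Proof.
rewrite totally_unboundedP; split => [h [[w r] M] /= [zeta z1 zwr]|h zeta e z1 e0 [M hM]].
  have e0 : 0 < ratr r - modulus (zeta - rat_pt w) by rewrite subr_gt0.
  apply: contrapT => no; apply: (h zeta _ z1 e0); exists M%:R => z [ze Dz].
  rewrite leNgt; apply/negP => hz; apply: no; exists z; split => //.
  by apply: disc_sub ze; lra.
have [q [r [h1 h2]]] := rat_disc_meet zeta e0.
have [|z [zq Dz]] := h (q, r, (Num.truncn M).+1); first by exists zeta.
apply/negP; rewrite -leNgt; apply: le_trans (hM z _) _; first by split => //; exact: h2.
exact/ltW/truncnS_gt.
Qed.

Lemma nonextendable_code f : holomorphic_on unit_disc f ->
  ~ extendable f <-> forall q : code,
   [/\ unit_disc (rat_pt q.1.1), 0 < ratr q.1.2 :> R & 1 < modulus (rat_pt q.1.1) + ratr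
     q.1.2] ->
    exists n, q.2%:R < modulus (tcoef f (rat_pt q.1.1) n) * ratr q.1.2 ^+ n.
Proof.
move=> hf; split => [next [[q r] M] /= [w1 r0 wr]|h ext].
  apply: contrapT => no; apply: next.
  set w := rat_pt q in w1 wr no.
  have hb n : modulus (tcoef f w n) * ratr r ^+ n <= M%:R.
    by rewrite leNgt; apply/negP => hn; apply: no; exists n.
  have [G hG] := pseries_cdiff r0 hb.
  pose F z := G (z - w).
  have hF : holomorphic_on (disc w (ratr r)) F.
    move=> z zr; apply/derivable_cdiff; have [_ [d hd]] := hG _ zr; exists d.
    by rewrite /F; under [fun z => _]eq_fun do rewrite addrC; apply: cdiff_shift; rewrite
      addrC.
  apply: (local_extendable w1 r0 wr hF) => z zr Dz; apply/eqP; rewrite -subr_eq0; apply/eqP.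
  have w1' : 0 < 1 - modulus w by rewrite subr_gt0 -unit_discE.
  (* Within [rho] of [w] both [f] and [F] are sums of the power series with coefficients
     [tcoef f w]; the identity theorem carries the equality to the whole intersection. *)
  pose rho : R := Num.min (ratr r) (1 - modulus w).
  have rho0 : 0 < rho by rewrite lt_min r0.
  apply: (@identity_theorem _ (disc w (ratr r) `&` unit_disc) (fun z => f z - F z) w rho) =>
    //.
  - by apply: openI; exact: disc_open.
  - by apply: convexC_connected; apply: convexCI; [exact: convexC_disc|exact:
      convexC_unit_disc].
  - apply: holomorphic_onB; [apply: holomorphic_on_sub hf|apply: holomorphic_on_sub hF].
      by move=> v [].
    by move=> v [].
  - by split => //; exact: disc_center.
  move=> v; rewrite /disc /= lt_min => /andP[v1 v2].
  have [h1 _] := hG _ v1.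
  have := has_taylor_tcoef w1' (holomorphic_on_sub (@disc_in_unit_disc _ w) hf) v2.
  by rewrite subrKC => h2; rewrite (cvgC_unique h2 h1) subrr.
have [zeta [e [F [z1 e0 hF fF]]]] := extendable_local ext.
pose m := Num.min e 1; have m0 : 0 < m by rewrite lt_min e0 ltr01.
have m1 : m <= 1 by rewrite ge_min lexx orbT.
have me : m <= e by rewrite ge_min lexx.
(* A rational [w] within [m / 8] of [p] is within [m / 4] of [zeta]. Thus the disc of radius
   [3 * m / 4] about [w] lies in the domain of [F], and a rational radius between [m / 4] and
   [m / 2] crosses the circle and leaves room for the expansion of [F] to converge. *)
pose p := (1 - m / 8)%:C%C * zeta.
have mp : modulus p = 1 - m / 8.
  by rewrite /p modulusM modulus_real z1 mulr1 ger0_norm//; lra.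
have pz : modulus (p - zeta) = m / 8.
  rewrite /p; have -> : (1 - m / 8)%:C%C * zeta - zeta = - (m / 8)%:C%C * zeta.
    by rewrite rmorphB rmorph1; ring.
  by rewrite modulusM modulusN modulus_real z1 mulr1 ger0_norm//; lra.
have [q hq] := rat_pt_dense p (divr_gt0 m0 (ltr0Sn _ 7)).
set w := rat_pt q in hq.
have [r /andP[r1 r2]] := @rat_between (m / 4) (m / 2) ltac:(lra).
have wz : modulus (w - zeta) < m / 4.
  by rewrite -[w](subrK p) -addrA; apply: le_lt_trans (modulusD _ _) _; lra.
have w1 : modulus w < 1.
  by rewrite -[w](subrK p); apply: le_lt_trans (modulusD _ _) _; lra.
have wr : 1 < modulus w + ratr r.
  have := modulusD (zeta - w) w; rewrite subrK z1 modulusBC; lra.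
have sub : disc w (3 * m / 4) `<=` disc zeta e by apply: disc_sub; lra.
have r34 : 0 < 3 * m / 4 by lra.
have [b [hb _]] := taylor r34 (holomorphic_on_sub sub hF).
have r0 : 0 < ratr r :> R by lra.
have rr : modulus ((ratr r)%:C%C : C) < 3 * m / 4 by rewrite modulus_real ger0_norm; lra.
have [M hM] := cvg_series_terms_bounded (hb _ rr).
have tb : tcoef f w = b.
  have rho0 : 0 < Num.min (3 * m / 4) (1 - modulus w) by rewrite lt_min r34 subr_gt0.
  apply: (tcoefE rho0); apply: (@has_taylor_eq _ F).
    move=> z; rewrite /disc /= lt_min => /andP[v1 v2]; apply/esym/fF; first exact: sub.
    exact: (@disc_in_unit_disc _ w).
  by apply: has_taylor_le hb; rewrite ge_min lexx.
have [|n] := h (q, r, (Num.truncn M).+1); first by split; rewrite ?unit_discE.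
rewrite /= -/w tb; apply/negP; rewrite -leNgt.
apply: (@le_trans _ _ M); last exact/ltW/truncnS_gt.
by apply: le_trans (hM n); rewrite modulusM modulusX modulus_real ger0_norm// ltW.
Qed.

Variables (A : set (C -> C)) (d : (C -> C) -> (C -> C) -> R).
Hypothesis A_holo : forall f, A f -> holomorphic_on unit_disc f.
Hypothesis close_coef : forall f e, A f -> 0 < e -> exists2 eta : R, 0 < eta &
  forall g, A g -> d f g < eta -> forall n, modulus (coef f n - coef g n) <= e.

(** The only passage from the metric of the space to the sup norm of the coefficients. *)
Lemma coef_open (Q : (C -> C) -> Prop) :
  (forall f, A f -> Q f -> exists2 e : R, 0 < e &
    forall g, A g -> (forall n, modulus (coef f n - coef g n) <= e) -> Q g) ->
  open [set f : metric_sub A d | Q (set_val f)].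
Proof.
move=> hQ; rewrite metric_openE => f Qf.
have Af : A (set_val f) := set_valP f.
have [e e0 he] := hQ _ Af Qf; have [eta eta0 heta] := close_coef Af e0.
exists eta => // g dfg; apply: he; first exact: (set_valP g).
by apply: heta => //; exact: (set_valP g).
Qed.

Lemma Gdelta_totally_unbounded :
  Gdelta [set f : metric_sub A d | totally_unbounded (set_val f)].
Proof.
have -> : [set f : metric_sub A d | totally_unbounded (set_val f)] =
  [set f : metric_sub A d | forall q : code,
     (exists2 zeta : C, unit_circle zeta & disc (rat_pt q.1.1) (ratr q.1.2) zeta) ->
    [set f : metric_sub A d | exists z, [/\ disc (rat_pt q.1.1) (ratr q.1.2) z, unit_disc z &
       q.2%:R < modulus (set_val f z)]] f].
  by apply/seteqP; split => f /totally_unbounded_code.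
apply: Gdelta_code => -[[w r] M] _ /=.
apply: (@coef_open (fun f => exists z, [/\ disc (rat_pt w) (ratr r) z, unit_disc z &
  M%:R < modulus (f z)])) => f Af [z [zw Dz hz]].
have z1 : 0 < 1 - modulus z by rewrite subr_gt0 -unit_discE.
(* By [coef_close_eval] the value at [z] then moves by at most half of its excess over [M]. *)
exists ((modulus (f z) - M%:R) / 2 * (1 - modulus z)); first by rewrite mulr_gt0//
  divr_gt0// subr_gt0.
move=> g Ag hfg; exists z; split => //.
have := coef_close_eval (A_holo Af) (A_holo Ag) hfg Dz; rewrite mulfK ?gt_eqF//.
have := lerB_modulus (f z) (f z - g z); rewrite opprB subrKC; lra.
Qed.

Lemma Gdelta_nonextendable :
  Gdelta [set f : metric_sub A d | ~ extendable (set_val f)].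
Proof.
have -> : [set f : metric_sub A d | ~ extendable (set_val f)] =
  [set f : metric_sub A d | forall q : code,
   [/\ unit_disc (rat_pt q.1.1), 0 < ratr q.1.2 :> R & 1 < modulus (rat_pt q.1.1) + ratr
     q.1.2] ->
    [set f : metric_sub A d | exists n,
       q.2%:R < modulus (tcoef (set_val f) (rat_pt q.1.1) n) * ratr q.1.2 ^+ n] f].
  by apply/seteqP; split => f /(nonextendable_code (A_holo (set_valP f))).
apply: Gdelta_code => -[[q r] M] /= [w1 r0 _].
apply: (@coef_open (fun f => exists n, M%:R < modulus (tcoef f (rat_pt q) n) * ratr r ^+ n))
  => f Af [n hn].
set w := rat_pt q in w1 hn *.
have s0 : 0 < 1 - modulus w by rewrite subr_gt0 -unit_discE.
pose gap := modulus (tcoef f w n) * ratr r ^+ n - M%:R.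
have gap0 : 0 < gap by rewrite subr_gt0.
(* By [coef_close_tcoef], changing the Taylor coefficients at 0 by at most [e] moves
   [modulus (tcoef f w n) * ratr r ^+ n] by at most [e * K]. *)
pose K := ratr r ^+ n / ((1 - modulus w) / 2) ^+ n * (2 / (1 - modulus w)).
have K0 : 0 < K by rewrite !mulr_gt0 ?invr_gt0 ?exprn_gt0// divr_gt0.
exists (gap / 2 / K); first by rewrite !divr_gt0.
move=> g Ag hfg; exists n.
have h := coef_close_tcoef (A_holo Af) (A_holo Ag) hfg w1 n.
have h1 : modulus (tcoef f w n - tcoef g w n) * ratr r ^+ n <= gap / 2.
  rewrite -ler_pdivlMr ?exprn_gt0//; move: h; rewrite -ler_pdivlMr ?exprn_gt0 ?divr_gt0// => h.
  apply: le_trans h _; rewrite le_eqVlt; apply/orP; left; apply/eqP.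
  have rn0 : ratr r ^+ n != 0 :> R by rewrite expf_neq0 ?gt_eqF.
  have sn0 : ((1 - modulus w) / 2) ^+ n != 0 by rewrite expf_neq0 ?gt_eqF// divr_gt0.
  have sn1 : 1 - modulus w != 0 by rewrite gt_eqF.
  rewrite /K; move: (ratr r ^+ n) (((1 - modulus w) / 2) ^+ n) (1 - modulus w) rn0 sn0 sn1.
  by move=> *; field; apply/and3P.
have h2 := lerB_modulus (tcoef f w n) (tcoef f w n - tcoef g w n).
rewrite opprB subrKC in h2.
have h3 := ler_wpM2r (exprn_ge0 n (ltW r0)) h2; rewrite mulrBl in h3.
apply: lt_le_trans h3; rewrite ltrBrDr.
apply: le_lt_trans (lerD (lexx M%:R) h1) _.
rewrite -[ltRHS](subrKC M%:R) ltrD2l -/gap.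
by rewrite ltr_pdivrMr// ltr_pMr// ltr1n.
Qed.
End rational_discs.

(** * A totally unbounded lacunary series *)

Section roots_of_unity.
Context {R : realType}.
Local Notation C := (Cplx R).
Implicit Types (x y t : R) (z w : C).

Lemma cisD x y : cis (x + y) = cis x * cis y.
Proof.
apply/eqP; rewrite eq_complex /= cosD sinD eqxx /=; apply/eqP; ring.
Qed.

Lemma cisMn x n : cis (n%:R * x) = cis x ^+ n.
Proof.
elim: n => [|n IH]; first by rewrite mul0r cis0.
by rewrite -natr1 mulrDl mul1r cisD IH exprSr.
Qed.

Lemma cis_surj z : modulus z = 1 -> exists2 t, 0 <= t & z = cis t.
Proof.
case: z => x y /= h.
have xy : x ^+ 2 + y ^+ 2 = 1.
  by rewrite -[LHS]sqr_sqrtr ?addr_ge0 ?sqr_ge0// h expr1n.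
have x1 : -1 <= x <= 1.
  by rewrite -ler_norml -(@ler_pXn2r _ 2) ?nnegrE// real_normK ?num_real// expr1n -xy lerDl
    sqr_ge0.
have y2 : Num.sqrt (1 - x ^+ 2) = `|y| by rewrite -xy addrAC subrr add0r sqrtr_sqr.
have [a0 api] : 0 <= acos x /\ acos x <= pi by rewrite acos_ge0 ?acos_lepi.
have cx : cos (acos x) = x by rewrite acosK// in_itv.
have [y0|y0] := leP 0 y.
  by exists (acos x) => //; rewrite /cis cx sin_acos// y2 ger0_norm.
exists (pi *+ 2 - acos x); first by rewrite mulr2n; lra.
by rewrite /cis cosB sinB cos2pi sin2pi cx sin_acos// y2 ltr0_norm// mul1r !mul0r addr0
  sub0r mulrN opprK mul1r.
Qed.

Lemma dist_cis x y : modulus (cis x - cis y) <= `|x - y|.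
Proof.
rewrite -[leRHS]mul1r; apply: (pdiff_mvt_abs (@pdiff_cis R)) => t _.
by rewrite modulusM modulus_iu modulus_cis mulr1.
Qed.

Lemma exists_exp2_gt x : exists m : nat, x < 2 ^+ m.
Proof.
exists (Num.truncn x).+1; apply: lt_trans (truncnS_gt _) _.
by set n := (Num.truncn x).+1; rewrite -natrX ltr_nat ltn_expl.
Qed.

(** Round the argument of [z] down to a multiple of [2 * pi / 2 ^+ m], with [m] so large that this
    step is below [e]. *)
Lemma dyadic_root_dense z e : modulus z = 1 -> 0 < e -> exists m w,
  [/\ modulus w = 1, w ^+ (2 ^ m) = 1 & modulus (w - z) < e].
Proof.
move=> z1 e0; have [t t0 ->] := cis_surj z1.
have [m hm] := exists_exp2_gt (2 * pi / e).
have pi2 : 0 < 2 * pi :> R by rewrite mulr_gt0 ?pi_gt0.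
have m0 : 0 < 2 ^+ m :> R by rewrite exprn_gt0.
pose s : R := 2 * pi / 2 ^+ m.
have s0 : 0 < s by rewrite divr_gt0.
pose a := Num.truncn (t / s).
have /andP[h1 h2] : a%:R <= t / s < a.+1%:R by rewrite truncn_itv// divr_ge0// ltW.
exists m, (cis (a%:R * s)); split; first exact: modulus_cis.
  rewrite -cisMn natrX mulrCA /s [2 ^+ m * _]mulrC divfK ?gt_eqF//.
  by rewrite cisMn cis2pi expr1n.
apply: le_lt_trans (dist_cis _ _) _.
rewrite ler_pdivlMr// in h1; rewrite ltr_pdivrMr// -natr1 mulrDl mul1r in h2.
have se : s < e by rewrite /s ltr_pdivrMr// [ltRHS]mulrC -ltr_pdivrMr.
rewrite ler0_norm; lra.
Qed.
End roots_of_unity.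

(** * The coefficients, and growth along dyadic radii *)

Section lacunary.
Context {R : realType}.
Local Notation C := (Cplx R).
Implicit Types (x y t : R) (z w : C).

Lemma sum_powers_of_two (phi : nat -> R) K :
  (forall n, (n != 2 ^ trunc_log 2 n)%N -> phi n = 0) ->
  \sum_(0 <= n < 2 ^ K) phi n = \sum_(0 <= k < K) phi (2 ^ k)%N.
Proof.
move=> h; elim: K => [|K IH]; first by rewrite expn0 big_nat1 big_geq// h.
rewrite (@big_cat_nat _ _ _ (2 ^ K)%N)//=; last by rewrite leq_exp2l.
rewrite IH big_nat_recr//=; congr (_ + _).
rewrite big_ltn ?ltn_exp2l// big1_seq ?addr0// => n /andP[_].
rewrite mem_index_iota => /andP[h1 h2]; apply: h.
by rewrite (@trunc_log_eq 2 K n)// ?(ltnW h1)// gtn_eqF.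
Qed.

(** There are [2 ^ j] indices with logarithm [j]; the extra [phi 0] is the index [k = 0], for which
    [trunc_log] takes the value 0. *)
Lemma sum_trunc_log (phi : nat -> R) J :
  \sum_(0 <= k < 2 ^ J) phi (trunc_log 2 k) = phi 0%N + \sum_(0 <= j < J) (2 ^+ j) * phi j.
Proof.
elim: J => [|J IH]; first by rewrite expn0 big_nat1 big_geq ?addr0.
rewrite (@big_cat_nat _ _ _ (2 ^ J)%N)//=; last by rewrite leq_exp2l.
rewrite IH -addrA [in RHS]big_nat_recr//=; congr (_ + (_ + _)).
rewrite (eq_big_nat _ _ (F2 := fun=> phi J)); last by move=> k hk; rewrite (@trunc_log_eq 2
  J k).
by rewrite sumr_const_nat expnS mul2n -addnn addnK -[LHS]mulr_natl natrX.
Qed.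

(* The exponents [2 ^ k] with [2 ^ j <= k < 2 ^ (j + 1)] share the coefficient [2 ^- j]; each
   of these blocks contributes 1 to the sum and [2 ^ (j * (1 - p))] to the sum of the p-th powers. *)
Definition lac n : R := let k := trunc_log 2 n in
  if (n == 2 ^ k)%N then (2 ^+ trunc_log 2 k)^-1 else 0.

Lemma lac_ge0 n : 0 <= lac n.
Proof. by rewrite /lac; case: ifP => // _; rewrite invr_ge0 exprn_ge0. Qed.

Lemma lac_le1 n : lac n <= 1.
Proof.
rewrite /lac; case: ifP => // _.
by rewrite invf_le1 ?exprn_gt0// exprn_ege1// ler1n.
Qed.

Lemma lac_pow k : lac (2 ^ k)%N = (2 ^+ trunc_log 2 k)^-1.
Proof. by rewrite /lac trunc_expnK// eqxx. Qed.

Lemma lac_unbounded x : exists N, x < \sum_(0 <= n < N) lac n.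
Proof.
(* Indices below [2 ^ (2 ^ J)] are the exponents [k < 2 ^ J], that is, [J] complete blocks of sum
   1. *)
pose J := (Num.truncn x).+1; exists (2 ^ (2 ^ J))%N.
rewrite sum_powers_of_two; last by move=> n /negbTE h; rewrite /lac h.
under eq_bigr do rewrite lac_pow.
rewrite (sum_trunc_log (fun j => (2 ^+ j)^-1)).
under eq_bigr do rewrite divff ?expf_neq0//.
by rewrite sumr_const_nat subn0 expr0 invr1 ltr_wpDl// /J truncnS_gt.
Qed.

Lemma lac_summable p : 1 < p -> exists B, forall N, \sum_(0 <= n < N) (lac n) `^ p <= B.
Proof.
move=> p1; have p0 : 0 < p by lra.
(* The ratio between the sums of p-th powers over consecutive blocks; it equals [2^-1] to the power
   [p - 1], which is below 1 because [1 < p]. *)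
pose rho : R := 2 * (2^-1 `^ p).
have rhoE : rho = 2^-1 `^ (p - 1).
  by rewrite /rho -mulr_powRB1// ?invr_ge0// mulrA divff// mul1r.
have rho1 : 0 <= rho < 1.
  rewrite rhoE powR_ge0/=; have E1 : 1 `^ (p - 1) = 1 :> R by rewrite powR1.
  rewrite -[ltRHS]E1.
  apply: gt0_ltr_powR; rewrite ?nnegrE ?invr_ge0// ?subr_gt0//.
  by rewrite invf_lt1// ltr1n.
have E j : (2 ^+ j)^-1 `^ p = (2^-1 `^ p) ^+ j :> R.
  rewrite -exprVn -powR_mulrn ?invr_ge0// -powRrM mulrC powRrM powR_mulrn// powR_ge0.
exists (1 + (1 - rho)^-1) => N.
have NN : (N <= 2 ^ (2 ^ N))%N.
  by apply: leq_trans (ltnW (@ltn_expl 2 N isT)) (ltnW (@ltn_expl 2 (2 ^ N) isT)).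
apply: (@le_trans _ _ (\sum_(0 <= n < 2 ^ (2 ^ N)) (lac n) `^ p)).
  rewrite (@big_cat_nat _ _ _ N 0 (2 ^ (2 ^ N)))//= lerDl.
  by apply: sumr_ge0 => n _; exact: powR_ge0.
rewrite (@sum_powers_of_two (fun n => lac n `^ p)); last first.
  by move=> n /negbTE h; rewrite /lac h powR0// gt_eqF.
under eq_bigr do rewrite lac_pow.
rewrite (sum_trunc_log (fun j => (2 ^+ j)^-1 `^ p)) expr0 invr1 powR1 lerD2l.
under eq_bigr do rewrite E -exprMn.
exact: geometric_sum_le.
Qed.

Lemma lac_cvg0 : lac @ \oo --> (0 : R).
Proof.
apply/cvgrPdist_lt => e e0; have [j hj] := exists_exp2_gt e^-1.
exists (2 ^ (2 ^ j))%N => // n /= hn; rewrite sub0r normrN ger0_norm ?lac_ge0//.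
rewrite /lac; case: ifP => // _.
rewrite -[ltRHS]invrK ltf_pV2 ?posrE ?invr_gt0 ?exprn_gt0//; apply: lt_le_trans hj _.
rewrite ler_eXn2l ?ltr1n//.
have := @leq_trunc_log 2 _ _ (@leq_trunc_log 2 _ _ hn).
by rewrite !trunc_expnK.
Qed.

Lemma exists_holomorphic_coef (b : nat -> C) M : (forall n, modulus (b n) <= M) ->
  exists2 g, holomorphic_disc g & coef g = b.
Proof.
move=> hb.
have [|G hG] := @pseries_cdiff R b M 1 ltr01; first by move=> n; rewrite expr1n mulr1.
pose g z := if modulus z < 1 then G z else 0.
have gG z : modulus z < 1 -> g z = G z by rewrite /g => ->.
exists g; first split.
- move=> z; rewrite unit_discE => z1; have [_ [d hd]] := hG _ z1.
  apply/derivable_cdiff; exists d; apply: (@cdiff_near _ G g z d (1 - modulus z)) => //.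
    by rewrite subr_gt0.
  move=> w wz; rewrite gG// -[w](subrK z); apply: le_lt_trans (modulusD _ _) _; lra.
- by move=> z; rewrite unit_discE /g => /negP/negbTE ->.
apply: coefE => z z1; rewrite add0r gG//.
by case: (hG _ z1).
Qed.

Lemma Re_sum n (u : nat -> C) : complex.Re (series u n) = \sum_(0 <= k < n) complex.Re (u k).
Proof.
by elim: n => [|n IH]; [rewrite seriesC0 big_geq|rewrite seriesCS ReD IH big_nat_recr].
Qed.

Lemma lacunary_totally_unbounded (g : C -> C) : holomorphic_disc g ->
  coef g = (fun n => (lac n)%:C%C) -> totally_unbounded g.
Proof.
move=> [hg _] cg; apply/totally_unboundedP => zeta e z1 e0 [M hM].
have [m [eta [eta1 eta_m eta_z]]] := dyadic_root_dense z1 (divr_gt0 e0 (ltr0Sn _ 1)).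
(* The terms of index below [2 ^ m] may point in any direction; each costs at most 2, hence at most
   [D] in all. The factor 2 in the choice of [N] makes up for [t ^+ k >= 1 / 2]. *)
pose D : R := 2 * (2 ^ m)%:R.
have D0 : 0 <= D by rewrite mulr_ge0.
have [N hN] := lac_unbounded (2 * (`|M| + 1 + D)).
(* The distance to the circle, chosen after [N]: by Bernoulli's inequality
   [t ^+ k >= 1 - k%:R * tau >= 1 / 2] for all [k < N], and the point stays within [e] of [zeta]. *)
pose tau : R := Num.min (1 / 2) (Num.min (e / 2) (1 / (2 * (N%:R + 1)))).
have N0 : (0 : R) <= N%:R by [].
have tau0 : 0 < tau by rewrite !lt_min !divr_gt0// mulr_gt0// ltr_wpDl.
have tau1 : tau <= 1 / 2 by rewrite ge_min lexx.
have tau2 : tau <= e / 2 by rewrite !ge_min lexx orbT.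
have tau3 : N%:R * tau <= 1 / 2.
  have : tau <= 1 / (2 * (N%:R + 1)) by rewrite !ge_min lexx !orbT.
  by rewrite ler_pdivlMr ?mulr_gt0 ?ltr_wpDl//; nra.
pose t := 1 - tau.
have t0 : 0 < t by rewrite /t; lra.
have t1 : t < 1 by rewrite /t; lra.
have bern n : 1 - n%:R * tau <= t ^+ n.
  elim: n => [|n IH]; first by rewrite mul0r subr0.
  rewrite exprS -natr1; have := ler_wpM2l (ltW t0) IH; rewrite /t.
  by have := ler0n R n; nra.
pose z : C := t%:C%C * eta.
have zm : modulus z = t by rewrite modulusM modulus_real eta1 mulr1 gtr0_norm.
have zz : disc zeta e z.
  rewrite /disc /= (_ : z - zeta = - tau%:C%C * eta + (eta - zeta)); last first.
    by rewrite /z /t rmorphB rmorph1; ring.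
  apply: le_lt_trans (modulusD _ _) _; rewrite modulusM modulusN modulus_real eta1
    gtr0_norm//; lra.
have Dz : unit_disc z by rewrite unit_discE zm.
pose u n : C := coef g n * z ^+ n.
have hu : series u @ \oo --> g z.
  by have := has_taylor_coef hg; move=> /(_ z); rewrite zm add0r; exact.
have modu n : modulus (u n) <= lac n * t ^+ n.
  by rewrite /u cg modulusM modulusX zm modulus_real ger0_norm ?lac_ge0.
(* A nonzero coefficient of index at least [2 ^ m] belongs to a power [2 ^ k] with [m <= k], where
   [eta ^+ n = 1] and the term is a nonnegative real. *)
have term n : lac n * t ^+ n - (if (n < 2 ^ m)%N then 2 else 0) <= complex.Re (u n).
  have lt1 : lac n * t ^+ n <= 1.
    by rewrite mulr_ile1 ?lac_ge0 ?lac_le1 ?exprn_ge0 ?exprn_ile1 ?(ltW t0) ?(ltW t1).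
  case: ifP => hn.
    have := Re_modulus (u n); have := modu n; rewrite ler_norml; lra.
  rewrite subr0 /u cg /lac; case: ifP => [/eqP nE|_]; last by rewrite !mul0r.
  have mk : (m <= trunc_log 2 n)%N.
    by rewrite leqNgt; apply/negP => h; move: hn; rewrite nE ltn_exp2l// h.
  have en : eta ^+ n = 1.
    by rewrite nE -(subnKC mk) expnD exprM eta_m expr1n.
  have zn : z ^+ n = (t ^+ n)%:C%C by rewrite /z exprMn en mulr1 rmorphXn.
  by rewrite zn Re_real_mul.
have L n : (N <= n)%N -> `|M| + 1 < complex.Re (series u n).
  move=> Nn; rewrite Re_sum.
  have h1 : \sum_(0 <= k < n) (lac k * t ^+ k - (if (k < 2 ^ m)%N then 2 else 0)) <=
      \sum_(0 <= k < n) complex.Re (u k) by apply: ler_sum => k _.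
  apply: lt_le_trans h1; rewrite sumrB.
  have h2 : \sum_(0 <= k < n) (if (k < 2 ^ m)%N then 2 else 0) <= D.
    rewrite (_ : \sum_(0 <= k < n) _ = 2 * (minn n (2 ^ m))%:R); last first.
      elim: n {Nn} => [|n IH]; first by rewrite big_geq// min0n mulr0.
      rewrite big_nat_recr//= IH; case: ifP => [hn|/negbT]; last rewrite -leqNgt => hn.
        by rewrite (minn_idPl (ltnW hn)) (minn_idPl hn) -[n.+1%:R]natr1 mulrDr mulr1.
      by rewrite addr0 (minn_idPr hn) (minn_idPr (leqW hn)).
    by rewrite /D ler_wpM2l// ler_nat geq_minr.
  have h3 : \sum_(0 <= k < N) lac k * (1 / 2) <= \sum_(0 <= k < n) lac k * t ^+ k.
    rewrite (@big_cat_nat _ _ _ N 0 n)//= -[leLHS]addr0 lerD//.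
      rewrite big_nat [leRHS]big_nat; apply: ler_sum => k /andP[_ kN].
      rewrite ler_wpM2l ?lac_ge0//; apply: le_trans (bern k).
      have : k%:R <= N%:R :> R by rewrite ler_nat ltnW.
      nra.
    by apply: sumr_ge0 => k _; rewrite mulr_ge0 ?lac_ge0 ?exprn_ge0// ltW.
  rewrite -mulr_suml in h3; lra.
have /cvg_modulus/cvgrPdist_lt/(_ _ ltr01)[n0 _ hn0] := hu.
pose n := maxn n0 N.
have := hn0 n (leq_maxl _ _); rewrite sub0r normrN ger0_norm ?modulus_ge0// => h1.
have h2 := L n (leq_maxr _ _).
have h3 := le_trans (ler_norm _) (Re_modulus (series u n)).
have h4 := lerB_modulus (series u n) (g z).
by have := hM z (conj zz Dz); have := ler_norm M; lra.
Qed.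
End lacunary.

(** * Density *)

Section density.
Context {R : realType}.
Local Notation C := (Cplx R).
Implicit Types (f g : C -> C).

Definition perturb f g (delta : R) : C -> C := fun z => f z + delta%:C%C * g z.

Lemma itv_not_countable (eta : R) : 0 < eta -> ~ countable (`]0, eta[%classic : set R).
Proof.
move=> eta0 /countable_lebesgue_measure0; rewrite lebesgue_measure_itv /= lte_fin eta0 => /eqP.
by rewrite sube0 eqe gt_eqF.
Qed.

(* Two values of [delta] for which [f + delta g] is bounded on the same disc would make [g] bounded
   on it, so every disc excludes at most one [delta]. *)
Lemma perturb_totally_unbounded f g (eta : R) : 0 < eta -> totally_unbounded g ->
  exists2 delta, 0 < delta < eta & totally_unbounded (perturb f g delta).
Proof.
move=> eta0 tg; apply: contrapT => no; apply: (itv_not_countable eta0).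
pose B (q : code) := [set delta : R |
   (exists2 zeta : C, unit_circle zeta & disc (rat_pt q.1.1) (ratr q.1.2) zeta) /\
   forall z, disc (rat_pt q.1.1) (ratr q.1.2) z -> unit_disc z ->
     modulus (perturb f g delta z) <= q.2%:R].
(* If no [delta] works, each one fails for some rational disc and some natural bound, so countably
   many sets [B q] cover the interval. *)
have sub : `]0, eta[%classic `<=` \bigcup_(q in [set: code]) B q.
  move=> delta /=; rewrite in_itv /= => hdelta.
  have ntu : ~ totally_unbounded (perturb f g delta) by move=> h; apply: no; exists delta.
  apply: contrapT => nb; apply: ntu; apply/totally_unbounded_code => q hq.
  apply: contrapT => nz; apply: nb; exists q => //; split => // z zq Dz.
  by rewrite leNgt; apply/negP => hz; apply: nz; exists z.
apply: (sub_countable (subset_card_le sub)).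
apply: bigcup_countable; first exact: countableP.
move=> q _.
suff single delta delta' : B q delta -> B q delta' -> delta = delta'.
  have [->|/set0P[delta Bd]] := eqVneq (B q) set0; first exact: countable0.
  apply: (@sub_countable _ _ _ [set delta]); last exact: countable1.
  by apply: subset_card_le => delta' Bd' /=; exact: single.
move=> [[zeta z1 zq] h1] [_ h2]; apply: contrapT => /eqP ne.
have dd : 0 < `|delta - delta'| by rewrite normr_gt0 subr_eq0.
have e0 : 0 < ratr q.1.2 - modulus (zeta - rat_pt q.1.1) :> R by rewrite subr_gt0.
have /totally_unboundedP/(_ _ _ z1 e0) := tg; apply.
exists ((q.2%:R + q.2%:R) / `|delta - delta'|) => z [ze Dz].
have zq' : disc (rat_pt q.1.1) (ratr q.1.2) z by apply: disc_sub ze; rewrite subrKC.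
rewrite ler_pdivlMr// mulrC -modulus_real -modulusM.
have -> : (delta - delta')%:C%C * g z = perturb f g delta z - perturb f g delta' z.
  by rewrite /perturb rmorphB; ring.
by apply: le_trans (modulusD _ _) _; rewrite modulusN lerD// ?h1// h2.
Qed.

Variables (A : set (C -> C)) (d : (C -> C) -> (C -> C) -> R) (g0 : C -> C).
Hypothesis g0_tu : totally_unbounded g0.
Hypothesis pert : forall f (e : R), A f -> 0 < e -> exists2 eta : R, 0 < eta &
  forall delta, 0 < delta < eta -> A (perturb f g0 delta) /\ d f (perturb f g0 delta) < e.

Lemma dense_totally_unbounded :
  dense [set f : metric_sub A d | totally_unbounded (set_val f)].
Proof.
move=> O [f Of]; rewrite metric_openE => /(_ _ Of)[e e0 he].
have [eta eta0 heta] := pert (set_valP f) e0.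
have [delta hd htu] := perturb_totally_unbounded (set_val f) eta0 g0_tu.
have [Ah dh] := heta _ hd.
pose h : metric_sub A d := SigSub (mem_set Ah).
exists h; split; last exact: htu.
exact: he.
Qed.

Lemma dense_nonextendable :
  dense [set f : metric_sub A d | ~ extendable (set_val f)].
Proof.
move=> O O0 oO; have [f [Of tf]] := dense_totally_unbounded O0 oO.
by exists f; split => //; exact: totally_unbounded_nonextendable.
Qed.

End density.

(** * The spaces *)

Section sequence_norms.
Context {R : realType}.
Local Notation C := (Cplx R).
Implicit Types (f g : C -> C) (a b : nat -> C) (p q e : R).

Lemma nneseries_ltyP (u : nat -> R) : (forall n, 0 <= u n) ->
  (\sum_(0 <= n <oo) (u n)%:E < +oo)%E <-> exists B, forall N, \sum_(0 <= n < N) u n <= B.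
Proof.
move=> u0; have u0' n : (0 <= (u n)%:E)%E by rewrite lee_fin.
split => [h|[B hB]].
  have fin : (\sum_(0 <= n <oo) (u n)%:E)%E \is a fin_num.
    by rewrite ge0_fin_numE// nneseries_ge0.
  exists (fine (\sum_(0 <= n <oo) (u n)%:E)%E) => N.
  by rewrite -lee_fin fineK// -sumEFin; apply: nneseries_lim_ge.
apply: (@le_lt_trans _ _ B%:E); last exact: ltry.
apply: lime_le; first exact: is_cvg_nneseries.
by near=> N; rewrite sumEFin lee_fin.
Unshelve. all: by end_near. Qed.

(** [fine] sends an infinite sum to 0, whence the boundedness hypothesis. *)
Lemma sum_le_fine_nneseries (u : nat -> R) N : (forall n, 0 <= u n) ->
  (exists B, forall N, \sum_(0 <= n < N) u n <= B) ->
  \sum_(0 <= n < N) u n <= fine (\sum_(0 <= n <oo) (u n)%:E)%E.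
Proof.
move=> u0 /(nneseries_ltyP u0) h; have u0' n : (0 <= (u n)%:E)%E by rewrite lee_fin.
have fin : (\sum_(0 <= n <oo) (u n)%:E)%E \is a fin_num.
  by rewrite ge0_fin_numE// nneseries_ge0.
by rewrite -lee_fin fineK// -sumEFin; apply: nneseries_lim_ge.
Qed.

Lemma fine_nneseries_le (u : nat -> R) B : (forall n, 0 <= u n) ->
  (forall N, \sum_(0 <= n < N) u n <= B) ->
  fine (\sum_(0 <= n <oo) (u n)%:E)%E <= B.
Proof.
move=> u0 hB; have u0' n : (0 <= (u n)%:E)%E by rewrite lee_fin.
have h : (\sum_(0 <= n <oo) (u n)%:E < +oo)%E by apply/nneseries_ltyP => //; exists B.
have fin : (\sum_(0 <= n <oo) (u n)%:E)%E \is a fin_num.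
  by rewrite ge0_fin_numE// nneseries_ge0.
rewrite -lee_fin fineK//; apply: lime_le; first exact: is_cvg_nneseries.
by near=> N; rewrite sumEFin lee_fin.
Unshelve. all: by end_near. Qed.

(** The sum is at most twice the larger modulus. The constant is crude but sufficient to see that
    sums of p-summable sequences are p-summable. *)
Lemma powR_modulusD (z w : C) p : 0 <= p ->
  modulus (z + w) `^ p <= 2 `^ p * (modulus z `^ p + modulus w `^ p).
Proof.
move=> p0.
have mono (x y : R) : 0 <= x -> x <= y -> x `^ p <= y `^ p.
  by move=> x0 xy; apply: ge0_ler_powR; rewrite ?nnegrE//; exact: le_trans xy.
have m0 := modulus_ge0 z; have m1 := modulus_ge0 w.
wlog zw : z w m0 m1 / modulus z <= modulus w => [h|].
  have [zw|/ltW zw] := leP (modulus z) (modulus w); first exact: h.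
  by rewrite addrC [X in _ * X]addrC; exact: h.
apply: (@le_trans _ _ ((2 * modulus w) `^ p)).
  by apply: mono (modulus_ge0 _) _; apply: le_trans (modulusD _ _) _; lra.
by rewrite powRM// ler_wpM2l ?powR_ge0// lerDr powR_ge0.
Qed.

Lemma summableD a b p : 0 <= p ->
  (exists B, forall N, \sum_(0 <= n < N) modulus (a n) `^ p <= B) ->
  (exists B, forall N, \sum_(0 <= n < N) modulus (b n) `^ p <= B) ->
  exists B, forall N, \sum_(0 <= n < N) modulus (a n + b n) `^ p <= B.
Proof.
move=> p0 [A hA] [B hB]; exists (2 `^ p * (A + B)) => N.
apply: (@le_trans _ _ (\sum_(0 <= n < N) 2 `^ p * (modulus (a n) `^ p + modulus (b n) `^ p))).
  by apply: ler_sum => n _; exact: powR_modulusD.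
by rewrite -mulr_sumr ler_wpM2l ?powR_ge0// big_split /= lerD.
Qed.

Lemma lpaP f p : lpa p%:E f <-> holomorphic_disc f /\
  exists B, forall N, \sum_(0 <= n < N) modulus (coef f n) `^ p <= B.
Proof.
by rewrite /lpa /=; split => -[h /nneseries_ltyP h']; split => //; apply: h' => n; exact:
  powR_ge0.
Qed.

Lemma summableB f g p : 0 <= p -> lpa p%:E f -> lpa p%:E g ->
  exists B, forall N, \sum_(0 <= n < N) modulus (coef f n - coef g n) `^ p <= B.
Proof.
move=> p0 /lpaP[_ hf] /lpaP[_ [B hB]]; apply: summableD => //.
by exists B => N; under eq_bigr do rewrite modulusN.
Qed.

Lemma dist_lpa_ge0 f g p : 1 < p -> 0 <= dist_lpa p%:E f g.
Proof. by move=> p1; rewrite /dist_lpa ltNge (ltW p1)/= powR_ge0. Qed.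

Lemma coef_le_dist_lpa f g p n : 1 < p -> lpa p%:E f -> lpa p%:E g ->
  modulus (coef f n - coef g n) <= dist_lpa p%:E f g.
Proof.
move=> p1 lf lg; have p0 : 0 <= p by lra.
have pn0 : p != 0 by rewrite gt_eqF//; lra.
rewrite /dist_lpa ltNge (ltW p1)/=; set S := fine _.
have h : modulus (coef f n - coef g n) `^ p <= S.
  have := @sum_le_fine_nneseries (fun n => modulus (coef f n - coef g n) `^ p) n.+1
    (fun n => powR_ge0 _ _) (summableB p0 lf lg).
  apply: le_trans; rewrite big_nat_recr//= lerDr.
  by apply: sumr_ge0 => k _; exact: powR_ge0.
have S0 : 0 <= S by apply: le_trans h; exact: powR_ge0.
have -> : modulus (coef f n - coef g n) = (modulus (coef f n - coef g n) `^ p) `^ p^-1.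
  by rewrite -powRrM divff// powRr1// modulus_ge0.
by apply: ge0_ler_powR; rewrite ?nnegrE ?powR_ge0 ?invr_ge0.
Qed.

Variable g0 : C -> C.
Hypothesis g0_holo : holomorphic_disc g0.
Hypothesis g0_coef : coef g0 = (fun n => (lac n)%:C%C).

Lemma perturb_holo f (delta : R) : holomorphic_disc f -> holomorphic_disc (perturb f g0 delta).
Proof.
move=> [hf f0]; have [hg g00] := g0_holo; split => z Dz; last first.
  by rewrite /perturb f0// g00// mulr0 addr0.
apply: derivableD; first exact: hf.
by apply: derivableM; [exact: derivable_cst|exact: hg].
Qed.

Lemma coef_perturb f (delta : R) n : holomorphic_disc f ->
  coef (perturb f g0 delta) n = coef f n + (delta * lac n)%:C%C.
Proof.
move=> hf; have [hf' _] := hf; have [hg _] := g0_holo.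
rewrite (@coefE _ _ (fun n => coef f n + (delta * lac n)%:C%C))// => z z1.
have := cvgC_lin (k := - delta%:C%C) (has_taylor_coef hf' z1) (cvg_cst (0 : C))
  (has_taylor_coef hg z1).
rewrite subr0 mulrN opprK add0r g0_coef [g0 z * _]mulrC.
suff -> : series (fun n => (coef f n + (delta * lac n)%:C%C) * z ^+ n) = fun n =>
  series (fun n => coef f n * z ^+ n) n - 0 - series (fun n => (lac n)%:C%C * z ^+ n) n * -
    delta%:C%C by exact.
apply/funext; elim=> [|k IH]; first by rewrite !seriesC0 mul0r !subrr.
by rewrite !seriesCS IH rmorphM; ring.
Qed.

Lemma modulus_coef_perturb f (delta : R) n : holomorphic_disc f -> 0 <= delta ->
  modulus (coef f n - coef (perturb f g0 delta) n) = delta * lac n.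
Proof.
move=> hf d0; rewrite coef_perturb// opprD addrA subrr sub0r modulusN modulus_real.
by rewrite ger0_norm// mulr_ge0// lac_ge0.
Qed.

(** [K] bounds the l^p norm of the coefficients of [g0]; it depends on [p] but not on [f]. *)
Lemma perturb_lpa p : 1 < p -> exists2 K, 0 <= K & forall f (delta : R), lpa p%:E f -> 0 <=
  delta ->
  lpa p%:E (perturb f g0 delta) /\ dist_lpa p%:E f (perturb f g0 delta) <= delta * K.
Proof.
move=> p1; have p0 : 0 <= p by lra.
have pn0 : p != 0 by rewrite gt_eqF//; lra.
have [B hB] := @lac_summable R _ p1.
have B0 : 0 <= B by have := hB 0%N; rewrite big_geq.
exists (B `^ p^-1); first exact: powR_ge0.
move=> f delta lf d0; have /lpaP[hf sf] := lf.
have sd N : \sum_(0 <= n < N) (delta * lac n) `^ p <= delta `^ p * B.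
  under eq_bigr do rewrite powRM ?lac_ge0//.
  by rewrite -mulr_sumr ler_wpM2l ?powR_ge0.
split.
  apply/lpaP; split; first exact: perturb_holo.
  have [|B' hB'] := @summableD (coef f) (fun n => (delta * lac n)%:C%C) p p0 sf.
    exists (delta `^ p * B) => N.
    by under eq_bigr do rewrite modulus_real ger0_norm ?mulr_ge0 ?lac_ge0//.
  by exists B' => N; under eq_bigr do rewrite coef_perturb//.
rewrite /dist_lpa ltNge (ltW p1)/=.
have -> : delta * B `^ p^-1 = (delta `^ p * B) `^ p^-1.
  by rewrite powRM ?powR_ge0// -powRrM divff// powRr1.
apply: ge0_ler_powR; rewrite ?nnegrE ?invr_ge0 ?mulr_ge0 ?powR_ge0//.
  by rewrite fine_ge0// nneseries_ge0// => n _ _; rewrite lee_fin powR_ge0.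
apply: fine_nneseries_le => [n|N]; first exact: powR_ge0.
under eq_bigr do rewrite modulus_coef_perturb//.
exact: sd.
Qed.

End sequence_norms.

(** * Bounded coefficients and coefficients tending to 0 *)

Section sup_norm.
Context {R : realType}.
Local Notation C := (Cplx R).
Implicit Types (f g : C -> C) (p q e : R).

Lemma lpa_pinftyP f : lpa +oo%E f <-> holomorphic_disc f /\
  exists M : R, forall n, modulus (coef f n) <= M.
Proof.
rewrite /lpa /=; split => -[hf h]; split => //; last first.
  have [M hM] := h; apply: (@le_lt_trans _ _ M%:E); last exact: ltry.
  by apply: ge_ereal_sup => _ [n _ <-]; rewrite lee_fin.
have ub n : ((modulus (coef f n))%:E <= ereal_sup (range (fun n => (modulus (coef f
  n))%:E)))%E.
  by apply: ereal_sup_ubound; exists n.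
have fin : ereal_sup (range (fun n => (modulus (coef f n))%:E)) \is a fin_num.
  rewrite ge0_fin_numE//; apply: le_trans (ub 0%N); rewrite lee_fin; exact: modulus_ge0.
by exists (fine (ereal_sup (range (fun n => (modulus (coef f n))%:E)))) => n; rewrite
  -lee_fin fineK.
Qed.

Lemma c0a_lpa f : c0a f -> lpa +oo%E f.
Proof.
move=> [hf /cvg_modulus cf]; apply/lpa_pinftyP; split => //.
have [M [_ hM]] := cvg_seq_bounded (cvgP _ cf).
have M1 : M < M + 1 by rewrite ltrDl.
exists (M + 1) => n; have : `|modulus (coef f n - 0)| <= M + 1 := hM _ M1 n I.
by rewrite subr0 ger0_norm ?modulus_ge0.
Qed.

Lemma coef_le_dist_lpa_pinfty f g n : lpa +oo%E f -> lpa +oo%E g ->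
  modulus (coef f n - coef g n) <= dist_lpa +oo%E f g.
Proof.
move=> /lpa_pinftyP[_ [M hM]] /lpa_pinftyP[_ [N hN]]; rewrite /dist_lpa.
apply: ub_le_sup; last by exists n.
exists (M + N) => _ [k _ <-]; apply: le_trans (modulusD _ _) _.
by rewrite modulusN lerD.
Qed.

Variable g0 : C -> C.
Hypothesis g0_holo : holomorphic_disc g0.
Hypothesis g0_coef : coef g0 = (fun n => (lac n)%:C%C).

Lemma perturb_lpa_pinfty f (delta : R) : lpa +oo%E f -> 0 <= delta ->
  lpa +oo%E (perturb f g0 delta) /\ dist_lpa +oo%E f (perturb f g0 delta) <= delta.
Proof.
move=> /lpa_pinftyP[hf [M hM]] d0; split.
  apply/lpa_pinftyP; split; first exact: perturb_holo.
  exists (M + delta) => n; rewrite coef_perturb//; apply: le_trans (modulusD _ _) _.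
  by rewrite lerD// modulus_real ger0_norm ?mulr_ge0 ?lac_ge0// ler_piMr// lac_le1.
rewrite /dist_lpa; apply: ge_sup; first by eexists; exists 0%N.
by move=> _ [n _ <-]; rewrite modulus_coef_perturb// ler_piMr// lac_le1.
Qed.

Lemma perturb_c0a f (delta : R) : c0a f -> 0 <= delta -> c0a (perturb f g0 delta).
Proof.
move=> [hf /cvg_modulus cf] d0; split; first exact: perturb_holo.
apply/cvg_modulus.
apply: (@squeeze_cvgr _ _ _ _ (cst 0) (fun n => modulus (coef f n - 0) + delta * lac n)).
- near=> n; apply/andP; split; first exact: modulus_ge0.
  rewrite coef_perturb// !subr0; apply: le_trans (modulusD _ _) _.
  by rewrite modulus_real ger0_norm ?mulr_ge0 ?lac_ge0.
- exact: cvg_cst.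
- have := cvgD cf (cvgM (cvg_cst delta) (@lac_cvg0 R)).
  by rewrite mulr0 addr0; exact.
Unshelve. all: by end_near. Qed.

End sup_norm.

(** * The intersection spaces *)

Section Xq_space.
Context {R : realType}.
Local Notation C := (Cplx R).
Implicit Types (f g : C -> C) (q e : R).

Variables (q : R) (pn : nat -> R).
Hypothesis q1 : 1 <= q.
Hypothesis qpn : forall n, q < pn n.

Lemma Xq_lpa f p : Xq q f -> q < p -> lpa p%:E f.
Proof. by move=> h; exact: h. Qed.

Let pn1 n : 1 < pn n. Proof. exact: le_lt_trans (qpn n). Qed.

Definition Xq_term f g n : R := (2 ^+ n)^-1 *
  (dist_lpa (pn n)%:E f g / (1 + dist_lpa (pn n)%:E f g)).

Lemma Xq_term_ge0 f g n : 0 <= Xq_term f g n.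
Proof.
have := dist_lpa_ge0 f g (pn1 n) => h.
by rewrite mulr_ge0 ?invr_ge0 ?exprn_ge0// divr_ge0// addr_ge0.
Qed.

Lemma Xq_term_le f g n : Xq_term f g n <= (2 ^+ n)^-1.
Proof.
have := dist_lpa_ge0 f g (pn1 n) => h.
rewrite ler_piMr ?invr_ge0 ?exprn_ge0// ler_pdivrMr ?ltr_pwDl// mul1r; lra.
Qed.

(** The terms are at most [(2 ^+ n)^-1]; the bound is the exact value of the finite geometric sum,
    which lets the induction close. *)
Lemma Xq_series_tail f g N j :
  series (Xq_term f g) (N + j)%N <= series (Xq_term f g) N + (2 ^+ N)^-1 * (2 * (1 - (2 ^+
    j)^-1)).
Proof.
elim: j => [|j IH]; first by rewrite addn0 expr0 invr1 subrr !mulr0 addr0.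
rewrite addnS seriesSr; apply: le_trans (lerD IH (Xq_term_le f g (N + j))) _.
rewrite exprD invfM exprS invfM.
set x := (2 ^+ N)^-1; set y := (2 ^+ j)^-1.
by rewrite -addrA lerD2l -mulrDr le_eqVlt; apply/orP; left; apply/eqP; congr (_ * _); field.
Qed.

Lemma Xq_series_cvg f g : cvgn (series (Xq_term f g)).
Proof.
apply: nondecreasing_is_cvgn.
  by apply/nondecreasing_seqP => n; rewrite seriesSr lerDl Xq_term_ge0.
exists 2 => _ [n _ <-].
have E0 : series (Xq_term f g) 0%N = 0 by rewrite /series /= big_geq.
have := Xq_series_tail f g 0 n; rewrite add0n E0 add0r expr0 invr1 mul1r.
have : 0 <= (2 ^+ n)^-1 :> R by rewrite invr_ge0 exprn_ge0.
lra.
Qed.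

Lemma dist_Xq_le f g N B : series (Xq_term f g) N <= B ->
  dist_Xq pn f g <= B + 2 * (2 ^+ N)^-1.
Proof.
move=> hB; apply: limr_le; first exact: Xq_series_cvg.
exists N => // m /= Nm; rewrite -(subnKC Nm); apply: le_trans (Xq_series_tail f g N (m - N)) _.
rewrite lerD// mulrC ler_wpM2r ?invr_ge0 ?exprn_ge0//.
have : 0 <= (2 ^+ (m - N))^-1 :> R by rewrite invr_ge0 exprn_ge0.
lra.
Qed.

Lemma Xq_close_coef f e : Xq q f -> 0 < e -> exists2 eta : R, 0 < eta &
  forall g, Xq q g -> dist_Xq pn f g < eta -> forall n, modulus (coef f n - coef g n) <= e.
Proof.
(* The term of index 0 has weight 1, and [d / (1 + d) < e / (1 + e)] means [d < e]. *)
move=> Xf e0; exists (e / (1 + e)); first by rewrite divr_gt0// ltr_pwDl// ltW.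
move=> g Xg; set D := dist_Xq _ _ _ => hD n.
apply: le_trans (coef_le_dist_lpa n (pn1 0) (Xq_lpa Xf (qpn 0)) (Xq_lpa Xg (qpn 0))) _.
have h0 := dist_lpa_ge0 f g (pn1 0).
set d := dist_lpa _ _ _ in h0 *.
have : d / (1 + d) <= D.
  have nd : nondecreasing_seq (series (Xq_term f g)).
    by apply/nondecreasing_seqP => k; rewrite seriesSr lerDl Xq_term_ge0.
  have := nondecreasing_cvgn_le nd (@Xq_series_cvg f g) 1%N; apply: le_trans.
  by rewrite /series /= big_nat1 /Xq_term expr0 invr1 mul1r.
move=> /le_lt_trans/(_ hD); rewrite ltr_pdivrMr ?ltr_pwDl// mulrAC ltr_pdivlMr ?ltr_pwDl
  ?(ltW e0)//.
nra.
Qed.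

Variable g0 : C -> C.
Hypothesis g0_holo : holomorphic_disc g0.
Hypothesis g0_coef : coef g0 = (fun n => (lac n)%:C%C).

(** The constants [K n] have no common bound, so the series is cut at an [N] whose tail is below
    [e / 2] for every [delta]; then [delta] is made small against the sum of the first [N]
    constants. *)
Lemma Xq_perturb f e : Xq q f -> 0 < e -> exists2 eta : R, 0 < eta &
  forall delta, 0 < delta < eta -> Xq q (perturb f g0 delta) /\ dist_Xq pn f (perturb f g0
    delta) < e.
Proof.
move=> Xf e0.
have /choice[K hK] : forall n, exists K : R, 0 <= K /\ forall f (delta : R), lpa (pn n)%:E f
  -> 0 <= delta ->
  lpa (pn n)%:E (perturb f g0 delta) /\ dist_lpa (pn n)%:E f (perturb f g0 delta) <= delta * K.
  by move=> n; have [K K0 h] := perturb_lpa g0_holo g0_coef (pn1 n); exists K.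
have [N hN] := exists_exp2_gt (4 / e).
have N0 : 0 < 2 ^+ N :> R by rewrite exprn_gt0.
have h2N : 2 * (2 ^+ N)^-1 < e / 2.
  by rewrite ltr_pdivrMr//; move: hN; rewrite ltr_pdivrMr//; lra.
pose S := \sum_(0 <= n < N) K n.
have S0 : 0 <= S by apply: sumr_ge0 => n _; case: (hK n).
exists (e / 2 / (S + 1)); first by rewrite !divr_gt0// ltr_wpDl.
move=> delta /andP[d0 hd0].
have hd : delta * (S + 1) < e / 2 by rewrite -ltr_pdivlMr// ltr_wpDl.
split.
  move=> p /= qp; have p1 : 1 < p by exact: le_lt_trans qp.
  have [K' _ h] := perturb_lpa g0_holo g0_coef p1.
  by have [] := h f delta (Xq_lpa Xf qp) (ltW d0).
apply: (@le_lt_trans _ _ (delta * S + 2 * (2 ^+ N)^-1)); last by nra.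
apply: dist_Xq_le; rewrite /S mulr_sumr /series /=; apply: ler_sum => n _.
have [_ h] := hK n; have [_ {}h] := h f delta (Xq_lpa Xf (qpn n)) (ltW d0).
have D0 := dist_lpa_ge0 f (perturb f g0 delta) (pn1 n).
apply: le_trans h; rewrite /Xq_term; set D := dist_lpa _ _ _ in D0 *.
apply: (@le_trans _ _ (D / (1 + D))).
  rewrite ler_piMl ?divr_ge0 ?addr_ge0// invf_le1 ?exprn_gt0//.
  by rewrite exprn_ege1// ler1n.
by rewrite ler_pdivrMr ?ltr_pwDl// ler_peMr// lerDl.
Qed.

End Xq_space.

(** * Assembly *)

Section main.
Context {R : realType}.
Local Notation C := (Cplx R).

(** The first two hypotheses give the G_delta property, the last two give density; [eta] may depend
    on [f] throughout, as openness and density are local. *)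
Lemma generic_functions (A : set (C -> C)) (d : (C -> C) -> (C -> C) -> R) (g0 : C -> C) :
  (forall f, A f -> holomorphic_disc f) ->
  (forall f (e : R), A f -> 0 < e -> exists2 eta : R, 0 < eta &
    forall g, A g -> d f g < eta -> forall n, modulus (coef f n - coef g n) <= e) ->
  totally_unbounded g0 ->
  (forall f (e : R), A f -> 0 < e -> exists2 eta : R, 0 < eta &
    forall delta, 0 < delta < eta -> A (perturb f g0 delta) /\ d f (perturb f g0 delta) < e) ->
  let X := metric_sub A d in
  (Gdelta [set f : X | totally_unbounded (set_val f)] /\
   dense [set f : X | totally_unbounded (set_val f)]) /\
  (Gdelta [set f : X | ~ extendable (set_val f)] /\
   dense [set f : X | ~ extendable (set_val f)]).
Proof.
move=> hA hd tg hp X.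
have hA' f : A f -> holomorphic_on unit_disc f by move=> /hA[].
split; split.
- exact: Gdelta_totally_unbounded.
- exact: (dense_totally_unbounded tg hp).
- exact: Gdelta_nonextendable.
- exact: (dense_nonextendable tg hp).
Qed.

Lemma exists_lacunary : exists g0 : C -> C,
  [/\ holomorphic_disc g0, coef g0 = (fun n => (lac n)%:C%C) & totally_unbounded g0].
Proof.
have [|g0 hg cg] := @exists_holomorphic_coef R (fun n => (lac n)%:C%C) 1.
  by move=> n; rewrite modulus_real ger0_norm ?lac_ge0 ?lac_le1.
by exists g0; split => //; exact: lacunary_totally_unbounded.
Qed.

End main.

Theorem theorem7p1 (R : realType) :
  (forall p : \bar R, (1%:E < p)%E ->
    let X := metric_sub (lpa p) (dist_lpa p) in
    (Gdelta [set f : X | totally_unbounded (set_val f)] /\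
     dense [set f : X | totally_unbounded (set_val f)]) /\
    (Gdelta [set f : X | ~ extendable (set_val f)] /\
     dense [set f : X | ~ extendable (set_val f)])) /\
  (let X := metric_sub (@c0a R) (dist_lpa +oo%E) in
    (Gdelta [set f : X | totally_unbounded (set_val f)] /\
     dense [set f : X | totally_unbounded (set_val f)]) /\
    (Gdelta [set f : X | ~ extendable (set_val f)] /\
     dense [set f : X | ~ extendable (set_val f)])) /\
  (forall (q : R) (pn : nat -> R), 1 <= q ->
    decreasing_seq pn -> pn @ \oo --> q ->
    let X := metric_sub (Xq q) (dist_Xq pn) in
    (Gdelta [set f : X | totally_unbounded (set_val f)] /\
     dense [set f : X | totally_unbounded (set_val f)]) /\
    (Gdelta [set f : X | ~ extendable (set_val f)] /\
     dense [set f : X | ~ extendable (set_val f)])).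
Proof.
have [g0 [hg cg tg]] := @exists_lacunary R.
split; [|split].
- move=> [p||] // p1.
    rewrite lte_fin in p1.
    apply: (generic_functions (g0 := g0)) tg _.
    - by move=> f /lpaP[].
    - move=> f e lf e0; exists e; first exact: e0.
    move=> g lg dfg n.
      exact: le_trans (coef_le_dist_lpa n p1 lf lg) (ltW dfg).
    move=> f e lf e0; have [K K0 hK] := perturb_lpa hg cg p1.
    exists (e / (K + 1)); first by rewrite divr_gt0// ltr_wpDl.
    move=> delta /andP[d0 hd]; have [h1 h2] := hK f delta lf (ltW d0); split; first exact: h1.
    apply: le_lt_trans h2 _; rewrite ltr_pdivlMr ?ltr_wpDl// in hd.
    by apply: le_lt_trans hd; rewrite ler_wpM2l ?(ltW d0)// lerDl.
  apply: (generic_functions (g0 := g0)) tg _.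
  - by move=> f /lpa_pinftyP[].
  - move=> f e lf e0; exists e; first exact: e0.
    move=> g lg dfg n.
    exact: le_trans (coef_le_dist_lpa_pinfty n lf lg) (ltW dfg).
  move=> f e lf e0; exists e; first exact: e0.
  move=> delta /andP[d0 hd].
  have [h1 h2] := perturb_lpa_pinfty hg cg lf (ltW d0); split; first exact: h1.
  exact: le_lt_trans h2 hd.
- apply: (generic_functions (g0 := g0)) tg _.
  - by move=> f [].
  - move=> f e lf e0; exists e; first exact: e0.
    move=> g lg dfg n.
    exact: le_trans (coef_le_dist_lpa_pinfty n (c0a_lpa lf) (c0a_lpa lg)) (ltW dfg).
  move=> f e lf e0; exists e; first exact: e0.
  move=> delta /andP[d0 hd].
  have [h1 h2] := perturb_lpa_pinfty hg cg (c0a_lpa lf) (ltW d0); split; first exact: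
    (perturb_c0a hg cg lf (ltW d0)).
  exact: le_lt_trans h2 hd.
move=> q pn q1 pn_dec pn_q.
(* The limit of a nonincreasing sequence is a lower bound for it; applied at [n.+1], the strict
   decrease gives [q < pn n]. *)
have qpn n : q < pn n.
  have lt_pn : pn n.+1 < pn n by rewrite ltNge pn_dec ltnn.
  apply: le_lt_trans lt_pn.
  have -> : q = limn pn by apply/esym/cvg_lim.
  apply: nonincreasing_cvgn_ge; last by apply/cvg_ex; exists q.
  by move=> i j ij; rewrite pn_dec.
apply: (generic_functions (g0 := g0)) tg _.
- by move=> f Xf; have /lpaP[] := Xq_lpa Xf (qpn 0%N).
- by move=> f e; exact: Xq_close_coef.
- by move=> f e; exact: Xq_perturb.
Qed.
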